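(* Let $A$ be a commutative $\mathbb{Q}$-algebra and let $I$ be an $A$-valued formal cell-zeta integral, i.e. an assignment $(S,o,\omega)\mapsto I(S,o,\omega)\in A$ as defined in the context, that satisfies all generalized shuffle relations and all generalized stuffle relations. For a convergent sequence $\mathbf{k}$ put $\zeta^I(\mathbf{k})=I(S_w,o_{st},\omega_{\mathbf{k}})$, where $w=w(\mathbf{k})$. Then for all convergent sequences $\mathbf{k}$ and $\mathbf{l}$ the shuffle relation $$\zeta^I(\mathbf{k})\,\zeta^I(\mathbf{l})=\sum_{\mathbf{s}\in\mathrm{sh}(\mathbf{k},\mathbf{l})}\zeta^I(\mathbf{s})$$ and the stuffle relation $$\zeta^I(\mathbf{k})\,\zeta^I(\mathbf{l})=\sum_{\mathbf{s}\in\mathrm{st}(\mathbf{k},\mathbf{l})}\zeta^I(\mathbf{s})$$ hold in $A$ (sums over multisets, with multiplicity). In other words, the generalized shuffle relations and the generalized stuffle relations jointly imply the shuffle relations and the stuffle relations.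
   Context: **Moduli spaces.** For a finite set $S$ with $|S|\ge 3$, $\mathcal{M}_{0,S}$ is the moduli space of embeddings $S\hookrightarrow\mathbb{P}^1$ into the complex projective line modulo the Möbius group, and $\overline{\mathcal{M}}_{0,S}$ is its compactification by stable genus-0 curves with points marked by $S$. The irreducible components of $\overline{\mathcal{M}}_{0,S}\setminus\mathcal{M}_{0,S}$ are normal crossing divisors indexed by partitions $S=A\sqcup B$ with $|A|,|B|\ge 2$. If $S$ is cyclically ordered, $\mathcal{M}^\delta_{0,S}$ is the open subvariety of $\overline{\mathcal{M}}_{0,S}$ obtained by adding to $\mathcal{M}_{0,S}$ only those boundary divisors for which $A$ and $B$ are both sets of cyclically consecutive elements (precisely, the complement in $\overline{\mathcal{M}}_{0,S}$ of all other boundary divisors). It is a smooth affine variety of dimension $|S|-3$ and is the same for a cyclic order and its reverse. For $T\subset S$ with $|T|\ge 3$ and the induced cyclic order there is a forgetful map $\mathcal{M}^\delta_{0,S}\to\mathcal{M}^\delta_{0,T}$. Regular differential forms are algebraic differential forms. **Cells.** Write $S=[s_1,s_2,s_3,s_4,\dots,s_{n+3}]$ (cyclic order). Put the points labeled $s_1,s_2,s_3$ at $0,\infty,1$; the coordinates $t_1,\dots,t_n$ of the points labeled $s_4,\dots,s_{n+3}$ are called simplicial coordinates. The set $\{1>t_1>\dots>t_n>0\}\subset\mathcal{M}_{0,S}$ depends only on the cyclic order and is the same for the reversed cyclic order. Its closure in $\mathcal{M}^\delta_{0,S}$ is compact and is denoted $\Delta(S)$. **Formal integrals.** An $A$-valued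 formal cell-zeta integral assigns an element $I(S,o,\omega)\in A$ (standing for $\int_{\Delta(S)}\omega$) to each finite cyclically ordered set $S$ with $|S|\ge3$, orientation $o$ of the interior of $\Delta(S)$, and regular differential form $\omega$ of top degree $|S|-3$ on $\mathcal{M}^\delta_{0,S}$, such that $I$ is $\mathbb{Q}$-linear in $\omega$, $I(S,-o,\omega)=-I(S,o,\omega)$, and $I$ is invariant under relabeling by isomorphisms of cyclically ordered sets. Write $\phi\boxtimes\psi=\mathrm{pr}_1^*\phi\wedge\mathrm{pr}_2^*\psi$. **Generalized shuffle relations.** Let $\underline{\mathbf{3}}$ be a cyclically ordered set with three elements. A 3-pointed cyclically ordered set $\mathcal{T}=(T,\imath)$ is a finite cyclically ordered set $T$ with an injection $\imath\colon\underline{\mathbf{3}}\hookrightarrow T$ preserving the cyclic order. For 3-pointed $\mathcal{T}_1,\mathcal{T}_2$, $\mathfrak{sh}(\mathcal{T}_1,\mathcal{T}_2)$ is the set of all cyclic orders on the pushout of sets $T_1\coprod_{\underline{\mathbf{3}}}T_2$ restricting to the given cyclic orders on $T_1$ and $T_2$. For $C\in\mathfrak{sh}(\mathcal{T}_1,\mathcal{T}_2)$ let $\beta_C\colon\mathcal{M}^\delta_{0,C}\to\mathcal{M}^\delta_{0,T_1}\times\mathcal{M}^\delta_{0,T_2}$ be the forgetful map on each factor. The generalized shuffle relations are: for all such $\mathcal{T}_1,\mathcal{T}_2$, all orientations $o_i$ of $\Delta(T_i)$, and all regular top-degree forms $\phi$ on $\mathcal{M}^\delta_{0,T_1}$, $\psi$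 on $\mathcal{M}^\delta_{0,T_2}$, $$I(T_1,o_1,\phi)\cdot I(T_2,o_2,\psi)=\sum_{C\in\mathfrak{sh}(\mathcal{T}_1,\mathcal{T}_2)}I(C,o_C,\beta_C^*(\phi\boxtimes\psi)),$$ where $o_C$ is the pullback under $\beta_C$ of the product orientation $o_1\times o_2$. **Generalized stuffle relations.** Let $\underline{\mathbf{4}}$ be a cyclically ordered set with four elements. A 4-pointed cyclically ordered set $\mathcal{T}=(T,\imath)$ is a finite cyclically ordered set $T$ with an injection $\imath\colon\underline{\mathbf{4}}\hookrightarrow T$ preserving the cyclic order. The Klein four-group $V$ acts on $\underline{\mathbf{4}}$ by the identity and the three fixed-point-free involutions; half of its elements preserve the cyclic order of $\underline{\mathbf{4}}$ and half reverse it. For $\nu\in V$, $\mathcal{T}^\nu=(T^\nu,\imath\circ\nu)$, where $T^\nu=T$ if $\nu$ preserves the cyclic order of $\underline{\mathbf{4}}$ and $T^\nu=T^{op}$ (reversed cyclic order) otherwise. For 4-pointed $\mathcal{T}_1,\mathcal{T}_2$, $\mathfrak{st}(\mathcal{T}_1,\mathcal{T}_2)$ is the set of all cyclic orders on the pushout $T_1\coprod_{\underline{\mathbf{4}}}T_2$ restricting to the given cyclic orders on $T_1$ and $T_2$. For $C\in\mathfrak{st}(\mathcal{T}_1,\mathcal{T}_2)$ and $C_\nu\in\mathfrak{st}(\mathcal{T}_1,\mathcal{T}_2^\nu)$ let $\gamma_C,\gamma_{C_\nu}$ be the maps from $\mathcal{M}^\delta_{0,C}$, resp. $\mathcal{M}^\delta_{0,C_\nu}$,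 to $\mathcal{M}^\delta_{0,T_1}\times\mathcal{M}^\delta_{0,T_2}$ given by the forgetful map on each factor (using $\mathcal{M}^\delta_{0,T_2^\nu}=\mathcal{M}^\delta_{0,T_2}$). The generalized stuffle relations are: for all 4-pointed $\mathcal{T}_1,\mathcal{T}_2$, all non-trivial $\nu\in V$, and all regular forms $\phi$ on $\mathcal{M}^\delta_{0,T_1}$, $\psi$ on $\mathcal{M}^\delta_{0,T_2}$ with $\deg\phi+\deg\psi=|T_1|+|T_2|-7$, $$\sum_{C\in\mathfrak{st}(\mathcal{T}_1,\mathcal{T}_2)}I(C,o_C,\gamma_C^*(\phi\boxtimes\psi))=\epsilon\sum_{C_\nu\in\mathfrak{st}(\mathcal{T}_1,\mathcal{T}_2^\nu)}I(C_\nu,o_{C_\nu},\gamma_{C_\nu}^*(\phi\boxtimes\psi)),$$ where $\epsilon=(-1)^{(|T_2|-3)(|T_2|-2)/2}$ if $\nu$ reverses the cyclic order on $\underline{\mathbf{4}}$ and $\epsilon=1$ otherwise. The orientations are as follows. Fix any orientation of $\Delta(T_1)$ and any listing $T_2=[s_1,\dots,s_{m+3}]$; orient $\Delta(T_2)$ by $dt_1\wedge\dots\wedge dt_m$ in the corresponding simplicial coordinates, and orient $\Delta(T_2^\nu)$ likewise, using the same listing if $\nu$ preserves the cyclic order of $\underline{\mathbf{4}}$ and the listing $[s_3,s_2,s_1,s_{m+3},\dots,s_4]$ if it reverses it. Fix a nowhere vanishing 1-form $\theta$ on the interior of $\Delta(\underline{\mathbf{4}})$. If the orientations of $\Delta(T_1),\Delta(T_2)$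 are locally given by $\pi_1^*\theta\wedge\eta_1$ and $\pi_2^*\theta\wedge\eta_2$, with $\pi_i\colon\Delta(T_i)\to\Delta(\underline{\mathbf{4}})$ the forgetful maps determined by $\imath_i$, then $o_C$ is given by $\theta\wedge\eta_1\wedge\eta_2$ (pulled back to $\Delta(C)$); $o_{C_\nu}$ is defined in the same way from $\Delta(T_1)$ and $\Delta(T_2^\nu)$ with the same $\theta$. **Multiple zeta forms.** A convergent sequence is a finite nonempty sequence $\mathbf{k}=(k_1,\dots,k_n)$ of positive integers with $k_1\ge2$; its weight is $w(\mathbf{k})=k_1+\dots+k_n$. For $w\geq 1$ let $S_w=[\underline{0},\underline{\infty},\underline{1},1,\dots,w]$ with simplicial coordinates $t_1,\dots,t_w$ ($\underline0,\underline\infty,\underline1$ at $0,\infty,1$), and let $o_{st}$ be the orientation $dt_1\wedge\dots\wedge dt_w$. Put $\omega_{\mathbf{k}}=\omega_1(t_1)\wedge\dots\wedge\omega_{w(\mathbf{k})}(t_{w(\mathbf{k})})$, where $\omega_i(t)=dt/(1-t)$ if $i\in\{k_1,k_1+k_2,\dots,k_1+\dots+k_n\}$ and $\omega_i(t)=dt/t$ otherwise. For convergent $\mathbf{k}$ this is a regular form on $\mathcal{M}^\delta_{0,S_{w(\mathbf{k})}}$, and $\int_{\Delta(S_{w(\mathbf{k})})}\omega_{\mathbf{k}}=\zeta(\mathbf{k})$ is the multiple zeta value. **Shuffle product of sequences.** To a sequence $\mathbf{k}=(k_1,\dots,k_n)$ of positive integers associate the word $z_{\mathbf{k}}=x^{k_1-1}y\,x^{k_2-1}y\cdots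 x^{k_n-1}y$; this is a bijection between sequences and words in $x,y$ ending in $y$. The shuffle product of words is the multiset given recursively by $\mathrm{sh}(v z_1,u z_2)=v\cdot\mathrm{sh}(z_1,u z_2)\cup u\cdot\mathrm{sh}(v z_1,z_2)$ for letters $u,v\in\{x,y\}$, and $\mathrm{sh}(1,z)=\mathrm{sh}(z,1)=\{z\}$ (unions are multiset sums; a letter acts elementwise by left concatenation). Via the bijection this defines the multiset $\mathrm{sh}(\mathbf{k},\mathbf{l})$ of sequences. **Stuffle product of sequences.** Let $\mathbf{k}\cdot x$ denote the sequence $\mathbf{k}$ with $x$ appended at the end, and $()$ the empty sequence. The multiset $\mathrm{st}(\mathbf{k},\mathbf{l})$ is given recursively by $\mathrm{st}(\mathbf{k}\cdot x,\mathbf{l}\cdot y)=\mathrm{st}(\mathbf{k}\cdot x,\mathbf{l})\cdot y\,\cup\,\mathrm{st}(\mathbf{k},\mathbf{l}\cdot y)\cdot x\,\cup\,\mathrm{st}(\mathbf{k},\mathbf{l})\cdot(x+y)$ and $\mathrm{st}((),\mathbf{k})=\mathrm{st}(\mathbf{k},())=\{\mathbf{k}\}$. For convergent $\mathbf{k},\mathbf{l}$ all elements of $\mathrm{sh}(\mathbf{k},\mathbf{l})$ and $\mathrm{st}(\mathbf{k},\mathbf{l})$ are convergent. *)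

(* Defs.v *)
From HB Require Import structures.
From mathcomp Require Import all_boot all_order all_algebra.
From mathcomp Require Import perm complex.
From mathcomp Require Import reals topology normedtype.
From mathcomp Require Import zify.

Set Implicit Arguments.
Unset Strict Implicit.
Unset Printing Implicit Defensive.

Import Order.TTheory GRing.Theory Num.Theory numFieldNormedType.Exports.
Local Open Scope ring_scope.

(** * Cyclic orders *)

(* A cyclic order is the set of triples (a, b, d) such that, going round
   strictly once from a, one meets b before d. *)
Definition cyc_axiom (S : finType) (c : {set S * S * S}) : bool :=
  [&& [forall a, forall b, forall d, ((a, b, d) \in c) ==> ((b, d, a) \in c)],
      [forall a, forall b, forall d, ((a, b, d) \in c) ==> ((d, b, a) \notin c)],
      [forall a, forall b, forall d, forall e,
         ((a, b, d) \in c) && ((a, d, e) \in c) ==> ((a, b, e) \in c)]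
    & [forall a, forall b, forall d, uniq [:: a; b; d] ==>
         ((a, b, d) \in c) || ((d, b, a) \in c)]].

Definition cycord (S : finType) := {c : {set S * S * S} | cyc_axiom c}.

Definition in_cyc (S : finType) (c : cycord S) (a b d : S) : bool :=
  (a, b, d) \in val c.

Lemma cyc_axiomP (S : finType) (c : {set S * S * S}) :
  reflect
    [/\ forall a b d, (a, b, d) \in c -> (b, d, a) \in c,
        forall a b d, (a, b, d) \in c -> (d, b, a) \notin c,
        forall a b d e, (a, b, d) \in c -> (a, d, e) \in c -> (a, b, e) \in c
      & forall a b d, uniq [:: a; b; d] ->
          ((a, b, d) \in c) || ((d, b, a) \in c)]
    (cyc_axiom c).
Proof.
apply: (iffP and4P) => -[h1 h2 h3 h4]; split.
- by move=> a b d; move/forallP/(_ a)/forallP/(_ b)/forallP/(_ d)/implyP: h1.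
- by move=> a b d; move/forallP/(_ a)/forallP/(_ b)/forallP/(_ d)/implyP: h2.
- move=> a b d e habd hade.
  move/forallP/(_ a)/forallP/(_ b)/forallP/(_ d)/forallP/(_ e)/implyP: h3.
  by apply; rewrite habd.
- by move=> a b d; move/forallP/(_ a)/forallP/(_ b)/forallP/(_ d)/implyP: h4.
- by do 3![apply/forallP => ?]; apply/implyP; apply: h1.
- by do 3![apply/forallP => ?]; apply/implyP; apply: h2.
- by do 4![apply/forallP => ?]; apply/implyP => /andP[]; apply: h3.
- by do 3![apply/forallP => ?]; apply/implyP; apply: h4.
Qed.

Lemma cyc_rev_subproof (S : finType) (c : cycord S) :
  cyc_axiom [set x : S * S * S | in_cyc c x.2 x.1.2 x.1.1].
Proof.
have /cyc_axiomP[rot asym trans tot] := valP c.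
rewrite /in_cyc; apply/cyc_axiomP; split=> [a b d|a b d|a b d e|a b d];
  rewrite !inE /=.
- by move/rot/rot.
- exact: asym.
- by move=> /rot/rot adb /rot/rot aed; apply/rot/(trans _ _ _ _ aed).
- by rewrite orbC; apply: tot.
Qed.

Definition cyc_rev (S : finType) (c : cycord S) : cycord S :=
  exist (fun c => is_true (cyc_axiom c)) _ (cyc_rev_subproof c).

Definition cyc_nat (i j k : nat) : bool :=
  [|| (i < j < k)%N, (j < k < i)%N | (k < i < j)%N].

Lemma cyc_std_subproof (n : nat) :
  cyc_axiom [set x : 'I_n * 'I_n * 'I_n | cyc_nat x.1.1 x.1.2 x.2].
Proof.
rewrite /cyc_nat; apply/cyc_axiomP; split=> [a b d|a b d|a b d e|a b d];
  rewrite !inE /=; try lia.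
by rewrite !inE !negb_or -!val_eqE /=; lia.
Qed.

Definition cyc_std (n : nat) : cycord 'I_n :=
  exist (fun c => is_true (cyc_axiom c)) _ (cyc_std_subproof n).

(* "c = [s_1, s_2, ...]" *)
Definition listing (S : finType) (c : cycord S) (s : seq S) : bool :=
  [&& uniq s, [forall a, a \in s]
    & [forall a, forall b, forall d,
         in_cyc c a b d == cyc_nat (index a s) (index b s) (index d s)]].

Definition consecutive (S : finType) (c : cycord S) (A : {set S}) : Prop :=
  exists2 s : seq S, listing c s & A = [set a in take #|A| s].

(* For an injective f: f preserves the cyclic order, equivalently c' restricts
   along f to c. *)
Definition cyc_emb (T S : finType) (f : T -> S) (c : cycord T) (c' : cycord S) :
    bool :=
  [forall a, forall b, forall d, in_cyc c a b d == in_cyc c' (f a) (f b) (f d)].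

Definition is_pushout (K T1 T2 P : Type) (i1 : K -> T1) (i2 : K -> T2)
    (j1 : T1 -> P) (j2 : T2 -> P) : Prop :=
  (forall k, j1 (i1 k) = j2 (i2 k)) /\
  forall (X : Type) (f1 : T1 -> X) (f2 : T2 -> X),
    (forall k, f1 (i1 k) = f2 (i2 k)) ->
    exists! h : P -> X,
      (forall x, h (j1 x) = f1 x) /\ (forall x, h (j2 x) = f2 x).

Record embedding (T S : Type) :=
  Embedding { emb_fun :> T -> S; emb_inj : injective emb_fun }.

Definition emb_comp (K T S : Type) (f : embedding T S) (g : embedding K T) :
    embedding K S :=
  Embedding (inj_comp (@emb_inj _ _ f) (@emb_inj _ _ g)).

Definition emb_perm (S : finType) (p : {perm S}) : embedding S S :=
  Embedding (@perm_inj _ p).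

(** * Differential forms on M_{0,S} *)

(* A point of M_{0,S}(F), i.e. an embedding of S into P^1(F) up to Mobius
   transformations, is represented by an embedding avoiding infinity; over the
   fields R and C every Mobius class contains such embeddings.  Functions and
   forms on M_{0,S} are identified with their pullbacks to the space of these
   embeddings; as they are all built from cross-ratios, these pullbacks are
   invariant. *)
Notation conf F S := (embedding S F) (only parsing).

(* omega z [:: v_1; ...; v_k] is the value of the form omega at the point z on
   the tangent vectors v_i : S -> F.  A form of degree k vanishes on lists of
   length other than k. *)
Definition form (F : fieldType) (S : Type) := conf F S -> seq (S -> F) -> F.

Section Forms.
Variables (F : fieldType) (S : Type).
Implicit Types (w : form F S) (z : conf F S).

Definition form_scale (f : conf F S -> F) w : form F S :=
  fun z vs => f z * w z vs.

(* The number of inversions of the shuffle that moves the entries selected by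
   the mask m to the front. *)
Fixpoint mask_inv (m : bitseq) : nat :=
  if m is b :: m' then ((if b then 0 else count id m') + mask_inv m')%N else 0%N.

Definition wedge w1 w2 : form F S := fun z vs =>
  \sum_(m : (size vs).-tuple bool)
    (-1) ^+ mask_inv m * w1 z (mask m vs) * w2 z (mask (map negb m) vs).

Definition form1 : form F S := fun _ vs => (size vs == 0%N)%:R.

Definition wedges (ws : seq (form F S)) : form F S := foldr wedge form1 ws.

End Forms.

(* The forgetful map M_{0,S} -> M_{0,T} of f : T -> S restricts z along f;
   pull f is the pullback of forms along it. *)
Definition pull (F : fieldType) (T S : Type) (f : embedding T S) (w : form F T) :
    form F S :=
  fun z vs => w (emb_comp z f) [seq v \o f | v <- vs].

Definition quad (S : Type) := (S * S * S * S)%type.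

Definition distinct (S : eqType) (q : quad S) : bool :=
  let: (i, j, k, l) := q in uniq [:: i; j; k; l].

Definition cross_ratio (F : fieldType) (S : Type) (q : quad S) (x : S -> F) : F :=
  let: (i, j, k, l) := q in
  (x i - x k) * (x j - x l) / ((x i - x l) * (x j - x k)).

(* The differential of the cross-ratio, by logarithmic differentiation. *)
Definition dcr (F : fieldType) (S : Type) (q : quad S) : form F S := fun z vs =>
  if vs is [:: v] then
    let: (i, j, k, l) := q in
    let dlog a b := (v a - v b) / (z a - z b) in
    cross_ratio q z * (dlog i k + dlog j l - dlog i l - dlog j k)
  else 0.

(* The cross-ratios that are the simplicial coordinates t_1, ..., t_n of the
   listing s = [:: s_1; s_2; s_3; s_4; ...], i.e. the coordinates of
   s_4, s_5, ... when s_1, s_2, s_3 are put at 0, oo, 1. *)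
Definition simplicial (S : Type) (s : seq S) : seq (quad S) :=
  if s is [:: s1, s2, s3 & r] then [seq (x, s3, s1, s2) | x <- r] else [::].

Definition simplicial_vol (F : fieldType) (S : Type) (s : seq S) : form F S :=
  wedges [seq @dcr F S q | q <- simplicial s].
Arguments simplicial_vol F {S} s.

(** * Stable curves and regular forms on M^delta_{0,S} *)

(* A stable curve of genus 0 with points marked by S: a tree of projective
   lines (vertices are components, edges are nodes).  On every component a
   coordinate is chosen for which no marked point or node is at infinity. *)
Record stable_curve (F : fieldType) (S : finType) := StableCurve {
  comp : finType;
  adj : rel comp;
  mark : S -> comp;
  pos : S -> F;
  (* node v w: coordinate, on the component v, of the node joining v and w *)
  node : comp -> comp -> F;
  adj_sym : symmetric adj;
  adj_irr : irreflexive adj;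
  adj_connected : forall v w, connect adj v w;
  adj_acyclic : forall v w, adj v w ->
    ~~ connect [rel x y | adj x y && ([set x; y] != [set v; w])] v w;
  pos_inj : forall s t, mark s = mark t -> pos s = pos t -> s = t;
  node_inj : forall v w u, adj v w -> adj v u -> node v w = node v u -> w = u;
  pos_node : forall s w, adj (mark s) w -> pos s <> node (mark s) w;
  stability : forall v,
    (3 <= #|[set s | mark s == v]| + #|[set w | adj v w]|)%N
}.

Section Regular.
Variables (F : fieldType) (S : finType).
Implicit Types (X : stable_curve F S) (c : cycord S).

(* The marked points beyond w, seen from the component v, when v and w meet. *)
Definition branch X (v w : comp X) : {set S} :=
  [set s | connect [rel x y | adj x y && ([set x; y] != [set v; w])] w (mark X s)].

(* X lies on the boundary divisor of the partition of S into A and ~: A. *)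
Definition on_divisor (A : {set S}) X : Prop :=
  exists v w : comp X, adj v w /\ A = branch v w.

Definition in_Mdelta c X : Prop :=
  forall A : {set S}, on_divisor A X -> consecutive c A /\ consecutive c (~: A).

(* The image of the marked point s under the contraction of X onto v. *)
Definition proj X (v : comp X) (s : S) : F :=
  if mark X s == v then pos X s
  else if [pick w | adj v w && (s \in branch v w)] is Some w then node v w
  else 0.

(* The cross-ratios of four distinct marked points extend to maps from the
   moduli space of stable curves to P^1, evaluated at X on any component to
   which at least three of the four points project differently.  (Such
   components exist and give the same value.)  Together these maps embed this
   moduli space in a product of projective lines. *)
Definition sees X (v : comp X) (q : quad S) : bool :=
  let: (i, j, k, l) := q in
  (3 <= size (undup [seq proj v s | s <- [:: i; j; k; l]]))%N.

Definition cr_finite X (q : quad S) : bool :=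
  let: (i, j, k, l) := q in
  [forall v : comp X, sees v q ==>
     (proj v i != proj v l) && (proj v j != proj v k)].

Definition cr_value X (q : quad S) : F :=
  if [pick v : comp X | sees v q] is Some v then cross_ratio q (proj v) else 0.

(* cr_poly X f a: f is a polynomial in the cross-ratios that are finite at X,
   and a is its value at X. *)
Inductive cr_poly X : (conf F S -> F) -> F -> Prop :=
| Cr_const a : cr_poly X (fun _ => a) a
| Cr_gen q : distinct q -> cr_finite X q ->
    cr_poly X (fun z => cross_ratio q z) (cr_value X q)
| Cr_add f a g b : cr_poly X f a -> cr_poly X g b ->
    cr_poly X (fun z => f z + g z) (a + b)
| Cr_mul f a g b : cr_poly X f a -> cr_poly X g b ->
    cr_poly X (fun z => f z * g z) (a * b).

(* The local ring at X is the localization of the ring of these polynomials at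
   those with nonzero value, so that its k-forms are the sums of
   (f / h) d q_1 /\ ... /\ d q_k with f, h polynomials in and q_1, ..., q_k
   among the cross-ratios finite at X, and h nonzero at X. *)
Definition regular_at X (k : nat) (w : form F S) : Prop :=
  exists (h : conf F S -> F) (a : F) (l : seq ((conf F S -> F) * seq (quad S))),
  [/\ cr_poly X h a, a != 0,
      (forall x, List.In x l ->
         [/\ exists b, cr_poly X x.1 b, size x.2 = k
           & all (fun q => distinct q && cr_finite X q) x.2])
    & forall z vs, h z * w z vs =
        \sum_(x <- l) x.1 z * wedges [seq @dcr F S q | q <- x.2] z vs].

(* Regular k-forms on M^delta_{0,S}, represented by their restrictions to the
   dense open subset M_{0,S}. *)
Definition regular_form c (k : nat) (w : form F S) : Prop :=
  forall X, in_Mdelta c X -> regular_at X k w.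

End Regular.

(** * The cells and their orientations *)

Section Orientations.
Variables (R : realType) (S : finType).
Implicit Types (c : cycord S) (z : conf R S).

(* z represents a point of the interior of Delta(S). *)
Definition in_cell c z : bool :=
  [exists s : #|S|.-tuple S, listing c s &&
    path >%R 1 (rcons [seq cross_ratio q z | q <- simplicial s] 0)].

(* An orientation is given by a nowhere vanishing top-degree form eta up to
   positive functions, that is, by the sign of eta on tangent frames at the
   points of the cell (extended by 0). *)
Definition orientation := form R S.

Definition orient c (eta : form R S) : orientation :=
  fun z vs => if in_cell c z then Num.sg (eta z vs) else 0.

Definition orient_opp (o : orientation) : orientation := fun z vs => - o z vs.

(* Simplicial coordinates identify the interior of Delta(S) with an open
   simplex, so that there are exactly two orientations. *)
Definition is_orientation c (o : orientation) : Prop :=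
  exists2 s : seq S, listing c s &
    o = orient c (simplicial_vol R s) \/
    o = orient_opp (orient c (simplicial_vol R s)).

(* eta is a real differential k-form on M_{0,S}: at each point it is an element
   of the k-th exterior power of the cotangent space.  Smoothness is not
   required, as only signs of eta are used. *)
Definition diff_form (k : nat) (eta : form R S) : Prop :=
  forall z, exists l : seq (R * seq (quad S)),
    all (fun x => (size x.2 == k) && all (@distinct S) x.2) l /\
    forall vs, eta z vs =
      \sum_(x <- l) x.1 * wedges [seq @dcr R S q | q <- x.2] z vs.

End Orientations.

(* The simplicial coordinate on Delta(4) for the listing [0, 1, 2, 3]. *)
Definition t4 : quad 'I_4 := (inord 3, inord 2, inord 0, inord 1).

(* A nowhere vanishing continuous 1-form g(t) dt on the interior ]0, 1[ of
   Delta(4). *)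
Definition nonvanishing_1form (R : realType) (theta : form R 'I_4) : Prop :=
  exists g : R -> R,
    [/\ {in `]0, 1[, continuous g}, {in `]0, 1[, forall t, g t != 0}
      & theta = form_scale (fun z => g (cross_ratio t4 z)) (@dcr R _ t4)].

(** * Formal cell-zeta integrals *)

Section Formal.
Variables (R : realType) (A : comAlgType rat).

Definition integral_data := forall (S : finType) (c : cycord S),
  orientation R S -> form R[i] S -> A.

Definition top_form (S : finType) (c : cycord S) (w : form R[i] S) : Prop :=
  regular_form c (#|S| - 3) w.

(* The values of I matter only when #|S| >= 3, the third argument is an
   orientation and the fourth one is a regular form of top degree. *)
Definition formal_cell_zeta (I : integral_data) : Prop :=
  [/\ forall (S : finType) (c : cycord S) (o : orientation R S) (a : rat)
        (w1 w2 : form R[i] S),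
        (3 <= #|S|)%N -> is_orientation c o -> top_form c w1 -> top_form c w2 ->
        I S c o (fun z vs => ratr a * w1 z vs + w2 z vs) =
        a *: I S c o w1 + I S c o w2,
      forall (S : finType) (c : cycord S) (o : orientation R S) (w : form R[i] S),
        (3 <= #|S|)%N -> is_orientation c o -> top_form c w ->
        I S c (orient_opp o) w = - I S c o w
    & forall (S S' : finType) (c : cycord S) (c' : cycord S')
        (f : embedding S S') (o : orientation R S) (w : form R[i] S),
        (3 <= #|S|)%N -> bijective f -> cyc_emb f c c' ->
        is_orientation c o -> top_form c w ->
        I S' c' (pull f o) (pull f w) = I S c o w].

(* The orientations o_1, o_2 are those given by eta_1, eta_2. *)
Definition generalized_shuffle (I : integral_data) : Prop :=
  forall (T1 T2 P : finType) (c1 : cycord T1) (c2 : cycord T2)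
    (i1 : embedding 'I_3 T1) (i2 : embedding 'I_3 T2)
    (j1 : embedding T1 P) (j2 : embedding T2 P)
    (eta1 : form R T1) (eta2 : form R T2)
    (phi : form R[i] T1) (psi : form R[i] T2),
  cyc_emb i1 (cyc_std 3) c1 -> cyc_emb i2 (cyc_std 3) c2 ->
  is_pushout i1 i2 j1 j2 ->
  diff_form (#|T1| - 3) eta1 -> is_orientation c1 (orient c1 eta1) ->
  diff_form (#|T2| - 3) eta2 -> is_orientation c2 (orient c2 eta2) ->
  top_form c1 phi -> top_form c2 psi ->
  I T1 c1 (orient c1 eta1) phi * I T2 c2 (orient c2 eta2) psi =
  \sum_(C : cycord P | cyc_emb j1 c1 C && cyc_emb j2 c2 C)
    I P C (orient C (wedge (pull j1 eta1) (pull j2 eta2)))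
      (wedge (pull j1 phi) (pull j2 psi)).

(* The nontrivial elements of the Klein four-group: fixed-point-free
   involutions. *)
Definition klein_nontrivial (nu : {perm 'I_4}) : bool :=
  [forall x, (nu (nu x) == x) && (nu x != x)].

Definition cyc_twist (nu : {perm 'I_4}) (T : finType) (c : cycord T) : cycord T :=
  if cyc_emb nu (cyc_std 4) (cyc_std 4) then c else cyc_rev c.

(* [s_3, s_2, s_1, s_{m+3}, ..., s_4] *)
Definition rev_listing (T : Type) (s : seq T) : seq T :=
  if s is [:: s1, s2, s3 & r] then [:: s3, s2, s1 & rev r] else s.

Definition listing_twist (nu : {perm 'I_4}) (T : Type) (s : seq T) : seq T :=
  if cyc_emb nu (cyc_std 4) (cyc_std 4) then s else rev_listing s.

Definition stuffle_sign (nu : {perm 'I_4}) (T : finType) : A :=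
  if cyc_emb nu (cyc_std 4) (cyc_std 4) then 1
  else (-1) ^+ (((#|T| - 3) * (#|T| - 2)) %/ 2).

(* One side of the stuffle relation: the sum over the cyclic orders on the
   pushout P, with the orientations given by theta /\ eta_1 /\ eta_2. *)
Definition stuffle_sum (I : integral_data) (T1 T2 P : finType)
    (c1 : cycord T1) (c2 : cycord T2) (i1 : embedding 'I_4 T1)
    (j1 : embedding T1 P) (j2 : embedding T2 P)
    (theta : form R 'I_4) (eta1 : form R T1) (eta2 : form R T2)
    (phi : form R[i] T1) (psi : form R[i] T2) : A :=
  \sum_(C : cycord P | cyc_emb j1 c1 C && cyc_emb j2 c2 C)
    I P C
      (orient C (wedge (pull (emb_comp j1 i1) theta)
                       (wedge (pull j1 eta1) (pull j2 eta2))))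
      (wedge (pull j1 phi) (pull j2 psi)).

Definition generalized_stuffle (I : integral_data) : Prop :=
  forall (T1 T2 P P' : finType) (c1 : cycord T1) (c2 : cycord T2)
    (i1 : embedding 'I_4 T1) (i2 : embedding 'I_4 T2) (nu : {perm 'I_4})
    (j1 : embedding T1 P) (j2 : embedding T2 P)
    (j1' : embedding T1 P') (j2' : embedding T2 P')
    (s : seq T2) (theta : form R 'I_4)
    (eta1 : form R T1) (eta2 eta2' : form R T2)
    (p q : nat) (phi : form R[i] T1) (psi : form R[i] T2),
  let i2' := emb_comp i2 (emb_perm nu) in
  let c2' := cyc_twist nu c2 in
  cyc_emb i1 (cyc_std 4) c1 -> cyc_emb i2 (cyc_std 4) c2 ->
  klein_nontrivial nu ->
  is_pushout i1 i2 j1 j2 -> is_pushout i1 i2' j1' j2' ->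
  listing c2 s -> nonvanishing_1form theta ->
  diff_form (#|T1| - 4) eta1 ->
  is_orientation c1 (orient c1 (wedge (pull i1 theta) eta1)) ->
  diff_form (#|T2| - 4) eta2 ->
  orient c2 (wedge (pull i2 theta) eta2) = orient c2 (simplicial_vol R s) ->
  diff_form (#|T2| - 4) eta2' ->
  orient c2' (wedge (pull i2' theta) eta2') =
    orient c2' (simplicial_vol R (listing_twist nu s)) ->
  regular_form c1 p phi -> regular_form c2 q psi ->
  (p + q + 7 = #|T1| + #|T2|)%N ->
  stuffle_sum I c1 c2 i1 j1 j2 theta eta1 eta2 phi psi =
  stuffle_sign nu T2 *
  stuffle_sum I c1 c2' i1 j1' j2' theta eta1 eta2' phi psi.

(** * Multiple zeta forms *)

Definition convergent (k : seq nat) : bool :=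
  [&& k != [::], all (ltn 0) k & (2 <= head 0 k)%N].

(* dt / (1 - t) if b holds, and dt / t otherwise, for t the cross-ratio q *)
Definition zeta_letter (S : Type) (b : bool) (q : quad S) : form R[i] S :=
  form_scale
    (fun z => let t := cross_ratio q z in if b then (1 - t)^-1 else t^-1)
    (@dcr _ _ q).

(* S_w is 'I_(w + 3), where 0, 1, 2, 3, ..., w + 2 stand for the labels
   0, oo, 1, 1, ..., w; scanl addn 0 k is k_1, k_1 + k_2, ... *)
Definition zeta_form (k : seq nat) : form R[i] 'I_(sumn k).+3 :=
  wedges [seq zeta_letter (x.1 \in scanl addn 0%N k) x.2
         | x <- zip (iota 1 (sumn k)) (simplicial (enum 'I_(sumn k).+3))].
Arguments zeta_form : clear implicits.

Definition o_st (w : nat) : orientation R 'I_w.+3 :=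
  orient (cyc_std w.+3) (simplicial_vol R (enum 'I_w.+3)).
Arguments o_st : clear implicits.

Definition zetaI (I : integral_data) (k : seq nat) : A :=
  I _ (cyc_std _) (o_st (sumn k)) (zeta_form k).

End Formal.

(** * Shuffle and stuffle products of sequences *)

(* Multisets are represented by lists.  In words, x is false and y is true. *)
Definition word_of_seq (k : seq nat) : bitseq :=
  flatten [seq rcons (nseq ki.-1 false) true | ki <- k].

(* The inverse of word_of_seq; n counts the letters x since the last y. *)
Fixpoint seq_of_word_rec (n : nat) (z : bitseq) : seq nat :=
  match z with
  | [::] => [::]
  | false :: z' => seq_of_word_rec n.+1 z'
  | true :: z' => n.+1 :: seq_of_word_rec 0 z'
  end.

Definition seq_of_word (z : bitseq) : seq nat := seq_of_word_rec 0 z.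

Fixpoint sh_word (z1 : bitseq) : bitseq -> seq bitseq :=
  if z1 is v :: z1' then
    fix sh_word1 (z2 : bitseq) : seq bitseq :=
      if z2 is u :: z2' then
        [seq v :: z | z <- sh_word z1' z2] ++ [seq u :: z | z <- sh_word1 z2']
      else [:: z1]
  else fun z2 => [:: z2].

Definition sh (k l : seq nat) : seq (seq nat) :=
  [seq seq_of_word z | z <- sh_word (word_of_seq k) (word_of_seq l)].

(* The stuffle product of reversed sequences. *)
Fixpoint st_rev (k : seq nat) : seq nat -> seq (seq nat) :=
  if k is x :: k' then
    fix st_rev1 (l : seq nat) : seq (seq nat) :=
      if l is y :: l' then
        [seq y :: s | s <- st_rev1 l'] ++ [seq x :: s | s <- st_rev k' l] ++
        [seq (x + y)%N :: s | s <- st_rev k' l']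
      else [:: k]
  else fun l => [:: l].

Definition st (k l : seq nat) : seq (seq nat) :=
  [seq rev s | s <- st_rev (rev k) (rev l)].

(* Main.v *)
(* Shuffle relation. Glue the standard sets of k and l along 0, oo and 1.  The
   cyclic orders on the pushout are then the shuffles of the two lists of
   labels, and relabelling such a cyclic order to the standard one turns the
   form omega_k x omega_l into the multiple zeta form of the shuffled word; the
   signs of this permutation of the variables in the form and in the orientation
   cancel.

   Stuffle relation. In the cubical coordinates x_m = t_m / t_(m-1) the form
   omega_k is the product of the dx_m / x_m and, over the partial sums b of k, of
   X / (1 - X) for X = x_1 ... x_b; call (0, b) an arc.  The product of omega_k
   and omega_l is the same kind of form, with the arcs of k and those of l on
   consecutive blocks of variables.  Choose the four points so that both sides of
   a generalized stuffle relation, for a nu which reverses the cyclic order, have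
   a single term: it says that the order of the x_m inside a block of consecutive
   variables may be reversed.  Reversing a block of q + 1 variables and then q of
   them moves the block of l through one variable, so that it may be inserted
   anywhere between two consecutive right ends of arcs of k.  With this freedom the
   identity
     X / (1 - X) * Y / (1 - Y) = X Y / (1 - X Y) * (1 + X / (1 - X) + Y / (1 - Y))
   for the last arcs of k and l gives the recursion of the stuffle product.  All these forms
   are regular, since their poles lie among those of the generator Theta of the top-degree forms. *)

Require Import Defs.
From mathcomp Require Import all_boot all_order all_algebra.
From mathcomp Require Import reals.
From mathcomp Require Import boolp.
From mathcomp Require Import perm complex topology normedtype zify ring.
Import Defs.

Set Implicit Arguments.
Unset Strict Implicit.
Unset Printing Implicit Defensive.

Import Order.TTheory GRing.Theory Num.Theory numFieldNormedType.Exports.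
Local Open Scope ring_scope.

(* zify is slow on hypotheses about forms. *)
Ltac nlia := repeat match goal with
  | H : ?T |- _ => lazymatch T with
      | is_true (leq _ _) => fail
      | is_true (andb _ _) => fail
      | nat => fail
      | @eq nat _ _ => fail
      | is_true (negb (@eq_op Datatypes_nat__canonical__eqtype_Equality _ _)) => fail
      | _ => clear H
      end
  end; lia.

(** Stable curves are inspected only to see that a cross-ratio whose chords cross has no pole on
    M^delta. All other regularity comes from writing forms globally in such cross-ratios ([nice]).
    For Theta two expressions, usable where some 1 - x_m, respectively the x_m, are invertible, are
    combined by 1 = (2 - x) x + (1 - x)^2. The obstacle in the reversal is that both factors of the
    stuffle relation see T, the cross-ratio of the four points, while dT must be given to one of
    them. With dT in the first factor, the form on the second may get a pole at T = 0; with dT in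
    the second, the form on the first may get one at T = 1. The same identity with x = T splits the
    integrand into two products without poles. Signs of reorderings are mostly left unevaluated:
    each is one boolean valid over all fields, hence common to the real form behind the orientation
    and to the complex integrand. The stuffle recursion also starts from a generalized shuffle
    relation: with the last point of k glued to the point 1 of l there is a single cyclic order,
    which puts the two products side by side. *)

Lemma big_tuple_cons (V : nmodType) (T : finType) n (f : n.+1.-tuple T -> V) :
  \sum_m f m = \sum_b \sum_(m : n.-tuple T) f [tuple of b :: m].
Proof.
rewrite pair_bigA /=.
rewrite (reindex (fun x : T * n.-tuple T => [tuple of x.1 :: x.2])) //=.
exists (fun m : n.+1.-tuple T => (thead m, [tuple of behead m])) => [[b m] _|m _] /=.
  by congr (_, _); apply: val_inj.
by rewrite [RHS]tuple_eta; apply: val_inj.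
Qed.

Notation form_sign b := (form_scale (fun=> (-1) ^+ b)).

(** * Exterior algebra of the shuffle wedge product *)

Section WedgeAlgebra.
Variables (F : fieldType) (S : Type).
Implicit Types (w : form F S) (z : conf F S) (f : conf F S -> F).

Lemma form_ext w1 w2 : (forall z vs, w1 z vs = w2 z vs) -> w1 = w2.
Proof. by move=> e; apply/funext => z; apply/funext. Qed.

Definition form_add w1 w2 : form F S := fun z vs => w1 z vs + w2 z vs.
Definition form_cons v w : form F S := fun z vs => w z (v :: vs).
Definition form_twist w : form F S := fun z vs => (-1) ^+ size vs * w z vs.
Definition homog n w := forall z vs, size vs != n -> w z vs = 0.

Lemma count_tuple_size (T : Type) (vs : seq T) (m : (size vs).-tuple bool) :
  size (mask m vs) = count id m.
Proof. by rewrite size_mask // size_tuple. Qed.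

Lemma size_mask_compl (T : Type) (vs : seq T) (m : (size vs).-tuple bool) :
  (size (mask m vs) + size (mask [seq ~~ b | b <- m] vs))%N = size vs.
Proof.
rewrite size_mask ?size_tuple // size_mask ?size_map ?size_tuple //.
rewrite count_map -[RHS](size_tuple m) -(count_predC id m).
by congr (_ + _)%N.
Qed.

Lemma wedge_nil w1 w2 z : wedge w1 w2 z [::] = w1 z [::] * w2 z [::].
Proof.
rewrite /wedge /= (bigD1 [tuple]) //= big1 => [|m]; last by move/negP; rewrite (tuple0 m).
by rewrite addr0 expr0 mul1r.
Qed.

(** Contraction with the first vector is a graded derivation: the shuffles are sorted by the side
    that takes this vector. It makes identities between wedge products provable by induction on the
    list of vectors. *)
Lemma wedge_cons w1 w2 z v vs :
  wedge w1 w2 z (v :: vs) =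
  wedge (form_cons v w1) w2 z vs + wedge (form_twist w1) (form_cons v w2) z vs.
Proof.
rewrite /wedge /= big_tuple_cons big_bool /=; congr (_ + _); apply: eq_bigr => m _.
rewrite /form_twist /form_cons count_tuple_size exprD.
by ring.
Qed.

Lemma wedgeDl w1 w1' w2 :
  wedge (form_add w1 w1') w2 = form_add (wedge w1 w2) (wedge w1' w2).
Proof.
apply/form_ext => z vs; rewrite /wedge /form_add -big_split /=.
by apply: eq_bigr => m _; rewrite mulrDr mulrDl.
Qed.

Lemma wedgeDr w1 w2 w2' :
  wedge w1 (form_add w2 w2') = form_add (wedge w1 w2) (wedge w1 w2').
Proof.
apply/form_ext => z vs; rewrite /wedge /form_add -big_split /=.
by apply: eq_bigr => m _; rewrite mulrDr.
Qed.

Lemma wedgeZl f w1 w2 : wedge (form_scale f w1) w2 = form_scale f (wedge w1 w2).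
Proof.
apply/form_ext => z vs; rewrite /wedge /form_scale mulr_sumr.
by apply: eq_bigr => m _; ring.
Qed.

Lemma wedgeZr f w1 w2 : wedge w1 (form_scale f w2) = form_scale f (wedge w1 w2).
Proof.
apply/form_ext => z vs; rewrite /wedge /form_scale mulr_sumr.
by apply: eq_bigr => m _; ring.
Qed.

Lemma form_scaleA f g w :
  form_scale f (form_scale g w) = form_scale (fun z => f z * g z) w.
Proof. by apply/form_ext => z vs; rewrite /form_scale mulrA. Qed.

Lemma form_scaleD f w w' :
  form_scale f (form_add w w') = form_add (form_scale f w) (form_scale f w').
Proof. by apply/form_ext => z vs; rewrite /form_scale /form_add mulrDr. Qed.

Lemma form_scale1 w : form_scale (fun=> 1) w = w.
Proof. by apply/form_ext => z vs; rewrite /form_scale mul1r. Qed.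

Lemma twist_wedge w1 w2 :
  form_twist (wedge w1 w2) = wedge (form_twist w1) (form_twist w2).
Proof.
apply/form_ext => z vs; rewrite /form_twist /wedge mulr_sumr.
apply: eq_bigr => m _.
have -> : (-1) ^+ size vs = (-1) ^+ size (mask m vs) *
    (-1) ^+ size (mask [seq ~~ i | i <- m] vs) :> F.
  by rewrite -exprD; congr (_ ^+ _); rewrite size_mask_compl.
by ring.
Qed.

Lemma wedgeA w1 w2 w3 : wedge (wedge w1 w2) w3 = wedge w1 (wedge w2 w3).
Proof.
apply/form_ext => z vs; elim: vs w1 w2 w3 => [|v vs IH] w1 w2 w3.
  by rewrite !wedge_nil mulrA.
rewrite !wedge_cons twist_wedge.
have -> u1 u2 : form_cons v (wedge u1 u2) =
    form_add (wedge (form_cons v u1) u2) (wedge (form_twist u1) (form_cons v u2)).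
  by apply/form_ext => ? ?; rewrite /form_cons wedge_cons.
have -> u1 u2 : form_cons v (wedge u1 u2) =
    form_add (wedge (form_cons v u1) u2) (wedge (form_twist u1) (form_cons v u2)).
  by apply/form_ext => ? ?; rewrite /form_cons wedge_cons.
by rewrite wedgeDl wedgeDr /form_add !IH addrA.
Qed.

Lemma wedge1l w : wedge (@form1 F S) w = w.
Proof.
apply/form_ext => z vs; elim: vs w => [|v vs IH] w.
  by rewrite wedge_nil /form1 mul1r.
rewrite wedge_cons.
have -> : form_cons v (@form1 F S) = form_scale (fun=> 0) (@form1 F S).
  by apply/form_ext => ? ?; rewrite /form_cons /form_scale /form1 mul0r.
have -> : form_twist (@form1 F S) = @form1 F S.
  by apply/form_ext => ? [|? ?]; rewrite /form_twist /form1 ?mulr0 // mul1r.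
by rewrite wedgeZl /form_scale mul0r add0r IH.
Qed.

Lemma wedge1r w : wedge w (@form1 F S) = w.
Proof.
apply/form_ext => z vs; elim: vs w => [|v vs IH] w.
  by rewrite wedge_nil /form1 mulr1.
rewrite wedge_cons.
have -> : form_cons v (@form1 F S) = form_scale (fun=> 0) (@form1 F S).
  by apply/form_ext => ? ?; rewrite /form_cons /form_scale /form1 mul0r.
by rewrite wedgeZr /form_scale mul0r addr0 IH.
Qed.

Lemma wedges_cat ws1 ws2 :
  wedges (ws1 ++ ws2) = wedge (@wedges F S ws1) (wedges ws2).
Proof. by elim: ws1 => [|w ws IH] /=; rewrite ?wedge1l // IH wedgeA. Qed.

Lemma wedges1 w : wedges [:: w] = w.
Proof. exact: wedge1r. Qed.

Lemma wedges_scale (T : Type) (s : seq T) (f : T -> conf F S -> F)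
    (w : T -> form F S) :
  wedges [seq form_scale (f x) (w x) | x <- s] =
  form_scale (fun z => \prod_(x <- s) f x z) (wedges [seq w x | x <- s]).
Proof.
elim: s => [|x s IH] /=.
  by apply/form_ext => z vs; rewrite /form_scale big_nil mul1r.
rewrite IH wedgeZl wedgeZr form_scaleA; congr form_scale.
by apply/funext => z; rewrite big_cons.
Qed.

Lemma homog_wedge m n w1 w2 :
  homog m w1 -> homog n w2 -> homog (m + n) (wedge w1 w2).
Proof.
move=> h1 h2 z vs hs; rewrite /wedge big1 // => k _.
have hc := size_mask_compl k.
have [e1|/h1->] := eqVneq (size (mask k vs)) m; last by rewrite mulr0 mul0r.
rewrite [X in _ * X]h2 ?mulr0 //.
by apply: contra_neq hs => e2; rewrite -[LHS]hc e1 e2.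
Qed.

Lemma wedge_anti w1 w2 : homog 1 w1 -> homog 1 w2 ->
  wedge w1 w2 = form_scale (fun=> -1) (wedge w2 w1).
Proof.
move=> h1 h2; apply/form_ext => z vs; rewrite /form_scale.
have [|hs] := eqVneq (size vs) 2%N; last first.
  by rewrite !(homog_wedge (m := 1) (n := 1)) ?mulr0.
case: vs => [|a [|b [|]]] //= _.
rewrite !wedge_cons !wedge_nil /form_cons /form_twist /=.
rewrite !(h1 z [:: _; _]) // !(h2 z [:: _; _]) // !(h1 z [::]) // !(h2 z [::]) //.
by ring.
Qed.

(** Evaluated on pairs of vectors, since anticommutativity would not suffice in characteristic 2.
    The zero form is written with a coefficient 0 so that this coefficient can be moved out of a
    larger wedge product. *)
Lemma wedge_self w : homog 1 w -> wedge w w = form_scale (fun=> 0) (wedge w w).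
Proof.
move=> h1; apply/form_ext => z vs; rewrite /form_scale.
have [|hs] := eqVneq (size vs) 2%N; last first.
  by rewrite !(homog_wedge (m := 1) (n := 1)) ?mulr0.
case: vs => [|a [|b [|]]] //= _.
rewrite !wedge_cons !wedge_nil /form_cons /form_twist /=.
rewrite !(h1 z [:: _; _]) // !(h1 z [::]) //.
by ring.
Qed.

Lemma homog_scale n f w : homog n w -> homog n (form_scale f w).
Proof. by move=> h z vs /h e; rewrite /form_scale e mulr0. Qed.

Lemma homog_dcr q : homog 1 (@dcr F S q).
Proof. by case: q => [[[i j] k] l] z [|v [|]]. Qed.

Lemma wedge_move (T : Type) (w : T -> form F S) (s : seq T) u :
  homog 1 u -> (forall x, homog 1 (w x)) ->
  wedge u (wedges [seq w x | x <- s]) =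
  form_sign (size s) (wedge (wedges [seq w x | x <- s]) u).
Proof.
move=> hu hw; elim: s => [|x s IH] /=.
  by rewrite form_scale1 wedge1l wedge1r.
rewrite -wedgeA (wedge_anti hu (hw x)) wedgeZl [wedge (wedge (w x) u) _]wedgeA IH wedgeZr.
rewrite form_scaleA wedgeA; congr form_scale.
by apply/funext => z; rewrite exprS.
Qed.

Lemma wedges_rev (T : Type) (w : T -> form F S) (s : seq T) :
  (forall x, homog 1 (w x)) ->
  wedges [seq w x | x <- rev s] =
  form_sign ('C(size s, 2)) (wedges [seq w x | x <- s]).
Proof.
move=> hw; elim: s => [|x s IH] /=; first by rewrite form_scale1.
rewrite rev_cons map_rcons -cats1 wedges_cat wedges1 IH wedgeZl.
rewrite (wedge_move _ (hw x) hw) form_scaleA; congr form_scale.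
by apply/funext => z; rewrite binS bin1 addnC exprD mulrC mulrA -expr2 sqrr_sign ?mul1r.
Qed.

End WedgeAlgebra.

(* The sign depends on the permutation only: the same one serves real and complex forms. *)
Lemma wedges_perm (T : eqType) (s s' : seq T) : perm_eq s s' ->
  exists b : bool, forall (F : fieldType) (S : Type) (w : T -> form F S),
    (forall x, homog 1 (w x)) ->
    wedges [seq w x | x <- s] =
    form_sign b (wedges [seq w x | x <- s']).
Proof.
elim: s s' => [|x s IH] s' hp.
  exists false => F S w hw.
  by move: hp; rewrite perm_sym => /perm_nilP ->; rewrite form_scale1.
have xs' : x \in s' by rewrite -(perm_mem hp) mem_head.
case/path.splitPr: xs' hp => p1 p2 hp.
have /IH[b hb] : perm_eq s (p1 ++ p2).
  by rewrite -(perm_cons x) (perm_trans hp) // -cat1s perm_catCA.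
exists (odd (size p1 + b)) => F S w hw.
rewrite /= hb // !map_cat !wedges_cat /= wedgeZr.
rewrite -[wedge (w x) (wedge _ _)]wedgeA (wedge_move _ (hw x) hw) wedgeZl form_scaleA.
rewrite -wedgeA; congr form_scale.
by apply/funext => z; rewrite signr_odd -exprD addnC.
Qed.

(** * Pullback of forms along forgetful maps *)

Section Pull.
Variables (F : fieldType) (T S : Type) (f : embedding T S).

Definition quad_map (q : quad T) : quad S :=
  let: (i, j, k, l) := q in (f i, f j, f k, f l).

Lemma pull_cons v w :
  form_cons v (pull f w) = pull f (form_cons (v \o f) w) :> form F S.
Proof. by []. Qed.

Lemma pull_twist w : form_twist (pull f w) = pull f (form_twist w) :> form F S.
Proof. by apply/form_ext => z vs; rewrite /pull /form_twist size_map. Qed.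

Lemma pull_wedge w1 w2 : pull f (wedge w1 w2) = wedge (pull f w1) (pull f w2) :> form F S.
Proof.
apply/form_ext => z vs; elim: vs w1 w2 => [|v vs IH] w1 w2.
  by rewrite /pull /= !wedge_nil.
by rewrite /pull /= !wedge_cons pull_twist !pull_cons -!IH.
Qed.

Lemma pull_dcr q : pull f (dcr q) = @dcr F S (quad_map q).
Proof. by case: q => [[[i j] k] l]; apply/form_ext => z [|v [|]]. Qed.

Lemma pull_wedges (I : Type) (w : I -> form F T) s :
  pull f (wedges [seq w x | x <- s]) = wedges [seq pull f (w x) | x <- s] :> form F S.
Proof.
elim: s => [|x s IH] /=; last by rewrite pull_wedge IH.
by apply/form_ext => z [|v vs].
Qed.

Lemma pull_scale (g : conf F T -> F) w :
  pull f (form_scale g w) = form_scale (fun z : conf F S => g (emb_comp z f)) (pull f w).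
Proof. by []. Qed.

Lemma cross_ratio_pull (z : conf F S) q :
  cross_ratio q (emb_comp z f) = cross_ratio (quad_map q) z.
Proof. by case: q => [[[i j] k] l]. Qed.

End Pull.

(** * Polynomials in crossing cross-ratios *)

(* The chords il and jk cross: these are the cross-ratios without poles on M^delta. *)
Definition crossing (S : finType) (c : cycord S) (q : quad S) : bool :=
  let: (i, j, k, l) := q in
  (in_cyc c i j l && in_cyc c i l k) || (in_cyc c l j i && in_cyc c k l i).

Section CycOrd.
Variables (S : finType) (c : cycord S).

Lemma cyc_rot a b d : in_cyc c a b d -> in_cyc c b d a.
Proof. by have /cyc_axiomP[h _ _ _] := valP c; apply: h. Qed.

Lemma cyc_asym a b d : in_cyc c a b d -> in_cyc c d b a = false.
Proof. by have /cyc_axiomP[_ h _ _] := valP c => /h/negbTE. Qed.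

Lemma cyc_trans a b d e : in_cyc c a b d -> in_cyc c a d e -> in_cyc c a b e.
Proof. by have /cyc_axiomP[_ _ h _] := valP c; apply: h. Qed.

Lemma cyc_total a b d : uniq [:: a; b; d] -> in_cyc c a b d || in_cyc c d b a.
Proof. by have /cyc_axiomP[_ _ _ h] := valP c; apply: h. Qed.

Lemma cyc_uniq a b d : in_cyc c a b d -> [&& a != b, b != d & a != d].
Proof.
move=> h; apply/and3P; split; apply/eqP => e; move: (h); rewrite e => h'.
- by move: (h') => /cyc_rot/cyc_asym; rewrite (cyc_rot h').
- by move: (h') => /cyc_rot/cyc_rot/cyc_asym; rewrite (cyc_rot (cyc_rot h')).
- by move: (h') => /cyc_asym; rewrite h'.
Qed.

(* going on around from a to d to e, when b is left out *)
Lemma cyc_mid a b d e : in_cyc c a b d -> in_cyc c a d e -> in_cyc c b d e.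
Proof.
move=> h1 h2; do 2![apply: cyc_rot].
exact: (cyc_trans (cyc_rot h2) (cyc_rot (cyc_rot h1))).
Qed.

Lemma cyc_emb_rev (S' : finType) (c' : cycord S') (f : S' -> S) :
  cyc_emb f (cyc_rev c') c ->
  forall a b d, in_cyc c' a b d = in_cyc c (f d) (f b) (f a).
Proof.
by move=> /forallP h a b d; move/(_ d)/forallP/(_ b)/forallP/(_ a)/eqP: h => <-; rewrite {2}/in_cyc /= inE.
Qed.

Lemma cyc_embP (S' : finType) (c' : cycord S') (f : S' -> S) :
  reflect (forall a b d, in_cyc c' a b d = in_cyc c (f a) (f b) (f d))
    (cyc_emb f c' c).
Proof.
apply: (iffP forallP) => [h a b d|h a]; first by move/(_ a)/forallP/(_ b)/forallP/(_ d)/eqP: h.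
by apply/forallP => b; apply/forallP => d; apply/eqP.
Qed.

Lemma crossing_distinct q : crossing c q -> distinct q.
Proof.
case: q => [[[i j] k] l] /orP[] /andP[/[dup] h1 /cyc_uniq/and3P[a1 a2 a3]].
  move=> /[dup] h2 /cyc_uniq/and3P[a4 a5 a6].
  have /cyc_uniq/and3P[a7 a8 a9] := cyc_mid h1 h2.
  by rewrite /distinct /= !inE !negb_or a1 a3 a6 a7 a9 eq_sym a5.
move=> /cyc_rot/cyc_rot/[dup] h2 /cyc_uniq/and3P[a4 a5 a6].
have /cyc_uniq/and3P[a7 a8 a9] := cyc_mid h2 (cyc_rot (cyc_rot h1)).
rewrite /distinct /= !inE !negb_or a4 a5 a6 (eq_sym i j) a2 (eq_sym j k) a9.
by rewrite (eq_sym j l) a1.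
Qed.

End CycOrd.

(** Whether two chords cross does not depend on the direction of the cyclic order: reversal
    exchanges the two alternatives in [crossing]. *)
Lemma crossing_map (S T : finType) (c : cycord S) (c' : cycord T)
    (f : embedding S T) q :
  cyc_emb f c c' \/ cyc_emb f (cyc_rev c) c' ->
  crossing c q -> crossing c' (quad_map f q).
Proof.
case: q => [[[i j] k] l] [/cyc_embP h|/cyc_emb_rev h] /=; rewrite !h //.
by rewrite orbC.
Qed.

(** * Crossing cross-ratios are finite on M^delta *)

Section CrossRatioFinite.
Variables (F : fieldType) (S : finType) (X : stable_curve F S).
Implicit Types (v w : comp X).

Let cut v w := [rel x y | adj x y && ([set x; y] != [set v; w])].

Lemma cut_sym v w x y : connect (cut v w) x y -> connect (cut v w) y x.
Proof. by rewrite sym_connect_sym // => a b; rewrite /cut /= adj_sym setUC. Qed.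

(* A simple path from w that does not use the edge vw avoids v altogether. *)
Lemma cut_avoid v w x : adj v w -> connect (cut v w) w x ->
  exists p, [/\ path (@adj _ _ X) w p, last w p = x & v \notin w :: p].
Proof.
move=> avw /connectP[p pth ->]; exists p; split=> //.
  by apply: sub_path pth => a b /andP[].
apply/negP => vp; move/negP: (adj_acyclic avw); apply.
apply: cut_sym; case/splitPl: vp pth => p1 p2 lp; rewrite cat_path => /andP[pth _].
by apply/connectP; exists p1.
Qed.

Lemma avoid_cut v w w' p : path (@adj _ _ X) w' p -> v \notin w' :: p ->
  connect (cut v w) w' (last w' p).
Proof.
move=> pth vp; apply/connectP; exists p => //.
elim: p w' pth vp => //= a p IH w' /andP[aw pth]; rewrite inE negb_or => /andP[vw' vp].
rewrite aw IH // andbT; apply/eqP => e.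
have : v \in [set w'; a] by rewrite e !inE eqxx.
rewrite !inE (negbTE vw') /= => /eqP e'.
by move: vp; rewrite e' mem_head.
Qed.

(** Two branches at v with a common marked point would close up to a cycle: from v to w', on to the
    marked point and back to w, without the edge between v and w. *)
Lemma branch_uniq v w w' s : adj v w -> adj v w' ->
  s \in branch v w -> s \in branch v w' -> w = w'.
Proof.
move=> avw avw'; rewrite !inE => /(cut_avoid avw)[p [pp lp vp]].
move=> /(cut_avoid avw')[p' [pp' lp' vp']].
apply/eqP/negPn/negP => nww'; move/negP: (adj_acyclic avw); apply.
apply: (@connect_trans _ _ w').
  apply: connect1; rewrite /= avw'; apply/eqP => e.
  have : w' \in [set v; w] by rewrite -e !inE eqxx orbT.
  rewrite !inE eq_sym (negbTE (_ : v != w')) /= 1?eq_sym ?(negbTE nww') //.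
  by apply/eqP => e'; move: avw'; rewrite e' adj_irr.
apply: (@connect_trans _ _ (mark X s)); first by rewrite -lp'; exact: avoid_cut.
by apply: cut_sym; rewrite -lp; exact: avoid_cut.
Qed.

Lemma mark_branch v w s : adj v w -> s \in branch v w -> mark X s != v.
Proof.
move=> avw; rewrite !inE => /(cut_avoid avw)[p [_ <- vp]].
by apply: contraNneq vp => <-; exact: mem_last.
Qed.

Lemma in_branch v s : mark X s != v -> exists2 w, adj v w & s \in branch v w.
Proof.
move=> nv; have /connectP[p pth lp] := adj_connected v (mark X s).
move: nv; case/shortenP: pth lp => p' pth up _ lp; rewrite lp.
case: p' pth up lp => [|w p'] /=; first by rewrite eqxx.
move=> /andP[avw pth] /andP[vp _] lp _; exists w => //.
by rewrite inE lp -/(cut v w) avoid_cut.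
Qed.

Lemma proj_branch v w s : adj v w -> s \in branch v w -> proj v s = node v w.
Proof.
move=> avw sb; rewrite /proj (negbTE (mark_branch avw sb)).
case: pickP => [w' /andP[avw' sb']|/(_ w)]; last by rewrite avw sb.
by rewrite (branch_uniq avw avw' sb sb').
Qed.

(** The coordinate on v separates its marked points and nodes, so distinct marked points are
    identified only by being contracted to the same node. *)
Lemma proj_eq v s t : s != t -> proj v s = proj v t ->
  exists2 w, adj v w & (s \in branch v w) && (t \in branch v w).
Proof.
move=> nst; have [ms|/in_branch[w aw sw]] := eqVneq (mark X s) v; last first.
  rewrite (proj_branch aw sw).
  have [mt|/in_branch[w' aw' tw']] := eqVneq (mark X t) v.
    rewrite /proj mt eqxx => e; case: (@pos_node _ _ X t w); rewrite ?mt //.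
  by rewrite (proj_branch aw' tw') => /(node_inj aw aw') e; exists w; rewrite // sw e tw'.
rewrite {1}/proj ms eqxx.
have [mt|/in_branch[w aw tw]] := eqVneq (mark X t) v.
  rewrite /proj mt eqxx => /pos_inj e.
  by move: nst; rewrite e ?eqxx // ms mt.
by rewrite (proj_branch aw tw) => e; case: (@pos_node _ _ X s w); rewrite ms.
Qed.

Lemma branch_proj v w s t : adj v w -> s \in branch v w ->
  proj v t != proj v s -> t \notin branch v w.
Proof.
by move=> aw sw; apply: contra => tw; rewrite (proj_branch aw sw) (proj_branch aw tw).
Qed.

(** A chord with both ends in an interval of the circle does not cross a chord with both ends
    outside. *)
Lemma consecutive_crossing c (A : {set S}) i j k l : consecutive c A ->
  crossing c (i, j, k, l) -> i \in A -> l \in A -> j \notin A -> k \notin A -> false.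
Proof.
case=> s /and3P[us /forallP sa /forallP hc] ->.
have hcc a b d : in_cyc c a b d = cyc_nat (index a s) (index b s) (index d s).
  by move/(_ a)/forallP/(_ b)/forallP/(_ d)/eqP: hc.
rewrite !inE !in_take ?sa //.
by rewrite /crossing !hcc /cyc_nat; lia.
Qed.

(** Three different values among four points leave room for one coincidence only. *)
Lemma sees_eqF v i j k l : sees v (i, j, k, l) -> proj v i = proj v l ->
  (proj v j != proj v i) && (proj v k != proj v i).
Proof.
rewrite /sees /= => + e; rewrite !inE e.
do 2!case: eqVneq => [->|?] //=; rewrite ?inE ?eqxx ?orbT ?orbF //=.
all: by do ?case: ifP.
Qed.

Lemma sees_rev v i j k l : sees v (i, j, k, l) = sees v (j, i, l, k).
Proof.
rewrite /sees; congr (_ <= _)%N; apply: perm_size; apply: uniq_perm; rewrite ?undup_uniq //.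
by move=> x; rewrite !mem_undup !inE; do 4!case: (_ == _).
Qed.

(** If i and l met on v, they would lie on one branch, which j and k avoid. On M^delta a branch is a
    set of consecutive labels, and this contradicts the crossing of the chords il and jk. *)
Lemma crossing_neq c v i j k l : in_Mdelta c X -> crossing c (i, j, k, l) ->
  sees v (i, j, k, l) -> proj v i != proj v l.
Proof.
move=> XM cr sv; apply/eqP => e.
have /andP[nj nk] := sees_eqF sv e.
have := crossing_distinct cr; rewrite /distinct /= !inE !negb_or => /and4P[/and3P[_ _ nil] _ _ _].
have [w aw /andP[iw lw]] := proj_eq nil e.
have [cA _] : consecutive c (branch v w) /\ consecutive c (~: branch v w).
  by apply: XM; exists v, w.
by have := consecutive_crossing cA cr iw lw (branch_proj aw iw nj) (branch_proj aw iw nk).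
Qed.

Lemma crossing_finite c q : in_Mdelta c X -> crossing c q -> cr_finite X q.
Proof.
case: q => [[[i j] k] l] XM cr; apply/forallP => v; apply/implyP => sv.
(* The symmetry (i, j, k, l) -> (j, i, l, k) exchanges the two chords, so that the second factor of
   the denominator is treated like the first. *)
rewrite (crossing_neq XM cr sv) /=; apply: (crossing_neq XM _ (_ : sees v (j, i, l, k))).
  move: cr; rewrite /crossing => /orP[] /andP[h1 h2]; apply/orP; [right|left]; apply/andP; split.
  - exact: cyc_rot (cyc_rot (cyc_trans h1 h2)).
  - exact: cyc_rot (cyc_mid h1 h2).
  - exact: cyc_rot (cyc_rot (cyc_trans (cyc_rot (cyc_rot h2)) (cyc_rot (cyc_rot h1)))).
  - exact: cyc_rot (cyc_rot (cyc_mid (cyc_rot (cyc_rot h2)) (cyc_rot (cyc_rot h1)))).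
by rewrite sees_rev.
Qed.
End CrossRatioFinite.

(** * Polynomial functions and forms in crossing cross-ratios *)

Section Nice.
Variables (F : fieldType).

(** Unlike [cr_poly] this refers to no stable curve: by [crossing_finite] the generators are finite
    on all of M^delta. *)
Inductive cpoly (S : finType) (c : cycord S) : (conf F S -> F) -> Prop :=
| Cpoly_const a : cpoly c (fun=> a)
| Cpoly_gen q : crossing c q -> cpoly c (fun z => cross_ratio q z)
| Cpoly_add f g : cpoly c f -> cpoly c g -> cpoly c (fun z => f z + g z)
| Cpoly_mul f g : cpoly c f -> cpoly c g -> cpoly c (fun z => f z * g z).

(** A global sufficient condition for regularity. As it involves no denominators, it passes to wedge
    products and to pullbacks along forgetful maps. *)
Inductive nice (S : finType) (c : cycord S) (k : nat) : form F S -> Prop :=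
| Nice_zero : nice c k (fun _ _ => 0)
| Nice_gen f qs : cpoly c f -> size qs = k -> all (crossing c) qs ->
    nice c k (form_scale f (wedges [seq dcr q | q <- qs]))
| Nice_add w1 w2 : nice c k w1 -> nice c k w2 -> nice c k (form_add w1 w2).

Section Fixed.
Variables (S : finType) (c : cycord S).
Implicit Types (w : form F S).

Lemma cpoly_ext f g : f =1 g -> cpoly c f -> cpoly c g.
Proof. by move=> /funext ->. Qed.

Lemma cpoly_prod (I : Type) (s : seq I) (P : pred I) (f : I -> conf F S -> F) :
  (forall x, P x -> cpoly c (f x)) -> cpoly c (fun z => \prod_(x <- s | P x) f x z).
Proof.
move=> h; elim: s => [|x s IH].
  by apply: (cpoly_ext _ (Cpoly_const c 1)) => z; rewrite big_nil.
case hx: (P x); last by apply: (cpoly_ext _ IH) => z; rewrite big_cons hx.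
by apply: (cpoly_ext _ (Cpoly_mul (h _ hx) IH)) => z; rewrite big_cons hx.
Qed.

Lemma cpoly_opp f : cpoly c f -> cpoly c (fun z => - f z).
Proof.
move=> h; apply: (@cpoly_ext (fun z => -1 * f z)) => [z|]; first by rewrite mulN1r.
by apply: Cpoly_mul h; apply: Cpoly_const.
Qed.

Lemma cpoly_sub f g : cpoly c f -> cpoly c g -> cpoly c (fun z => f z - g z).
Proof. by move=> hf hg; apply: Cpoly_add hf _; apply: cpoly_opp. Qed.

Lemma nice_scale f k w : cpoly c f -> nice c k w -> nice c k (form_scale f w).
Proof.
move=> hf; elim=> [|g qs hg sq aq|w1 w2 _ h1 _ h2].
- rewrite (_ : form_scale _ _ = fun _ _ => 0); first exact: Nice_zero.
  by apply/form_ext => z vs; rewrite /form_scale mulr0.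
- by rewrite form_scaleA; apply: Nice_gen => //; apply: Cpoly_mul.
- by rewrite form_scaleD; apply: Nice_add.
Qed.

Lemma wedge0l w : wedge (fun _ _ => 0) w = fun _ _ => 0.
Proof. by apply/form_ext => z vs; rewrite /wedge big1 // => m _; rewrite mulr0 mul0r. Qed.

Lemma wedge0r w : wedge w (fun _ _ => 0) = fun _ _ => 0.
Proof. by apply/form_ext => z vs; rewrite /wedge big1 // => m _; rewrite mulr0. Qed.

Lemma nice_wedge m n w1 w2 : nice c m w1 -> nice c n w2 -> nice c (m + n) (wedge w1 w2).
Proof.
move=> h1 h2; elim: h1 => [|f qs hf sq aq|u1 u2 _ i1 _ i2].
- by rewrite wedge0l; apply: Nice_zero.
- elim: h2 => [|g rs hg sr ar|u1 u2 _ i1 _ i2].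
  + by rewrite wedge0r; apply: Nice_zero.
  + rewrite wedgeZl wedgeZr form_scaleA -wedges_cat -map_cat.
    by apply: Nice_gen; rewrite ?size_cat ?sq ?sr ?all_cat ?aq //; apply: Cpoly_mul.
  + by rewrite wedgeDr; apply: Nice_add.
- by rewrite wedgeDl; apply: Nice_add.
Qed.

Lemma nice_wedges qs : all (crossing c) qs -> nice c (size qs) (wedges [seq dcr q | q <- qs]).
Proof. by move=> h; rewrite -[wedges _]form_scale1; apply: Nice_gen => //; apply: Cpoly_const. Qed.

Lemma nice_dcr q : crossing c q -> nice c 1 (dcr q).
Proof. by move=> h; rewrite -[dcr q]wedges1; apply: (@nice_wedges [:: q]); rewrite /= h. Qed.

(** One expression, with denominator 1, serves at every stable curve of M^delta. *)
Lemma nice_regular k w : nice c k w -> regular_form c k w.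
Proof.
move=> hw X XM.
have pf f : cpoly c f -> exists b, cr_poly X f b.
  elim=> {f} [a|q hq|f g _ [a ha] _ [b hb]|f g _ [a ha] _ [b hb]].
  - by exists a; apply: Cr_const.
  - exists (cr_value X q); apply: Cr_gen; first exact: crossing_distinct hq.
    exact: crossing_finite XM hq.
  - by exists (a + b); apply: Cr_add.
  - by exists (a * b); apply: Cr_mul.
suff [l [h1 h2]] : exists l : seq ((conf F S -> F) * seq (quad S)),
    (forall x, List.In x l ->
         [/\ exists b, cr_poly X x.1 b, size x.2 = k
           & all (fun q => distinct q && cr_finite X q) x.2]) /\
    (forall z vs, w z vs =
        \sum_(x <- l) x.1 z * wedges [seq @dcr F S q | q <- x.2] z vs).
  exists (fun=> 1), 1, l; split=> //; [exact: Cr_const|exact: oner_neq0|].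
  by move=> z vs; rewrite mul1r.
elim: hw => [|f qs hf sq aq|w1 w2 _ [l1 [h1 e1]] _ [l2 [h2 e2]]].
- by exists [::]; split=> // z vs; rewrite big_nil.
- exists [:: (f, qs)]; split; last by move=> z vs; rewrite big_seq1.
  move=> x [<-|[]].
  split=> //=; first exact: pf.
  apply: sub_all aq => q hq.
  by rewrite (crossing_distinct hq) (crossing_finite XM hq).
- exists (l1 ++ l2); split; first by move=> x hx; case: (List.in_app_or _ _ _ hx) => [/h1|/h2].
  move=> z vs; by rewrite big_cat /form_add e1 e2.
Qed.

End Fixed.

Lemma cpoly_pull (T S : finType) (c : cycord T) (c' : cycord S) (j : embedding T S) f :
  cyc_emb j c c' \/ cyc_emb j (cyc_rev c) c' ->
  cpoly c f -> cpoly c' (fun z => f (emb_comp z j)).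
Proof.
move=> hj; elim=> [a|q hq|g h _ ig _ ih|g h _ ig _ ih].
- exact: Cpoly_const.
- apply: (cpoly_ext _ (Cpoly_gen (crossing_map hj hq))) => z.
  by rewrite cross_ratio_pull.
- exact: Cpoly_add.
- exact: Cpoly_mul.
Qed.

Lemma nice_pull (T S : finType) (c : cycord T) (c' : cycord S) (j : embedding T S) k w :
  cyc_emb j c c' \/ cyc_emb j (cyc_rev c) c' ->
  nice c k w -> nice c' k (pull j w).
Proof.
move=> hj; elim=> [|f qs hf sq aq|w1 w2 _ h1 _ h2].
- exact: Nice_zero.
- rewrite pull_scale pull_wedges (_ : [seq _ | q <- qs] = [seq dcr q | q <- [seq quad_map j q | q <- qs]]).
    apply: Nice_gen; rewrite ?size_map //; first exact: (cpoly_pull hj hf).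
    by rewrite all_map; apply: sub_all aq => q hq; exact: (crossing_map hj hq).
  by rewrite -map_comp; apply: eq_map => q /=; rewrite pull_dcr.
- exact: Nice_add.
Qed.

End Nice.

(* With o and i at 0 and infinity, the quotient of the coordinates of b and a. *)
Definition cub (S : Type) (o i a b : S) : quad S := (b, a, o, i).

Definition dlog (F : fieldType) (S : Type) (q : quad S) : form F S :=
  form_scale (fun z => (cross_ratio q z)^-1) (dcr q).
Arguments dlog F {S} q.

Notation dlogw F s := (wedges [seq dlog F q | q <- s]).

(** * Ratios of coordinates and their logarithmic differentials *)

Section Cub.
Variables (F : fieldType) (S : eqType).
Implicit Types (z : conf F S) (o i a b d e : S).

Lemma conf_neq z a b : a != b -> z a - z b != 0.
Proof. by rewrite subr_eq0; apply: contra_neq; apply: emb_inj. Qed.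

(** The logarithmic differential of (z a - z o) / (z a - z i), the coordinate of a when o and i are
    at 0 and oo. *)
Definition lam o i z (v : S -> F) a : F :=
  (v a - v o) / (z a - z o) - (v a - v i) / (z a - z i).

Lemma cub_mul o i a b d z : b != o -> b != i ->
  cross_ratio (cub o i a b) z * cross_ratio (cub o i b d) z =
  cross_ratio (cub o i a d) z.
Proof.
move=> /(conf_neq z) h1 /(conf_neq z) h2; rewrite /cub /cross_ratio.
rewrite -[RHS](mulfK (mulf_neq0 h1 h2)) !invfM; ring.
Qed.

Lemma cub_self o i a z : a != o -> a != i -> cross_ratio (cub o i a a) z = 1.
Proof.
move=> /(conf_neq z) h1 /(conf_neq z) h2; rewrite /cub /cross_ratio.
by rewrite mulrC [X in X^-1 * _]mulrC mulVf // mulf_neq0.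
Qed.

Lemma cub_neq0 o i a b z : a != o -> a != i -> b != o -> b != i ->
  cross_ratio (cub o i a b) z != 0.
Proof.
move=> /(conf_neq z) h1 /(conf_neq z) h2 /(conf_neq z) h3 /(conf_neq z) h4.
by rewrite /cub /cross_ratio mulf_neq0 ?invr_neq0 ?mulf_neq0.
Qed.

(** The three-term Plucker relation. The factored form shows that 1 - t does not vanish for distinct
    points and makes quotients of such differences into cross-ratios. *)
Lemma cub_sub1 o i a b z : a != o -> b != i ->
  1 - cross_ratio (cub o i a b) z =
  (z a - z b) * (z o - z i) / ((z b - z i) * (z a - z o)).
Proof.
by move=> /(conf_neq z) h1 /(conf_neq z) h2; rewrite /cub /cross_ratio; field; rewrite h1 h2.
Qed.

Lemma cub_neq1 o i a b z : o != i -> a != b -> a != o -> b != i ->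
  1 - cross_ratio (cub o i a b) z != 0.
Proof.
move=> oi ab ao bi; rewrite cub_sub1 //.
by rewrite mulf_neq0 ?invr_neq0 ?mulf_neq0 ?conf_neq.
Qed.

Lemma dlog_cub o i a b z v : a != o -> a != i -> b != o -> b != i ->
  dlog F (cub o i a b) z [:: v] = lam o i z v b - lam o i z v a.
Proof.
move=> ao ai bo bi; rewrite /dlog /form_scale /dcr.
have := cub_neq0 z ao ai bo bi; rewrite /cub => h; rewrite mulKf //.
by rewrite /lam; ring.
Qed.

Lemma homog_dlog (q : quad S) : homog 1 (dlog F q).
Proof. exact/homog_scale/homog_dcr. Qed.

Lemma dcr_dlog o i a b : a != o -> a != i -> b != o -> b != i ->
  dcr (cub o i a b) = form_scale (cross_ratio (cub o i a b)) (dlog F (cub o i a b)).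
Proof.
move=> ao ai bo bi; apply/form_ext => z vs.
by rewrite /dlog /form_scale mulVKf // cub_neq0.
Qed.

Lemma dlog_add o i a b d : a != o -> a != i -> b != o -> b != i -> d != o -> d != i ->
  dlog F (cub o i a d) = form_add (dlog F (cub o i a b)) (dlog F (cub o i b d)).
Proof.
move=> ao ai bo bi do_ di; apply/form_ext => z vs; rewrite /form_add.
have [|hs] := eqVneq (size vs) 1%N; last by rewrite !homog_dlog // addr0.
case: vs => [|v [|]] //= _.
by rewrite !dlog_cub //; ring.
Qed.

(* The differential of the coordinate with zero at e instead of o *)
Lemma dcr_move_zero o i a b e : o != i -> a != o -> a != i -> b != o -> b != i ->
    e != o -> e != i -> a != e -> b != e ->
  exists g, dcr (cub e i a b) =
  form_add
   (form_scale (fun z => cross_ratio (cub o i a b) z / (1 - cross_ratio (cub o i a e) z))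
     (dlog F (cub o i a b)))
   (form_scale g (dlog F (cub o i a e))).
Proof.
move=> oi ao ai bo bi eo ei ae be.
(* With y = b / a and u = e / a in the coordinate with o, i at 0, oo, the new ratio is (y - u) / (1
   - u); this is the coefficient of du / u in its differential. *)
exists (fun z => cross_ratio (cub o i a e) z * (cross_ratio (cub o i a b) z - 1)
                 / (1 - cross_ratio (cub o i a e) z) ^+ 2).
apply/form_ext => z vs; rewrite /form_add /form_scale.
have [|hs] := eqVneq (size vs) 1%N; last first.
  by rewrite !homog_dlog // homog_dcr // !mulr0 addr0.
case: vs => [|v [|]] //= _.
rewrite !dlog_cub // cub_sub1 //.
have h : cross_ratio (cub o i a b) z - 1 =
   - ((z a - z b) * (z o - z i) / ((z b - z i) * (z a - z o))).
  by rewrite -cub_sub1 // opprB.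
rewrite h /cub /cross_ratio /lam.
move: (conf_neq z oi) (conf_neq z ao) (conf_neq z ai) (conf_neq z bo) (conf_neq z bi)
  (conf_neq z eo) (conf_neq z ei) (conf_neq z ae) (conf_neq z be).
move: (z o) (z i) (z a) (z b) (z e) (v o) (v i) (v a) (v b) (v e).
move=> zo zi za zb ze vo vi va vb ve h1 h2 h3 h4 h5 h6 h7 h8 h9.
have h1' : zi - zo != 0 by rewrite -opprB oppr_eq0.
field.
by rewrite ?h1 ?h2 ?h3 ?h4 ?h5 ?h6 ?h7 ?h8 ?h9 ?h1'.
Qed.

End Cub.

Notation off o i x := [/\ o != i, x != o & x != i].

(** * The generator of the regular forms of top degree *)

Section Theta.
Variables (F : fieldType) (S : finType) (c : cycord S).
Implicit Types (o i : S) (p : nat -> S) (a b m k : nat) (z : conf F S).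

(* o, i, p_a, ..., p_b are in cyclic order. *)
Definition chain o i p a b :=
  (forall m, (a <= m <= b)%N -> in_cyc c o i (p m)) /\
  (forall m k, (a <= m < k)%N -> (k <= b)%N -> in_cyc c o (p m) (p k)).

Lemma chain_sub o i p a b a' b' : (a <= a')%N -> (b' <= b)%N ->
  chain o i p a b -> chain o i p a' b'.
Proof.
move=> ha hb [h1 h2]; split=> [m hm|m k hm hk]; [apply: h1|apply: h2]; nlia.
Qed.

(** The last point takes over the role of o, which is forgotten, as in the change of zero in
    [Theta_move]. *)
Lemma chain_move o i p a b : (a <= b)%N -> chain o i p a b.+1 -> chain (p b.+1) i p a b.
Proof.
move=> ab [h1 h2]; split=> [m hm|m k hm hk].
  by apply/cyc_rot/cyc_rot/(cyc_mid (h1 m _) (h2 m b.+1 _ _)); nlia.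
by apply/cyc_rot/cyc_rot/(cyc_mid (h2 m k _ _) (h2 k b.+1 _ _)); nlia.
Qed.

Section Chain.
Variables (o i : S) (p : nat -> S) (a b : nat).
Hypothesis ch : chain o i p a b.

Lemma chain_neq m : (a <= m <= b)%N -> off o i (p m).
Proof. by case: ch => h _ /h/cyc_uniq/and3P[]; rewrite ![_ == p m]eq_sym. Qed.

Lemma chain_inj m k : (a <= m < k)%N -> (k <= b)%N -> p m != p k.
Proof. by case: ch => _ h h1 h2; case/and3P: (cyc_uniq (h _ _ h1 h2)). Qed.

(* The ratio of the coordinates of p_k and p_m *)
Definition P m k z := cross_ratio (cub o i (p m) (p k)) z.

Lemma crossing_cub m k : (a <= m < k)%N -> (k <= b)%N -> crossing c (cub o i (p m) (p k)).
Proof.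
case: ch => h1 h2 hm hk; apply/orP; right; apply/andP; split; last by apply: h1; nlia.
by apply: cyc_mid (h2 _ _ hm hk); apply: h1; nlia.
Qed.

Lemma P_neq0 m k z : (a <= m <= b)%N -> (a <= k <= b)%N -> P m k z != 0.
Proof. by move=> /chain_neq[_ h1 h2] /chain_neq[_ h3 h4]; apply: cub_neq0. Qed.

Lemma P_neq1 m k z : (a <= m < k)%N -> (k <= b)%N -> 1 - P m k z != 0.
Proof.
move=> hm hk; have [] : off o i (p m) by apply: chain_neq; nlia.
have [_ _] : off o i (p k) by apply: chain_neq; nlia.
by move=> h1 h2 h3 h4; apply: cub_neq1 => //; apply: chain_inj hm hk.
Qed.

Lemma P_mul m k l z : (a <= k <= b)%N -> P m k z * P k l z = P m l z.
Proof. by move=> /chain_neq[_ h1 h2]; apply: cub_mul. Qed.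

Lemma P_self m z : (a <= m <= b)%N -> P m m z = 1.
Proof. by move=> /chain_neq[_ h1 h2]; apply: cub_self. Qed.

Lemma cpoly_P m k : (a <= m <= k)%N -> (k <= b)%N -> cpoly c (P m k).
Proof.
move=> hm hk; have [->|hmk] := eqVneq m k.
  by apply: (cpoly_ext _ (Cpoly_const c 1)) => z; rewrite P_self //; nlia.
by apply: (@Cpoly_gen F S c (cub o i (p m) (p k))); apply: crossing_cub => //; nlia.
Qed.

(* The ratios of two differences of coordinates, one interval lying inside the other *)
Lemma cpoly_ratio d m k e : (a <= d <= m)%N -> (m < k <= e)%N -> (e <= b)%N ->
  cpoly c (fun z => (1 - P m k z) / (1 - P d e z)).
Proof.
move=> hd hk he.
have [oi do_ di] : off o i (p d) by apply: chain_neq; nlia.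
have [_ mo mi] : off o i (p m) by apply: chain_neq; nlia.
have [_ ko ki] : off o i (p k) by apply: chain_neq; nlia.
have [_ eo ei] : off o i (p e) by apply: chain_neq; nlia.
case: ch => h1 h2.
(* The ends of the interval are moved one at a time: each of the two quotients [c1] and [c2] is 1 or
   a single crossing cross-ratio. *)
have c1 : cpoly c (fun z => (1 - P d k z) / (1 - P d e z)).
  have [->|nke] := eqVneq k e.
    apply: (cpoly_ext _ (Cpoly_const c 1)) => z.
    by rewrite divff // P_neq1 //; nlia.
  have dk : p d != p k by apply: chain_inj; nlia.
  have de : p d != p e by apply: chain_inj; nlia.
  apply: (cpoly_ext _ (@Cpoly_gen F S c (p d, i, p k, p e) _)) => [z|].
    rewrite /P !cub_sub1 // /cross_ratio; field.
    by rewrite !conf_neq // eq_sym.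
  apply/orP; right; apply/andP; split.
    by apply/cyc_rot/cyc_rot/(cyc_mid (h1 d _) (h2 d e _ _)); nlia.
  by apply/cyc_rot/(cyc_mid (h2 d k _ _) (h2 k e _ _)); nlia.
have c2 : cpoly c (fun z => (1 - P m k z) / (1 - P d k z)).
  have [->|nke] := eqVneq d m.
    apply: (cpoly_ext _ (Cpoly_const c 1)) => z.
    by rewrite divff // P_neq1 //; nlia.
  have dk : p d != p k by apply: chain_inj; nlia.
  have mk : p m != p k by apply: chain_inj; nlia.
  apply: (cpoly_ext _ (@Cpoly_gen F S c (p m, p d, p k, o) _)) => [z|].
    rewrite /P !cub_sub1 // /cross_ratio; field.
    by rewrite !conf_neq // eq_sym.
  apply/orP; right; apply/andP; split; first by apply: h2; nlia.
  by apply/cyc_rot/cyc_rot/h2; nlia.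
apply: (cpoly_ext _ (Cpoly_mul c2 c1)) => z.
by rewrite mulrA divfK // P_neq1 //; nlia.
Qed.

End Chain.
End Theta.

Section ThetaNice.
Variables (F : fieldType) (S : finType) (c : cycord S).
Implicit Types (o i : S) (p : nat -> S) (a b m k : nat) (z : conf F S).

Definition den o i p a b z : F := \prod_(a.+1 <= m < b) (1 - P o i p m.-1 m.+1 z)^-1.

(* In the cubical coordinates x_m of the points p_a, ..., p_b this is
   dx_{a+1} ... dx_b / ((1 - x_{a+1} x_{a+2}) ... (1 - x_{b-1} x_b)). *)
Definition Theta o i p a b : form F S :=
  form_scale (den o i p a b)
    (wedges [seq dcr (cub o i (p m.-1) (p m)) | m <- index_iota a.+1 b.+1]).

(** Let x be the ratio of p_(k+1) and p_k. The factors of [den] that are lost in the splitting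
    belong to the intervals from p_(k-1) to p_(k+1) and from p_k to p_(k+2). Each absorbs one factor
    1 - x by [cpoly_ratio], whence the square; at an end of the chain, where one is absent, 1 - x
    remains in r. *)
Lemma den_split o i p a b k : chain c o i p a b -> (a <= k < b)%N ->
  exists2 r, cpoly c r & forall z,
    (1 - P o i p k k.+1 z) ^+ 2 * den o i p a b z =
    r z * (den o i p a k z * den o i p k.+1 b z).
Proof.
move=> ch hk.
have cx : cpoly c (fun z => 1 - P o i p k k.+1 z).
  by apply: cpoly_sub; [exact: Cpoly_const|apply: (cpoly_P _ ch); nlia].
have [r1 h1 e1] : exists2 r, cpoly c r & forall z, (1 - P o i p k k.+1 z) *
    (\prod_(a.+1 <= m < k.+1) (1 - P o i p m.-1 m.+1 z)^-1) = r z * den o i p a k z.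
  have [ak|ka] := ltnP a k; last first.
    exists (fun z => 1 - P o i p k k.+1 z) => // z.
    by rewrite /den !big_geq //; nlia.
  exists (fun z => (1 - P o i p k k.+1 z) / (1 - P o i p k.-1 k.+1 z)).
    by apply: (@cpoly_ratio F S c o i p a b ch k.-1 k k.+1 k.+1); nlia.
  by move=> z; rewrite big_nat_recr //= /den; ring.
have [r2 h2 e2] : exists2 r, cpoly c r & forall z, (1 - P o i p k k.+1 z) *
    (\prod_(k.+1 <= m < b) (1 - P o i p m.-1 m.+1 z)^-1) = r z * den o i p k.+1 b z.
  have [kb|bk] := ltnP k.+1 b; last first.
    exists (fun z => 1 - P o i p k k.+1 z) => // z.
    by rewrite /den !big_geq //; nlia.
  exists (fun z => (1 - P o i p k k.+1 z) / (1 - P o i p k k.+2 z)).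
    by apply: (@cpoly_ratio F S c o i p a b ch k k k.+1 k.+2); nlia.
  by move=> z; rewrite big_ltn //= /den mulrA.
exists (fun z => r1 z * r2 z) => [|z]; first exact: Cpoly_mul.
rewrite mulrACA -e1 -e2 /den (@big_cat_nat _ _ _ k.+1) /=; [ring|nlia|nlia].
Qed.

Lemma index_iota_split a b k : (a <= k < b)%N ->
  index_iota a.+1 b.+1 = index_iota a.+1 k.+1 ++ k.+1 :: index_iota k.+2 b.+1.
Proof.
move=> hk; rewrite /index_iota -[k.+1 :: _]/(iota k.+1 (b.+1 - k.+2).+1).
have -> : (b.+1 - a.+1 = (k.+1 - a.+1) + (b.+1 - k.+2).+1)%N by lia.
by rewrite iotaD; congr (_ ++ iota _ _); lia.
Qed.

(** Where x differs from 1, Theta is a polynomial multiple, up to the inverse of (1 - x)^2, of dx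
    wedged with the generators of two shorter chains. This is one of the two reductions in
    [nice_Theta]. *)
Lemma Theta_split o i p a b k : chain c o i p a b -> (a <= k < b)%N ->
  exists2 r, cpoly c r &
    form_scale (fun z => (1 - P o i p k k.+1 z) ^+ 2) (Theta o i p a b) =
    form_scale r (wedge (Theta o i p a k)
      (wedge (dcr (cub o i (p k) (p k.+1))) (Theta o i p k.+1 b))).
Proof.
move=> ch hk; have [r hr e] := den_split ch hk; exists r => //.
rewrite /Theta (index_iota_split hk) map_cat wedges_cat /=.
rewrite !wedgeZl !wedgeZr !form_scaleA; congr form_scale.
by apply/funext => z; rewrite e mulrA.
Qed.

Lemma wedges_mem (T : eqType) (w : T -> form F S) (s : seq T) x :
  (forall y, homog 1 (w y)) -> x \in s ->
  wedge (wedges [seq w y | y <- s]) (w x) = fun _ _ => 0.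
Proof.
move=> hw; case/path.splitPr => s1 s2.
rewrite map_cat /= wedges_cat /= !wedgeA.
have -> : wedge (wedges [seq w y | y <- s2]) (w x) =
   form_sign (size s2) (wedge (w x) (wedges [seq w y | y <- s2])).
  rewrite (wedge_move _ (hw x) hw) form_scaleA.
  apply/form_ext => z vs; rewrite /form_scale -expr2 sqrr_sign ?mul1r //.
rewrite wedgeZr -wedgeA wedge_self // wedgeZl !wedgeZr.
by apply/form_ext => z vs; rewrite /form_scale; ring.
Qed.

End ThetaNice.

Lemma index_iota_rcons a j : (a <= j)%N ->
  index_iota a.+1 j.+2 = rcons (index_iota a.+1 j.+1) j.+1.
Proof.
move=> aj; rewrite /index_iota -cats1 (_ : (j.+2 - a.+1 = (j.+1 - a.+1) + 1)%N); last by lia.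
by rewrite iotaD /=; congr (_ ++ [:: _]); lia.
Qed.

Lemma In_map (T : eqType) (U : Type) (f : T -> U) (s : seq T) x :
  List.In x [seq f y | y <- s] -> exists2 y, y \in s & x = f y.
Proof.
elim: s => //= y s IH [<-|/IH[u us ->]]; first by exists y => //; apply: mem_head.
by exists u => //; rewrite inE us orbT.
Qed.

Section ThetaMove.
Variables (F : fieldType) (S : finType) (c : cycord S).
Implicit Types (o i : S) (p : nat -> S) (a b m k : nat) (z : conf F S).

Definition zero_form : form F S := fun _ _ => 0.

Lemma scale_zero f : form_scale f zero_form = zero_form.
Proof. by apply/form_ext => z vs; rewrite /form_scale mulr0. Qed.

Lemma add0_form (w : form F S) : form_add zero_form w = w.
Proof. by apply/form_ext => z vs; rewrite /form_add add0r. Qed.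

Lemma addr0_form (w : form F S) : form_add w zero_form = w.
Proof. by apply/form_ext => z vs; rewrite /form_add addr0. Qed.

Section Fix.
Variables (o i : S) (p : nat -> S) (a k : nat).
Hypothesis ch : chain c o i p a k.+1.
Hypothesis ak : (a <= k)%N.

Let ne m : (a <= m <= k.+1)%N -> off o i (p m).
Proof. exact: (chain_neq ch). Qed.

Lemma dlog_path_kill (W : form F S) j : (a <= j <= k.+1)%N ->
  (forall m, (a < m <= j)%N -> wedge W (dlog F (cub o i (p m.-1) (p m))) = zero_form) ->
  wedge W (dlog F (cub o i (p a) (p j))) = zero_form.
Proof.
move=> /andP[aj jk] hW; have [oi ao ai] : off o i (p a) by apply: ne; nlia.
elim: j aj jk hW => [|j IH] aj jk hW.
  have -> : dlog F (cub o i (p a) (p 0)) = zero_form; last by rewrite wedge0r.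
  have -> : a = 0%N by lia.
  apply/form_ext => z vs; have [|hs] := eqVneq (size vs) 1%N; last by rewrite homog_dlog.
  case: vs => [|v [|]] //= _.
  have [_ h1 h2] : off o i (p 0) by apply: ne; nlia.
  by rewrite dlog_cub // subrr.
have [ej|nj] := eqVneq a j.+1.
  have -> : dlog F (cub o i (p a) (p j.+1)) = zero_form; last by rewrite wedge0r.
  rewrite -ej; apply/form_ext => z vs.
  have [|hs] := eqVneq (size vs) 1%N; last by rewrite homog_dlog.
  by case: vs => [|v [|]] //= _; rewrite dlog_cub // subrr.
have [_ h1 h2] : off o i (p j) by apply: ne; nlia.
have [_ h3 h4] : off o i (p j.+1) by apply: ne; nlia.
rewrite (dlog_add _ ao ai h1 h2 h3 h4) wedgeDr IH.
- by rewrite add0_form (hW j.+1) //; nlia.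
- by nlia.
- by nlia.
- by move=> m hm; apply: hW; nlia.
Qed.

Let e := p k.+1.

Definition dlog_list j := cub o i (p a) e ::
  [seq cub o i (p m.-1) (p m) | m <- index_iota a.+1 j.+1].

Lemma mem_dlog_list j m : (a < m <= j)%N -> cub o i (p m.-1) (p m) \in dlog_list j.
Proof.
by move=> hm; rewrite inE; apply/orP; right; apply: map_f; rewrite mem_index_iota.
Qed.

Lemma dlog_list_rcons j : (a <= j)%N ->
  dlog_list j.+1 = rcons (dlog_list j) (cub o i (p j) (p j.+1)).
Proof. by move=> aj; rewrite /dlog_list index_iota_rcons // map_rcons. Qed.

(** By [dcr_move_zero] each differential is a multiple of an old logarithmic one plus a multiple of
    that of e / p_j. The latter is killed: e / p_j is the quotient of e / p_a, whose differential
    stands in front, by p_j / p_a, whose differential is a sum of earlier entries. *)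
Lemma wedges_move_zero j : (a <= j <= k)%N ->
  wedges (dlog F (cub o i (p a) e) ::
     [seq dcr (cub e i (p m.-1) (p m)) | m <- index_iota a.+1 j.+1]) =
  form_scale (fun z => \prod_(a.+1 <= m < j.+1)
     (P o i p m.-1 m z / (1 - P o i p m.-1 k.+1 z)))
   (dlogw F (dlog_list j)).
Proof.
move=> /andP[aj jk].
have [oi ao ai] : off o i (p a) by apply: ne; nlia.
have [_ eo ei] : off o i e by apply: ne; nlia.
have hd := @homog_dlog F S.
elim: j aj jk => [|j IH] aj jk.
  rewrite /dlog_list (_ : a = 0%N); last by lia.
  rewrite /index_iota /=; apply/form_ext => z vs.
  by rewrite /form_scale big_nil mul1r.
have [ej|nj] := eqVneq a j.+1.
  rewrite /dlog_list -ej /index_iota subnn /=; apply/form_ext => z vs.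
  by rewrite /form_scale big_nil mul1r.
have {}aj : (a <= j)%N by lia.
rewrite dlog_list_rcons // index_iota_rcons // !map_rcons -!cats1 -cat_cons !wedges_cat !wedges1.
rewrite {}IH //; last by lia.
have [_ h1 h2] : off o i (p j) by apply: ne; nlia.
have [_ h3 h4] : off o i (p j.+1) by apply: ne; nlia.
have h5 : p j != e by apply: (chain_inj ch); nlia.
have h6 : p j.+1 != e by apply: (chain_inj ch); nlia.
have [g ->] := dcr_move_zero F oi h1 h2 h3 h4 eo ei h5 h6.
set W := dlogw F (dlog_list j).
have kill : wedge W (dlog F (cub o i (p j) e)) = zero_form.
  have k1 : wedge W (dlog F (cub o i (p a) (p j))) = zero_form.
    apply: dlog_path_kill; first by nlia.
    by move=> m hm; apply: wedges_mem => //; apply: mem_dlog_list.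
  have k2 : wedge W (dlog F (cub o i (p a) e)) = zero_form.
    by apply: wedges_mem => //; apply: mem_head.
  by move: k2; rewrite (dlog_add _ ao ai h1 h2 eo ei) wedgeDr k1 add0_form.
rewrite wedgeDr !wedgeZl [wedge W (form_scale g _)]wedgeZr kill !scale_zero addr0_form.
rewrite [wedge W (form_scale _ _)]wedgeZr form_scaleA.
by congr form_scale; apply/funext => z; rewrite big_cat big_seq1.
Qed.

(** The change of zero multiplies the factor m of [den] by 1 - P_(m-1, k+1). These cancel the
    denominators of [wedges_move_zero], except for m = k, where the denominator is the last factor
    of the longer [den]. *)
Lemma prod_move_zero z : \prod_(a.+1 <= m < k.+1)
     (P o i p m.-1 m z / (1 - P o i p m.-1 k.+1 z)) * den e i p a k z =
  \prod_(a.+1 <= m < k.+1) P o i p m.-1 m z * den o i p a k.+1 z.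
Proof.
rewrite /den; have [ak'|ka] := ltnP a k; last by rewrite !big_geq // ?mulr1; nlia.
have -> : \prod_(a.+1 <= m < k) (1 - P e i p m.-1 m.+1 z)^-1 =
  \prod_(a.+1 <= m < k) ((1 - P o i p m.-1 k.+1 z) * (1 - P o i p m.-1 m.+1 z)^-1).
  apply: eq_big_nat => m hm.
  have [oi h1 h2] : off o i (p m.-1) by apply: ne; nlia.
  have [_ h3 h4] : off o i (p m.+1) by apply: ne; nlia.
  have [_ h5 h6] : off o i e by apply: ne; nlia.
  have h7 : p m.-1 != e by apply: (chain_inj ch); nlia.
  have h8 : p m.+1 != e by apply: (chain_inj ch); nlia.
  have h9 : p m.-1 != p m.+1 by apply: (chain_inj ch); nlia.
  rewrite /P -/e !cub_sub1 //; field.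
  by rewrite !conf_neq // eq_sym.
rewrite !big_split /= !(big_nat_recr k) //=; [|nlia..].
rewrite !prodfV mulrACA.
set Q := \prod_(a.+1 <= m < k) (1 - P o i p m.-1 k.+1 z).
have Q0 : Q != 0.
  rewrite prodf_seq_neq0; apply/allP => m; rewrite mem_index_iota => hm.
  by apply/implyP => _; apply: (P_neq1 ch); nlia.
rewrite -[_ * Q * _]mulrA; congr (_ * _).
by rewrite !mulrA divff // mul1r mulrC.
Qed.

Lemma prod_dlog j : (a <= j <= k.+1)%N ->
  wedges [seq dcr (cub o i (p m.-1) (p m)) | m <- index_iota a.+1 j.+1] =
  form_scale (fun z => \prod_(a.+1 <= m < j.+1) P o i p m.-1 m z)
    (wedges [seq dlog F (cub o i (p m.-1) (p m)) | m <- index_iota a.+1 j.+1]).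
Proof.
move=> hj; rewrite -wedges_scale; congr wedges; apply/eq_in_map => m.
rewrite mem_index_iota => hm.
have [_ h1 h2] : off o i (p m.-1) by apply: ne; nlia.
have [_ h3 h4] : off o i (p m) by apply: ne; nlia.
exact: dcr_dlog.
Qed.

(** The differential of log(e / p_a) is a sum of steps, of which only the last, from p_k to e,
    survives; it is moved to its place behind the k - a others. *)
Lemma dlog_first :
  dlogw F (dlog_list k) =
  form_sign (k - a)
    (wedges [seq dlog F (cub o i (p m.-1) (p m)) | m <- index_iota a.+1 k.+2]).
Proof.
have hd := @homog_dlog F S.
have [oi ao ai] : off o i (p a) by apply: ne; nlia.
have [_ eo ei] : off o i e by apply: ne; nlia.
have [_ h1 h2] : off o i (p k) by apply: ne; nlia.
rewrite /dlog_list /= (dlog_add _ ao ai h1 h2 eo ei) wedgeDl.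
have wm q := wedge_move [seq cub o i (p m.-1) (p m) | m <- index_iota a.+1 k.+1] (hd q) hd.
rewrite !wm dlog_path_kill; [|nlia|]; last first.
  by move=> m hm; apply: wedges_mem => //; apply: map_f; rewrite mem_index_iota.
rewrite scale_zero add0_form index_iota_rcons // map_rcons -cats1 wedges_cat wedges1.
by rewrite size_map size_iota subSS -map_comp.
Qed.

(** Where x_(a+1), ..., x_k are invertible, the point p_(k+1) can replace o as zero of the
    coordinate. Theta then splits off the differential of the ratio of p_(k+1) and p_a, and a
    generator on one variable less remains. *)
Lemma Theta_move :
  form_scale (fun z => \prod_(a.+1 <= m < k.+1) P o i p m.-1 m z) (Theta o i p a k.+1) =
  form_sign (k - a) (wedge (dcr (cub o i (p a) e)) (Theta e i p a k)).
Proof.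
have [oi ao ai] : off o i (p a) by apply: ne; nlia.
have [_ eo ei] : off o i e by apply: ne; nlia.
rewrite /Theta wedgeZr form_scaleA (dcr_dlog _ ao ai eo ei) wedgeZl.
rewrite -[wedge (dlog F _) _]/(wedges (dlog F (cub o i (p a) e) ::
     [seq dcr (cub e i (p m.-1) (p m)) | m <- index_iota a.+1 k.+1])).
rewrite wedges_move_zero ?ak ?leqnn // dlog_first prod_dlog ?leqnn; last by nlia.
rewrite !form_scaleA; congr form_scale; apply/funext => z.
have -> : \prod_(a.+1 <= m < k.+2) P o i p m.-1 m z = P o i p a k.+1 z.
  have h j : (a <= j <= k.+1)%N -> \prod_(a.+1 <= m < j.+1) P o i p m.-1 m z = P o i p a j z.
    elim: j => [|j IH] hj.
      rewrite (_ : a = 0%N) ?big_geq //; last by lia.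
      by rewrite (P_self ch) //; lia.
    have [<-|nj] := eqVneq a j.+1; first by rewrite big_geq // (P_self ch) //; lia.
    by rewrite big_nat_recr /=; [rewrite IH ?(P_mul ch) //|]; lia.
  by apply: h; lia.
rewrite -prod_move_zero -/(P o i p a k.+1 z).
have s1 : (-1) ^+ (k - a) * (-1) ^+ (k - a) = 1 :> F by rewrite -expr2 sqrr_sign.
move: s1; move: (_ ^+ _) (\prod_(_ <= _ < _) _) => s Q s1.
by rewrite -[LHS]mul1r -s1 /e; ring.
Qed.

End Fix.

(** Since 1 = (2 - x) x + (1 - x)^2, the functions x and (1 - x)^2 generate the unit ideal, and the
    factors x can be removed one after the other. *)
Lemma nice_unit n (xs : seq (conf F S -> F)) (w : form F S) :
  (forall x, List.In x xs ->
     cpoly c x /\ nice c n (form_scale (fun z => (1 - x z) ^+ 2) w)) ->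
  nice c n (form_scale (fun z => \prod_(x <- xs) x z) w) -> nice c n w.
Proof.
elim: xs => [|x xs IH] h.
  rewrite (_ : form_scale _ _ = w) //.
  by apply/form_ext => z vs; rewrite /form_scale big_nil mul1r.
move=> hw; apply: IH => [y hy|]; first by apply: h; right.
have [cx nx] := h x (or_introl erefl).
have cxs : cpoly c (fun z => \prod_(x <- xs) x z).
  have {nx hw} : forall y, List.In y xs -> cpoly c y.
    by move=> y hy; case: (h y (or_intror hy)).
  elim: xs {h} => [|y ys IH] h.
    by apply: (cpoly_ext _ (Cpoly_const c 1)) => z; rewrite big_nil.
  apply: (cpoly_ext _ (Cpoly_mul (h y (or_introl erefl)) (IH _))) => [z|u hu].
    by rewrite big_cons.
  by apply: h; right.
rewrite (_ : form_scale _ w = form_add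
    (form_scale (fun z => 2 - x z) (form_scale (fun z => \prod_(x <- x :: xs) x z) w))
    (form_scale (fun z => \prod_(x <- xs) x z) (form_scale (fun z => (1 - x z) ^+ 2) w))).
  apply: Nice_add; apply: nice_scale => //.
  by apply: cpoly_sub => //; apply: Cpoly_const.
by apply/form_ext => z vs; rewrite /form_add /form_scale big_cons; ring.
Qed.

(** Induction on the length of the chain. [Theta_split] treats (1 - x_m)^2 Theta, [Theta_move]
    treats Theta times the product of all x_m but the last, and [nice_unit] combines them. *)
Lemma nice_Theta o i p a b : (a <= b)%N -> chain c o i p a b -> nice c (b - a) (Theta o i p a b : form F S).
Proof.
move: {2}(b - a)%N (leqnn (b - a)) => n; elim: n o a b => [|n IH] o a b hn ab ch.
all: have [<-|nab] := eqVneq a b; first by rewrite /Theta /index_iota !subnn;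
  apply: (@Nice_gen _ _ _ _ _ [::]) => //;
  by apply: (cpoly_ext _ (Cpoly_const c 1)) => z; rewrite /den big_geq.
  by lia.
case: b ab hn ch nab => [|k] ab hn ch nab; first by lia.
have ak : (a <= k)%N by lia.
have xcr m : (a < m <= k.+1)%N -> crossing c (cub o i (p m.-1) (p m)).
  by move=> hm; apply: (crossing_cub ch); nlia.
have cx m : (a < m <= k.+1)%N -> cpoly c (P o i p m.-1 m).
  by move=> hm; apply: (cpoly_P _ ch); nlia.
apply: (@nice_unit _ [seq P o i p m.-1 m | m <- index_iota a.+1 k.+1]).
  move=> x hx; have [m hm ->] : exists2 m, (a < m <= k)%N & x = P o i p m.-1 m.
    by have [m] := In_map hx; rewrite mem_index_iota => hm ->; exists m.
  split; first by apply: cx; nlia.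
  have hm1 : (a <= m.-1 < k.+1)%N by lia.
  have m1 : m = m.-1.+1 by lia.
  have [r hr] := Theta_split F ch hm1; rewrite -m1 => ->.
  apply: nice_scale => //.
  have -> : (k.+1 - a = (m.-1 - a) + (1 + (k.+1 - m)))%N by lia.
  apply: nice_wedge; first by apply: IH; [lia|lia|apply: chain_sub ch; lia].
  apply: nice_wedge; first by apply/nice_dcr/xcr; lia.
  by apply: IH; [lia|lia|apply: chain_sub ch; lia].
have -> : (fun z => \prod_(x <- [seq P o i p m.-1 m | m <- index_iota a.+1 k.+1]) x z) =
   (fun z => \prod_(a.+1 <= m < k.+1) P o i p m.-1 m z).
  by apply/funext => z; rewrite big_map.
rewrite (Theta_move ch ak); apply: nice_scale; first exact: Cpoly_const.
rewrite subSn // -add1n; apply: nice_wedge.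
  by apply: nice_dcr; apply: (crossing_cub ch); nlia.
by apply: IH; [lia|lia|exact: (chain_move ak ch)].
Qed.

End ThetaMove.

(** * Regularity of arc forms *)

Section Arcs.
Variables (F : fieldType) (S : finType) (c : cycord S).
Implicit Types (o i : S) (p : nat -> S) (n m : nat) (z : conf F S).

(* The geometric series of the products of the cubical coordinates along the arcs of E *)
Definition arcs o i p (E : seq (nat * nat)) z : F :=
  \prod_(e <- E) (P o i p e.1 e.2 z / (1 - P o i p e.1 e.2 z)).

Definition cubical o i p n : seq (quad S) :=
  [seq cub o i (p m.-1) (p m) | m <- index_iota 1 n.+1].

Definition Omega o i p n E : form F S :=
  form_scale (arcs o i p E) (dlogw F (cubical o i p n)).

Lemma arcs_cat o i p E E' z : arcs o i p (E ++ E') z = arcs o i p E z * arcs o i p E' z.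
Proof. by rewrite /arcs big_cat. Qed.

Section Fix.
Variables (o i : S) (p : nat -> S) (n : nat).
Hypothesis ch : chain c o i p 0 n.

Lemma prod_cubical z m : (m <= n)%N -> \prod_(1 <= k < m.+1) P o i p k.-1 k z = P o i p 0 m z.
Proof.
elim: m => [|m IH] hm; first by rewrite big_geq // (P_self ch).
by rewrite big_nat_recr //= IH ?(P_mul ch) //; lia.
Qed.

Lemma wedges_cubical :
  wedges [seq dcr q | q <- cubical o i p n] =
  form_scale (P o i p 0 n) (dlogw F (cubical o i p n)).
Proof.
rewrite (_ : P o i p 0 n = fun z => \prod_(1 <= k < n.+1) P o i p k.-1 k z); last first.
  by apply/funext => z; rewrite prod_cubical.
rewrite -!map_comp -wedges_scale; congr wedges; apply/eq_in_map => m.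
rewrite mem_index_iota => hm.
have [_ h1 h2] : off o i (p m.-1) by apply: (chain_neq ch); nlia.
have [_ h3 h4] : off o i (p m) by apply: (chain_neq ch); nlia.
exact: dcr_dlog.
Qed.

Lemma Theta_dlog : Theta o i p 0 n =
  form_scale (fun z => den o i p 0 n z * P o i p 0 n z)
    (dlogw F (cubical o i p n)).
Proof. by rewrite /Theta map_comp -/(cubical _ _ _ _) wedges_cubical form_scaleA. Qed.

(** By [Theta_dlog] the bracket is the coefficient of Theta against the logarithmic differentials,
    so the condition makes the form with coefficient f a polynomial multiple of Theta. *)
Definition fits f := exists2 N : conf F S -> F, cpoly c N &
  forall z, f z = N z * (den o i p 0 n z * P o i p 0 n z).

Lemma nice_fits f : fits f ->
  nice c n (form_scale f (dlogw F (cubical o i p n))).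
Proof.
case=> N hN e; rewrite (funext e) -form_scaleA -Theta_dlog; apply: nice_scale => //.
by rewrite -{1}[n]subn0; apply: nice_Theta.
Qed.

(* Each arc (a, b) is paid for by a peak m strictly between a and b. *)
Lemma arcs_peaks (T : seq (nat * nat * nat)) :
  uniq [seq t.2 | t <- T] ->
  all (fun t => (t.1.1 < t.2 < t.1.2)%N && (t.1.2 <= n)%N) T ->
  exists2 N, cpoly c N & forall z,
    \prod_(t <- T) (1 - P o i p t.1.1 t.1.2 z)^-1 = N z * den o i p 0 n z.
Proof.
move=> uT aT; rewrite /den.
have sT : {subset [seq t.2 | t <- T] <= index_iota 1 n}.
  move=> m /mapP[t /(allP aT) ht ->]; rewrite mem_index_iota.
  by move: ht => /andP[]; lia.
(* The induction needs an arbitrary set s of available peaks, from which the peak of each treated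
   arc is removed. *)
suff : forall s, uniq s -> {subset s <= index_iota 1 n} ->
    {subset [seq t.2 | t <- T] <= s} -> exists2 N, cpoly c N & forall z,
    \prod_(t <- T) (1 - P o i p t.1.1 t.1.2 z)^-1 =
    N z * \prod_(m <- s) (1 - P o i p m.-1 m.+1 z)^-1.
  by apply=> //; apply: iota_uniq.
elim: T uT aT {sT} => [|[[a b] m] T IH] /=.
  (* The factors of [den] at peaks that belong to no arc are compensated by their numerators 1 - P
     in N. *)
  move=> _ _ s _ hs _; exists (fun z => \prod_(m <- s) (1 - P o i p m.-1 m.+1 z)).
    rewrite (_ : (fun z => _) = fun z => \prod_(m <- s | m \in s) (1 - P o i p m.-1 m.+1 z)).
      apply: cpoly_prod => m /hs; rewrite mem_index_iota => hm.
      by apply: cpoly_sub; [exact: Cpoly_const|apply: (cpoly_P _ ch); nlia].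
    by apply/funext => z; rewrite big_seq.
  move=> z; rewrite big_nil -big_split /= big_seq big1 // => m /hs.
  by rewrite mem_index_iota => hm; rewrite divff // (P_neq1 ch) //; nlia.
move=> /andP[mT uT] /andP[hab aT] s us hs sT.
have ms : m \in s by apply: sT; apply: mem_head.
have [] := IH uT aT (rem m s) (rem_uniq _ us).
- by move=> x /mem_rem/hs.
- move=> x xT; rewrite mem_rem_uniq // inE; apply/andP; split.
    by apply: contraNneq mT => <-.
  by apply: sT; rewrite inE xT orbT.
move=> N hN e.
exists (fun z => (1 - P o i p m.-1 m.+1 z) / (1 - P o i p a b z) * N z).
  apply: Cpoly_mul => //.
  by apply: (@cpoly_ratio F S c o i p 0 n ch a m.-1 m.+1 b); nlia.
move=> z; rewrite big_cons /= e (perm_big _ (perm_to_rem ms)) /= big_cons.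
have h : 1 - P o i p m.-1 m.+1 z != 0 by apply: (P_neq1 ch); nlia.
have h' : 1 - P o i p a b z != 0 by apply: (P_neq1 ch); nlia.
by field; rewrite h.
Qed.

End Fix.
End Arcs.

(** * Arc forms with one differential singled out *)

Section Split.
Variables (F : fieldType) (S : finType) (c : cycord S).
Variables (o i : S) (p : nat -> S) (n : nat).
Hypothesis ch : chain c o i p 0 n.
Implicit Types (z : conf F S) (f : conf F S -> F).

Let ne m : (m <= n)%N -> off o i (p m).
Proof. by move=> hm; apply: (chain_neq ch); lia. Qed.

Lemma arcs_stuffle a b d z : (a < b < d)%N -> (d <= n)%N ->
  arcs o i p [:: (a, b); (b, d)] z =
  arcs o i p [:: (a, d); (a, b)] z + arcs o i p [:: (a, d); (b, d)] z
  + arcs o i p [:: (a, d)] z.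
Proof.
move=> hab hd; rewrite /arcs !big_cons !big_nil /= !mulr1.
rewrite -(P_mul ch (k := b) a d z); last by lia.
have h1 : 1 - P o i p a b z != 0 by apply: (P_neq1 ch); nlia.
have h2 : 1 - P o i p b d z != 0 by apply: (P_neq1 ch); nlia.
have : 1 - P o i p a d z != 0 by apply: (P_neq1 ch); nlia.
rewrite -(P_mul ch (k := b) a d z); last by lia.
by move=> h3; field; rewrite h1 h2 h3.
Qed.

(** Simplicial coordinates are products t_m = x_1 ... x_m, so the change of logarithmic
    differentials is unitriangular and preserves their wedge product. *)
Lemma wedges_from0 :
  wedges [seq dlog F (cub o i (p 0) (p m)) | m <- index_iota 1 n.+1] =
  dlogw F (cubical o i p n).
Proof.
have hd := @homog_dlog F S.
have [oi h1 h2] := ne (leq0n n).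
suff h j : (j <= n)%N -> wedges [seq dlog F (cub o i (p 0) (p m)) | m <- index_iota 1 j.+1] =
    dlogw F (cubical o i p j) by apply: h.
elim: j => [|j IH] hj //.
rewrite /cubical index_iota_rcons // !map_rcons -!cats1 !wedges_cat !wedges1 IH; last by lia.
have [_ h3 h4] := ne (ltnW hj).
have [_ h5 h6] := ne hj.
rewrite (dlog_add _ h1 h2 h3 h4 h5 h6) wedgeDr.
case: n ch ne hj => // k ch' ne' hj.
rewrite (@dlog_path_kill _ _ _ _ _ _ _ _ ch') ?add0_form //; first by lia.
by move=> m hm; apply: wedges_mem => //; apply: map_f; rewrite mem_index_iota.
Qed.

Definition cubical_but m : seq (quad S) :=
  [seq cub o i (p k.-1) (p k) | k <- index_iota 1 m ++ index_iota m.+1 n.+1].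

Lemma size_cubical_but m : (0 < m <= n)%N -> size (cubical_but m) = n.-1.
Proof. by move=> hm; rewrite size_map size_cat !size_iota; lia. Qed.

Lemma cubical_but_perm m : (0 < m <= n)%N ->
  perm_eq (rcons (cubical_but m) (cub o i (p m.-1) (p m))) (cubical o i p n).
Proof.
move=> hm; rewrite -map_rcons perm_map // perm_rcons.
have hm1 : (0 <= m.-1 < n)%N by lia.
have m1 : m.-1.+1 = m by lia.
rewrite (index_iota_split hm1) m1.
by rewrite -cat1s perm_catCA.
Qed.

(** The part (2 - T) T of the unit, for T = x_m, with dT in the first factor: the division by T is
    compensated by dT = T dlog T. *)
Lemma nice_but_top f m : fits c o i p n f -> (0 < m <= n)%N ->
  nice c n (form_scale (fun z => (2 - P o i p m.-1 m z) * (f z / P o i p m.-1 m z))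
    (wedge (dlogw F (cubical_but m))
       (dcr (cub o i (p m.-1) (p m))))).
Proof.
move=> hf hm; have [b hb] := wedges_perm (cubical_but_perm hm).
have [_ h1 h2] : off o i (p m.-1) by apply: ne; lia.
have [_ h3 h4] : off o i (p m) by apply: ne; lia.
rewrite dcr_dlog // wedgeZr form_scaleA -{1}(wedges1 (dlog F _)) -wedges_cat cats1 -map_rcons.
rewrite (hb _ _ (dlog F)); last by move=> q; apply: homog_dlog.
rewrite form_scaleA.
rewrite (_ : (fun z => _) = fun z => (2 - P o i p m.-1 m z) * (-1) ^+ b * f z).
  rewrite -form_scaleA; apply: nice_scale; last exact: nice_fits.
  apply: Cpoly_mul; last exact: Cpoly_const.
  by apply: cpoly_sub; [exact: Cpoly_const|apply: (cpoly_P _ ch); nlia].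
apply/funext => z; rewrite -/(P o i p m.-1 m z).
have h : P o i p m.-1 m z != 0 by apply: (P_neq0 ch); nlia.
by field.
Qed.

(** The part (1 - T)^2, without dT: this factor lets Theta fall apart at x_m by [den_split], and the
    m-th differential is left out. *)
Lemma nice_but f m : fits c o i p n f -> (0 < m <= n)%N ->
  nice c n.-1 (form_scale (fun z => (1 - P o i p m.-1 m z) ^+ 2 * (f z / P o i p m.-1 m z))
    (dlogw F (cubical_but m))).
Proof.
case=> N hN e hm.
have hm1 : (0 <= m.-1 < n)%N by lia.
have m1 : m.-1.+1 = m by lia.
have [r hr] := den_split F ch hm1; rewrite m1 => er.
have -> : form_scale (fun z => (1 - P o i p m.-1 m z) ^+ 2 * (f z / P o i p m.-1 m z))
    (dlogw F (cubical_but m)) =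
  form_scale (fun z => N z * r z) (wedge (Theta o i p 0 m.-1) (Theta o i p m n)).
  rewrite /Theta wedgeZl wedgeZr !form_scaleA -wedges_cat -map_cat m1.
  have -> : [seq dcr (cub o i (p k.-1) (p k)) | k <- index_iota 1 m ++ index_iota m.+1 n.+1] =
     [seq form_scale (P o i p k.-1 k) (dlog F (cub o i (p k.-1) (p k)))
     | k <- index_iota 1 m ++ index_iota m.+1 n.+1].
    apply/eq_in_map => k; rewrite mem_cat !mem_index_iota => hk.
    have [_ h1 h2] : off o i (p k.-1) by apply: ne; lia.
    have [_ h3 h4] : off o i (p k) by apply: ne; lia.
    exact: dcr_dlog.
  rewrite wedges_scale form_scaleA /cubical_but -map_comp; congr form_scale.
  apply/funext => z; rewrite e big_cat /=.
  have hx : P o i p m.-1 m z != 0 by apply: (P_neq0 ch); nlia.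
  have -> : P o i p 0 n z = \prod_(1 <= k < m) P o i p k.-1 k z * P o i p m.-1 m z *
      \prod_(m.+1 <= k < n.+1) P o i p k.-1 k z.
    rewrite -(prod_cubical ch z (leqnn n)) (@big_cat_nat _ _ _ m) /=; [|lia..].
    by rewrite [X in _ * X]big_ltn ?mulrA //; lia.
  move: (er z); move: hx; set x := P o i p m.-1 m z => hx er'.
  rewrite -[LHS](_ : N z * ((1 - x) ^+ 2 * den o i p 0 n z) *
     (\prod_(1 <= k < m) P o i p k.-1 k z * \prod_(m.+1 <= k < n.+1) P o i p k.-1 k z) = _).
    by rewrite er'; ring.
  by field.
apply: nice_scale; first exact: Cpoly_mul.
have -> : (n.-1 = (m.-1 - 0) + (n - m))%N by lia.
by apply: nice_wedge; apply: nice_Theta; rewrite ?leq0n //; [apply: chain_sub ch; lia|lia|apply: chain_sub ch; lia].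
Qed.

(** Removes dT, for T the product of all variables, from a top form. By [Theta_move], Theta times
    all x_m but the last is, up to sign, dT wedged with the generator whose zero is the last point.
    This is why a factor T is required on the right. *)
Lemma nice_interior f : (0 < n)%N -> fits c o i p n f ->
  exists2 psi, nice c n.-1 psi &
    wedge (dcr (cub o i (p 0) (p n))) psi =
    form_scale (fun z => P o i p 0 n z * f z) (dlogw F (cubical o i p n)).
Proof.
case: n ch => // k chk _ [N hN e].
(* The last variable completes the product of [Theta_move] to T, and (-1)^k cancels its sign. *)
exists (form_scale (fun z => N z * (P o i p k k.+1 z * (-1) ^+ k)) (Theta (p k.+1) i p 0 k)).
  apply: nice_scale.
    apply: Cpoly_mul => //; apply: Cpoly_mul; last exact: Cpoly_const.
    by apply: (cpoly_P _ chk); lia.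
  by rewrite -[X in nice _ X _]subn0; apply: nice_Theta => //; exact: (chain_move (leq0n k) chk).
have := Theta_move F chk (leq0n k); rewrite subn0 => em.
rewrite wedgeZr (_ : (fun z => _) = (fun z => N z * P o i p k k.+1 z * (-1) ^+ k)); last first.
  by apply/funext => z; rewrite mulrA.
rewrite -form_scaleA -em form_scaleA (Theta_dlog F chk) form_scaleA; congr form_scale.
apply/funext => z; rewrite e.
have hP : P o i p 0 k.+1 z = \prod_(1 <= m < k.+1) P o i p m.-1 m z * P o i p k k.+1 z.
  by rewrite -(prod_cubical chk z (leqnn k.+1)) big_nat_recr.
transitivity (N z * P o i p 0 k.+1 z * (den o i p 0 k.+1 z * P o i p 0 k.+1 z)); last by ring.
by rewrite {2}hP; ring.
Qed.

End Split.

(** * The standard cell *)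

Notation std n := (cyc_std n.+3).

Section Standard.
Variable n : nat.

(** The points at 0 and oo; [pt 0] is the point at 1, and [pt k] for k > 0 is the label k of the
    standard set. *)
Definition pto : 'I_n.+3 := inord 0.
Definition pti : 'I_n.+3 := inord 1.
Definition pt k : 'I_n.+3 := inord k.+2.

Lemma val_pto : pto = 0%N :> nat. Proof. by rewrite inordK. Qed.
Lemma val_pti : pti = 1%N :> nat. Proof. by rewrite inordK. Qed.
Lemma val_pt k : (k <= n)%N -> pt k = k.+2 :> nat. Proof. by move=> hk; rewrite inordK. Qed.

Lemma in_cyc_std m (a b d : 'I_m) : in_cyc (cyc_std m) a b d = cyc_nat a b d.
Proof. by rewrite /in_cyc inE. Qed.

Lemma chain_std : chain (std n) pto pti pt 0 n.
Proof.
split=> [m hm|m k hm hk]; rewrite in_cyc_std /cyc_nat val_pto ?val_pti !val_pt //; lia.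
Qed.

Lemma enum_std : enum 'I_n.+3 = [:: pto, pti, pt 0 & [seq pt k | k <- iota 1 n]].
Proof.
apply: (inj_map val_inj); rewrite val_enum_ord /= val_pto val_pti val_pt //.
have -> : iota 3 n = [seq (2 + k)%N | k <- iota 1 n] by rewrite -iotaDl.
congr [:: _, _, _ & _]; rewrite -map_comp; apply/eq_in_map => k; rewrite mem_iota => hk /=.
by rewrite val_pt //; lia.
Qed.

Lemma iota_index m : index_iota 1 m.+1 = iota 1 m.
Proof. by rewrite /index_iota subSS subn0. Qed.

Lemma simplicial_std : simplicial (enum 'I_n.+3) =
  [seq cub pto pti (pt 0) (pt k) | k <- index_iota 1 n.+1].
Proof. by rewrite enum_std /= -map_comp iota_index. Qed.

Lemma listing_std m : listing (cyc_std m) (enum 'I_m).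
Proof.
apply/and3P; split; first exact: enum_uniq.
  by apply/forallP => a; rewrite mem_enum.
do 3![apply/forallP => ?].
by rewrite in_cyc_std !index_enum_ord.
Qed.

Variable F : fieldType.

Notation dlogs := (dlogw F (cubical pto pti pt n)).

Lemma simplicial_vol_std : simplicial_vol F (enum 'I_n.+3) =
  form_scale (fun z => \prod_(1 <= k < n.+1) P pto pti pt 0 k z) dlogs.
Proof.
rewrite /simplicial_vol simplicial_std -map_comp -(wedges_from0 F chain_std) -wedges_scale.
congr wedges; apply/eq_in_map => k; rewrite mem_index_iota => hk /=.
have [oi h1 h2] := chain_neq chain_std (isT : (0 <= 0 <= n)%N).
have [_ h3 h4] : off pto pti (pt k).
  by apply: (chain_neq chain_std); lia.
exact: dcr_dlog.
Qed.

(** The reversed listing exchanges the points at 0 and 1, so each t becomes 1 - t, and it reverses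
    the order of the n differentials. The exponent n + n (n - 1) / 2 is that of the stuffle sign for
    a factor with n + 3 points. *)
Lemma rev_listing_std :
  simplicial_vol F (rev_listing (enum 'I_n.+3)) =
  form_sign ('C(n.+1, 2)) (simplicial_vol F (enum 'I_n.+3)).
Proof.
rewrite /simplicial_vol simplicial_std enum_std /= -!map_comp iota_index.
rewrite -map_rev -map_comp.
have -> : [seq (@dcr F _ \o (fun x => (x, pto, pt 0, pti)) \o pt) k | k <- rev (iota 1 n)] =
  [seq form_scale (fun=> -1) (dcr (cub pto pti (pt 0) (pt k))) | k <- rev (iota 1 n)].
  apply/eq_in_map => k; rewrite mem_rev mem_iota => hk.
  have [oi h1 h2] := chain_neq chain_std (isT : (0 <= 0 <= n)%N).
  have [_ h3 h4] : off pto pti (pt k).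
    by apply: (chain_neq chain_std); lia.
  have h5 : pt 0 != pt k by apply: (chain_inj chain_std); lia.
  apply/form_ext => z [|v [|]] //=; rewrite /form_scale /= ?mulr0 //.
  move: (conf_neq z oi) (conf_neq z h1) (conf_neq z h2) (conf_neq z h3) (conf_neq z h4).
  move: (conf_neq z h5).
  move: (z pto) (z pti) (z (pt 0)) (z (pt k)) (v pto) (v pti) (v (pt 0)) (v (pt k)).
  move=> zo zi z0 zk vo vi v0 vk e1 e2 e3 e4 e5 e6.
  have e3' : zo - z0 != 0 by rewrite -opprB oppr_eq0.
  have e1' : zk - z0 != 0 by rewrite -opprB oppr_eq0.
  by field; rewrite e1' e2 e3 e3' e4 e5 e6.
rewrite wedges_scale wedges_rev ?form_scaleA; last by move=> k; apply: homog_dcr.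
rewrite size_iota; congr form_scale; apply/funext => z.
by rewrite big_const_seq count_predT size_rev size_iota binS bin1 exprD mulrC iter_mulr_1.
Qed.

End Standard.

(** * Cyclic orders determined by a listing *)

(** Transitivity extends the hypothesis to all increasing triples from the first point, [cyc_mid] to
    all increasing triples and rotation to their cyclic permutations; asymmetry excludes the other
    triples. *)
Lemma cyc_listing (S : finType) (C : cycord S) (x0 : S) (q : seq S) :
  uniq q -> (forall a, a \in q) ->
  (forall j, (0 < j)%N -> (j.+1 < size q)%N ->
     in_cyc C (nth x0 q 0) (nth x0 q j) (nth x0 q j.+1)) ->
  listing C q.
Proof.
move=> uq aq hC.
have hA j k : (0 < j < k)%N -> (k < size q)%N -> in_cyc C (nth x0 q 0) (nth x0 q j) (nth x0 q k).
  elim: k => [|k IH] hj hk; first by lia.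
  have [->|njk] := eqVneq j k; first by apply: hC; lia.
  by apply: (cyc_trans (IH _ _) (hC k _ _)); lia.
have hB a b d : (index a q < index b q < index d q)%N -> in_cyc C a b d.
  have hx x : nth x0 q (index x q) = x by rewrite nth_index.
  have hd : (index d q < size q)%N by rewrite index_mem.
  move=> hjk; rewrite -(hx a) -(hx b) -(hx d).
  move: hd hjk; move: (index a q) (index b q) (index d q) => j k l hl hjk.
  have [->|j0] := eqVneq j 0%N; first by apply: hA; lia.
  by apply: (cyc_mid (hA j k _ _) (hA k l _ _)); lia.
have hD a b d : cyc_nat (index a q) (index b q) (index d q) -> in_cyc C a b d.
  by move=> /or3P[/hB//|/hB/cyc_rot/cyc_rot//|/hB/cyc_rot//].
apply/and3P; split=> //; first exact/forallP.
apply/forallP => a; apply/forallP => b; apply/forallP => d; apply/eqP; apply/idP/idP; last exact: hD.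
move=> h; have /and3P[ab bd ad] := cyc_uniq h.
have hi x y : x != y -> index x q != index y q.
  by apply: contra_neq => e; rewrite -(nth_index x0 (aq x)) e nth_index.
move: (hi _ _ ab) (hi _ _ bd) (hi _ _ ad) => h1 h2 h3.
apply/negPn/negP => hn; have /hD/cyc_asym : cyc_nat (index d q) (index b q) (index a q).
  by move: hn h1 h2 h3; rewrite /cyc_nat; nlia.
by rewrite h.
Qed.

Lemma listing_cyc (S : finType) (C : cycord S) q a b d : listing C q ->
  in_cyc C a b d = cyc_nat (index a q) (index b q) (index d q).
Proof. by case/and3P=> _ _ /forallP/(_ a)/forallP/(_ b)/forallP/(_ d)/eqP. Qed.

Lemma listing_uniq (S : finType) (C C' : cycord S) q : listing C q -> listing C' q -> C = C'.
Proof.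
move=> h h'; apply: val_inj; apply/setP => -[[a b] d].
by rewrite -!/(in_cyc _ _ _ _) (listing_cyc _ _ _ h) (listing_cyc _ _ _ h').
Qed.

Lemma cyc_std_uniq n (C : cycord 'I_n.+3) :
  (forall j, (0 < j)%N -> (j < n.+2)%N -> in_cyc C (inord 0) (inord j) (inord j.+1)) ->
  C = cyc_std n.+3.
Proof.
move=> h; apply: (listing_uniq _ (listing_std n.+3)).
apply: (@cyc_listing _ _ (inord 0)); first exact: enum_uniq.
  by move=> a; rewrite mem_enum.
have hn j : (j < n.+3)%N -> nth (inord 0) (enum 'I_n.+3) j = inord j.
  by move=> hj; apply: val_inj; rewrite /= nth_enum_ord // inordK.
by rewrite size_enum_ord => j j0 hj; rewrite !hn //; [apply: h|lia].
Qed.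

Lemma in_cyc_inord n (C : cycord 'I_n.+3) x y z j : in_cyc C x y z ->
  x = 0%N :> nat -> y = j :> nat -> z = j.+1 :> nat -> in_cyc C (inord 0) (inord j) (inord j.+1).
Proof. by move=> h <- <- <-; rewrite !inord_val. Qed.

Lemma o_st_orientation (R : realType) n : is_orientation (std n) (@o_st R n).
Proof. by exists (enum 'I_n.+3); [exact: listing_std|left]. Qed.

(** * Positivity on the cell *)

Section Cell.
Variables (R : realType).

(* Up to rescaling the points, the coordinates of a point of the cell are decreasing along a listing. *)
Lemma cell_signs (S : finType) (c : cycord S) (z : conf R S) : (2 < #|S|)%N -> in_cell c z ->
  exists s : seq S, listing c s /\ exists (kap : R) (eps : S -> R),
  forall x y, (index x s < index y s)%N -> 0 < kap * eps x * eps y * (z x - z y).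
Proof.
move=> hS /existsP[[s sz] /andP[ls p]]; exists s; split=> //.
case/and3P: (ls) => us /forallP as_ _.
case: s sz ls p us as_ => [|s1 [|s2 [|s3 r]]] sz ls p us as_;
  try by move: hS; rewrite -(eqP sz).
move: (us); rewrite /= !inE !negb_or -!andbA => /and5P[n12 n13 n1r n23 /and3P[n2r n3r ur]].
have has x : x \in [:: s1, s2, s3 & r] by [].
pose t x := cross_ratio (x, s3, s1, s2) z.
have t3 : t s3 = 1.
  rewrite /t /cross_ratio mulrC [X in X^-1 * _]mulrC mulVf //.
  by rewrite mulf_neq0 // conf_neq // eq_sym.
have srt : sorted >%R (rcons [seq t x | x <- s3 :: r] 0).
  by move: p; rewrite /= -map_comp t3.
have hidx x : (1 < index x [:: s1, s2, s3 & r])%N ->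
    [/\ x != s1, x != s2, index x [:: s1, s2, s3 & r] = (index x (s3 :: r)).+2
      & t x = nth 0 (rcons [seq t x | x <- s3 :: r] 0) (index x (s3 :: r))].
  have [->|n1] := eqVneq x s1; first by rewrite /= eqxx.
  have [->|n2] := eqVneq x s2; first by rewrite /= eqxx; case: ifP.
  move=> _; have hx : x \in s3 :: r by move: (has x); rewrite !inE (negbTE n1) (negbTE n2).
  split=> //; first by rewrite /= eq_sym (negbTE n1) eq_sym (negbTE n2).
  rewrite nth_rcons size_map index_mem hx.
  by rewrite (nth_map s3) ?index_mem // nth_index.
have hidx_size x : (1 < index x [:: s1, s2, s3 & r])%N -> (index x (s3 :: r) < (size r).+1)%N.
  by move=> /hidx[_ _ ex _]; rewrite -[(size r).+1]/(size (s3 :: r)) -2!ltnS -ex index_mem.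
have gt_nth i j : (i < j < (size r).+2)%N ->
    nth 0 (rcons [seq t x | x <- s3 :: r] 0) j < nth 0 (rcons [seq t x | x <- s3 :: r] 0) i.
  move=> /andP[ij hj]; have tr : transitive (>%R : rel R) by move=> u v y h1 h2; apply: lt_trans h2 h1.
  have szL : size (rcons [seq t x | x <- s3 :: r] 0) = (size r).+2 by rewrite size_rcons size_map.
  move: srt szL; move: (rcons _ _) => L srt szL.
  by apply: (sorted_ltn_nth tr 0 srt) => //; rewrite inE szL //; apply: ltn_trans hj.
have tgt x y : (1 < index x [:: s1, s2, s3 & r] < index y [:: s1, s2, s3 & r])%N -> t y < t x.
  move=> /andP[hx hxy]; have [_ _ ex ->] := hidx x hx.
  have hy := ltn_trans hx hxy; have [_ _ ey ->] := hidx y hy.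
  by apply: gt_nth; rewrite -2!ltnS -ex -ey hxy ltnS ltnW // hidx_size.
have tpos x : (1 < index x [:: s1, s2, s3 & r])%N -> 0 < t x.
  move=> hx; have [_ _ _ ->] := hidx x hx.
  have e0 : nth 0 (rcons [seq t x | x <- s3 :: r] 0) (size (s3 :: r)) = 0 :> R.
    by rewrite nth_rcons size_map ltnn eqxx.
  by rewrite -[X in X < _]e0; apply: gt_nth; rewrite /= ltnSn hidx_size.
(* For points other than s1, s2 the difference t x - t y is kap / ((z x - z s2) (z y - z s2)) times
   z x - z y, whence eps. The point s1 is listed first although t = 0 there, so its weight gets the
   opposite sign; s2 is at t = oo, and the weight -kap turns its products with later points, and
   that of s1 with it, into kap^2. *)
pose kap := (z s3 - z s2) / (z s3 - z s1) * (z s1 - z s2).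
pose eps x := if x == s1 then - (z s1 - z s2)^-1 else if x == s2 then - kap else (z x - z s2)^-1.
have d12 := conf_neq z n12.
have d31 : z s3 - z s1 != 0 by apply: conf_neq; rewrite eq_sym.
have d32 : z s3 - z s2 != 0 by apply: conf_neq; rewrite eq_sym.
have k0 : kap != 0 by rewrite !mulf_neq0 ?invr_neq0.
exists kap, eps => x y hxy.
have y1 : y != s1 by apply: contraTneq hxy => ->; rewrite /= eqxx.
have [ex|nx1] := eqVneq x s1.
  rewrite ex {1}/eps eqxx; have [ey|ny2] := eqVneq y s2.
    rewrite ey /eps eq_sym (negbTE n12) eqxx.
    rewrite (_ : _ * _ = kap ^+ 2); last by field.
    by rewrite lt_def sqrf_eq0 k0 sqr_ge0.
  have hy : (1 < index y [:: s1, s2, s3 & r])%N.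
    by rewrite /= eq_sym (negbTE y1) eq_sym (negbTE ny2).
  rewrite /eps (negbTE y1) (negbTE ny2).
  have dy := conf_neq z ny2.
  rewrite (_ : _ * _ = t y); first exact: tpos.
  by rewrite /kap /t /cross_ratio; field; rewrite d12 d31 dy.
have [ex|nx2] := eqVneq x s2.
  have ny2 : y != s2.
    by apply: contraTneq hxy => ->; rewrite ex ltnn.
  rewrite ex {1}/eps eq_sym (negbTE n12) eqxx /eps (negbTE y1) (negbTE ny2).
  have dy := conf_neq z ny2.
  rewrite (_ : _ * _ = kap ^+ 2); last by field.
  by rewrite lt_def sqrf_eq0 k0 sqr_ge0.
have hx : (1 < index x [:: s1, s2, s3 & r])%N.
  by rewrite /= eq_sym (negbTE nx1) eq_sym (negbTE nx2).
have [_ ny2 _ _] := hidx y (ltn_trans hx hxy).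
rewrite /eps (negbTE nx1) (negbTE nx2) (negbTE y1) (negbTE ny2).
have dy := conf_neq z ny2; have dx := conf_neq z nx2.
rewrite (_ : _ * _ = t x - t y); first by rewrite subr_gt0 tgt // hx.
by rewrite /kap /t /cross_ratio; field; rewrite d31 dx dy.
Qed.

(** The weights of [cell_signs] cancel in a cross-ratio, so its sign can be read off from the
    positions of the four points in the listing. *)
Lemma cell_pos (S : finType) (c : cycord S) (z : conf R S) a b d e :
  in_cell c z -> in_cyc c a b d -> in_cyc c a d e ->
  0 < cross_ratio (cub a b d e) z.
Proof.
move=> hz h1 h2.
have hS : (2 < #|S|)%N.
  have /and3P[ab bd ad] := cyc_uniq h1.
  have /card_uniqP e3 : uniq [:: a; b; d] by rewrite /= !inE negb_or ab ad bd.
  by rewrite -[(2 < _)%N]/(size [:: a; b; d] <= _)%N -e3 max_card.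
have [s [ls [kap [eps hs]]]] := cell_signs hS hz.
move: h1 h2; rewrite !(listing_cyc _ _ _ ls) => h1 h2.
pose h x y := kap * eps x * eps y * (z x - z y).
have hh x y : h x y = - h y x by rewrite /h; ring.
have h0 x y : index x s != index y s -> h x y != 0.
  rewrite neq_ltn => /orP[/hs|/hs] h3; first by rewrite lt0r_neq0.
  by rewrite hh oppr_eq0 lt0r_neq0.
have [hea hdb heb hda] :
    [/\ h e a != 0, h d b != 0, h e b != 0 & h d a != 0].
  by split; apply: h0; move: h1 h2; rewrite /cyc_nat; lia.
have -> : cross_ratio (cub a b d e) z = (h e a * h d b) / (h e b * h d a).
  move: hea hdb; rewrite /h !mulf_eq0 !negb_or -!andbA.
  move=> /and4P[k0 e0 a0 zea] /and4P[_ d0 b0 zdb].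
  move: heb hda; rewrite /h !mulf_eq0 !negb_or -!andbA.
  move=> /and4P[_ _ _ zeb] /and4P[_ _ _ zda].
  by rewrite /cub /cross_ratio; field; rewrite k0 e0 a0 zeb zda d0 b0.
have hp x y : (index x s < index y s)%N -> 0 < h x y by move=> /hs.
have hn x y : (index y s < index x s)%N -> h x y < 0 by move=> /hs; rewrite hh oppr_lt0.
have sgn x y : h x y != 0 -> (index x s < index y s)%N /\ 0 < h x y \/
    (index y s < index x s)%N /\ h x y < 0.
  have [/[dup] /hp|/[dup] /hn|e'] := ltngtP (index x s) (index y s); [by left|by right|].
  move=> /negP[]; have -> : x = y; last by rewrite /h subrr mulr0.
  by case/and3P: ls => _ /forallP ma _; rewrite -(nth_index x (ma x)) e' nth_index.
move: h1 h2; rewrite /cyc_nat.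
case: (sgn _ _ hea) => [[i1 p1]|[i1 p1]]; case: (sgn _ _ hdb) => [[i2 p2]|[i2 p2]];
case: (sgn _ _ heb) => [[i3 p3]|[i3 p3]]; case: (sgn _ _ hda) => [[i4 p4]|[i4 p4]] => h1 h2;
 try (by exfalso; clear -i1 i2 i3 i4 h1 h2; lia).
all: move: p1 p2 p3 p4; move: (h e a) (h d b) (h e b) (h d a) => u1 u2 u3 u4 p1 p2 p3 p4.
all: rewrite -sgr_cp0 !sgrM sgrV sgrM.
all: try rewrite (gtr0_sg p1); try rewrite (ltr0_sg p1).
all: try rewrite (gtr0_sg p2); try rewrite (ltr0_sg p2).
all: try rewrite (gtr0_sg p3); try rewrite (ltr0_sg p3).
all: try rewrite (gtr0_sg p4); try rewrite (ltr0_sg p4).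
all: rewrite ?(mulr1, mul1r, mulrN1, mulN1r, opprK, invrN1, invr1).
all: by [].
Qed.

Lemma P_pos n (z : conf R 'I_n.+3) a b : in_cell (std n) z -> (a <= b <= n)%N ->
  0 < P (pto n) (pti n) (@pt n) a b z.
Proof.
move=> hz hab; have ch := chain_std n.
have [->|nab] := eqVneq a b; first by rewrite (P_self ch) ?ltr01 //; lia.
by case: ch => h1 h2; apply: (cell_pos hz (h1 a _) (h2 a b _ _)); lia.
Qed.
End Cell.

Lemma simplicial_map (S S' : Type) (f : embedding S S') s :
  simplicial [seq f x | x <- s] = [seq quad_map f q | q <- simplicial s].
Proof. by case: s => [|s1 [|s2 [|s3 r]]] //=; rewrite -!map_comp. Qed.

(** * Transport of cells along isomorphisms of cyclic orders *)

Section Transport.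
Variables (R : realType) (S S' : finType) (f : embedding S S') (c : cycord S) (c' : cycord S').
Hypothesis bf : bijective f.
Hypothesis ef : cyc_emb f c c'.

Lemma listing_map s : listing c s -> listing c' [seq f x | x <- s].
Proof.
have fi := @emb_inj _ _ f; case: bf => g fg gf.
move=> /[dup] ls /and3P[us /forallP ms _]; apply/and3P; split; first by rewrite map_inj_uniq.
  by apply/forallP => a; rewrite -(gf a); apply: map_f.
apply/forallP => a; apply/forallP => b; apply/forallP => d; rewrite -(gf a) -(gf b) -(gf d).
by rewrite !index_map // -(listing_cyc _ _ _ ls) (cyc_embP _ _ _ ef).
Qed.

Lemma in_cell_map (z : conf R S') : in_cell c (emb_comp z f) = in_cell c' z.
Proof.
have cS : #|S| = #|S'| by apply: bij_eq_card bf.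
have fi := @emb_inj _ _ f; have := bf => -[g fg gf].
have cr s : [seq cross_ratio q (emb_comp z f) | q <- simplicial s] =
    [seq cross_ratio q z | q <- simplicial [seq f x | x <- s]].
  by rewrite simplicial_map -map_comp; apply: eq_map => q; rewrite cross_ratio_pull.
apply/existsP/existsP => -[s /andP[ls p]].
  have hs : size [seq f x | x <- s] == #|S'| by rewrite size_map size_tuple cS.
  by exists (Tuple hs); rewrite /= listing_map // -cr.
have hs : size [seq g x | x <- s] == #|S| by rewrite size_map size_tuple cS.
exists (Tuple hs) => /=.
have e : [seq f x | x <- [seq g x | x <- s]] = s.
  by rewrite -map_comp -[RHS]map_id; apply: eq_map => x /=.
rewrite cr e p andbT; case/and3P: (ls) => us /forallP ms _; apply/and3P; split.
- by rewrite map_inj_uniq //; exact: can_inj gf.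
- by apply/forallP => a; rewrite -(fg a); apply: map_f.
- apply/forallP => a; apply/forallP => b; apply/forallP => d.
  rewrite -(fg a) -(fg b) -(fg d) !index_map; try exact: can_inj gf.
  by rewrite (cyc_embP _ _ _ ef) !fg (listing_cyc _ _ _ ls).
Qed.

Lemma pull_orient (eta : form R S) : pull f (orient c eta) = orient c' (pull f eta).
Proof. by apply/form_ext => z vs; rewrite /pull /orient in_cell_map. Qed.

End Transport.

(** * Pushouts and embeddings of standard sets *)

(** Two injections that cover P and overlap exactly in the image of K present P as a pushout; the
    induced map is defined by a classical choice of preimages. *)
Lemma pushoutP (K T1 T2 P : Type) (i1 : K -> T1) (i2 : K -> T2) (j1 : T1 -> P) (j2 : T2 -> P) :
  injective j1 -> injective j2 -> (forall k, j1 (i1 k) = j2 (i2 k)) ->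
  (forall x, (exists y, j1 y = x) \/ (exists y, j2 y = x)) ->
  (forall y1 y2, j1 y1 = j2 y2 -> exists k, y1 = i1 k /\ y2 = i2 k) ->
  is_pushout i1 i2 j1 j2.
Proof.
move=> inj1 inj2 com cov ov; split=> // X f1 f2 ef.
have D x : {y | j1 y = x} + {y | j2 y = x}.
  case: (pselect (exists y, j1 y = x)) => [/cid|n1]; first by left.
  by right; apply: cid; case: (cov x).
pose h x := match D x with inl y => f1 (sval y) | inr y => f2 (sval y) end.
have h1 x : h (j1 x) = f1 x.
  rewrite /h; case: (D (j1 x)) => -[y e] /=; first by rewrite (inj1 _ _ e).
  by have [k [-> ->]] := ov _ _ (esym e); rewrite ef.
have h2 x : h (j2 x) = f2 x.
  rewrite /h; case: (D (j2 x)) => -[y e] /=; last by rewrite (inj2 _ _ e).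
  by have [k [-> ->]] := ov _ _ e; rewrite ef.
exists h; split=> // h' [h1' h2']; apply/funext => x.
by case: (cov x) => -[y <-]; rewrite ?h1 ?h1' ?h2 ?h2'.
Qed.

Section OrdEmb.
Variables (a b : nat) (f : nat -> nat).
Hypothesis fb : forall x, (x < a)%N -> (f x < b.+1)%N.
Hypothesis fi : forall x y, (x < a)%N -> (y < a)%N -> f x = f y -> x = y.

Lemma ord_emb_inj : injective (fun x : 'I_a => inord (f x) : 'I_b.+1).
Proof.
move=> x y /(congr1 val) /=; rewrite !inordK ?fb // => e; apply: val_inj.
exact: fi e.
Qed.

Definition ord_emb : embedding 'I_a 'I_b.+1 := Embedding ord_emb_inj.

Lemma ord_embE x : ord_emb x = f x :> nat.
Proof. by rewrite /= inordK ?fb. Qed.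
End OrdEmb.

Lemma cyc_emb_mono a b (f : nat -> nat) (j : embedding 'I_a 'I_b) :
  (forall x, j x = f x :> nat) -> (forall x y, (x < y)%N -> (f x < f y)%N) ->
  cyc_emb j (cyc_std a) (cyc_std b).
Proof.
move=> jf fm; apply/cyc_embP => x y z; rewrite !in_cyc_std !jf /cyc_nat.
have ff u v : (f u < f v)%N = (u < v)%N.
  by case: (ltngtP u v) => [/fm->//|/fm h|->]; rewrite ?ltnn // ltnNge (ltnW h).
by rewrite !ff.
Qed.

Lemma pull_dlog (F : fieldType) (T S : Type) (f : embedding T S) (q : quad T) :
  pull f (dlog F q) = dlog F (quad_map f q).
Proof.
rewrite /dlog pull_scale pull_dcr; congr form_scale.
by apply/funext => z; rewrite cross_ratio_pull.
Qed.

(** Exchanging the points at 0 and oo inverts the coordinate. This describes the effect of the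
    order-reversing gluing on ratios. *)
Lemma cub_swap (F : fieldType) (S : Type) (o i a b : S) (z : conf F S) :
  cross_ratio (cub i o a b) z = cross_ratio (cub o i b a) z.
Proof. by rewrite /cub /cross_ratio; congr (_ / _); rewrite mulrC. Qed.

Lemma dcr_swap (F : fieldType) (S : Type) (o i a b : S) :
  @dcr F S (cub i o a b) = dcr (cub o i b a).
Proof.
apply/form_ext => z [|v [|]] //; rewrite /dcr /cub.
by congr (_ * _); [exact: cub_swap|ring].
Qed.

Lemma dlog_swap (F : fieldType) (S : Type) (o i a b : S) :
  dlog F (cub i o a b) = dlog F (cub o i b a).
Proof.
rewrite /dlog dcr_swap; congr form_scale.
by apply/funext => z; rewrite cub_swap.
Qed.

Lemma diff_form_dlogs (R : realType) (S : finType) (g : conf R S -> R) (qs : seq (quad S)) :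
  all (@distinct S) qs ->
  diff_form (size qs) (form_scale g (dlogw R qs)).
Proof.
move=> aq z; exists [:: (g z * \prod_(q <- qs) (cross_ratio q z)^-1, qs)]; split.
  by rewrite /= eqxx aq.
by move=> vs; rewrite big_seq1 /= /dlog wedges_scale /form_scale mulrA.
Qed.

Lemma cubical_distinct (S : finType) (c : cycord S) o i p n : chain c o i p 0 n ->
  all (@distinct S) (cubical o i p n).
Proof.
move=> ch; apply/allP => q /mapP[k]; rewrite mem_index_iota => hk ->.
by apply: (@crossing_distinct _ c); apply: (crossing_cub ch); lia.
Qed.

(** * Orientations up to positive factors and signs *)

Section Orient.
Variables (R : realType) (S : finType) (c : cycord S).
Implicit Types (eta : form R S).

Lemma orient_pos (g : conf R S -> R) eta : (forall z, in_cell c z -> 0 < g z) ->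
  orient c (form_scale g eta) = orient c eta.
Proof.
move=> hg; apply/form_ext => z vs; rewrite /orient /form_scale; case: ifP => // hz.
by rewrite sgrM gtr0_sg ?mul1r // hg.
Qed.

Lemma orient_sign (b : bool) eta : orient c (form_sign b eta) =
  if b then orient_opp (orient c eta) else orient c eta.
Proof.
case: b; last by rewrite form_scale1.
apply/form_ext => z vs; rewrite /orient /orient_opp /form_scale expr1 mulN1r.
by case: ifP; rewrite ?sgrN ?oppr0.
Qed.

Lemma is_orientation_opp (o : orientation R S) : is_orientation c o -> is_orientation c (orient_opp o).
Proof.
case=> s ls [->|->]; exists s => //; [by right|left].
by apply/form_ext => z vs; rewrite /orient_opp opprK.
Qed.
End Orient.

(** * Sums and multiples of regular forms *)

Section RegularForms.
Variables (F : fieldType) (S : finType) (c : cycord S) (k : nat).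
Implicit Types (w : form F S).

Lemma regular_terms (X : stable_curve F S) (f : conf F S -> F) d
    (l : seq ((conf F S -> F) * seq (quad S))) : cr_poly X f d ->
  (forall x, List.In x l ->
     [/\ exists b, cr_poly X x.1 b, size x.2 = k
       & all (fun q => distinct q && cr_finite X q) x.2]) ->
  forall x, List.In x [seq ((fun z => f z * y.1 z), y.2) | y <- l] ->
     [/\ exists b, cr_poly X x.1 b, size x.2 = k
       & all (fun q => distinct q && cr_finite X q) x.2].
Proof.
move=> hf; elim: l => //= y l IH hl x [<-|hx]; last by apply: IH hx => u ul; apply: hl; right.
have [[b hb] sy ay] := hl y (or_introl erefl); split=> //.
by exists (d * b); apply: Cr_mul.
Qed.

Lemma regular_scale (a : F) w : regular_form c k w -> regular_form c k (form_scale (fun=> a) w).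
Proof.
move=> hw X /hw[h [a' [l [h1 h2 h3 h4]]]].
exists h, a', [seq ((fun z => a * x.1 z), x.2) | x <- l]; split=> // [|z vs].
  exact: regular_terms (Cr_const X a) h3.
rewrite /form_scale mulrCA h4 mulr_sumr big_map /=.
by apply: eq_bigr => x _; rewrite mulrA.
Qed.

Lemma regular_add w1 w2 : regular_form c k w1 -> regular_form c k w2 ->
  regular_form c k (form_add w1 w2).
Proof.
move=> hw1 hw2 X XM; have [h [a [l [h1 h2 h3 h4]]]] := hw1 X XM.
have [h' [a' [l' [h1' h2' h3' h4']]]] := hw2 X XM.
exists (fun z => h z * h' z), (a * a').
exists ([seq ((fun z => h' z * x.1 z), x.2) | x <- l] ++
        [seq ((fun z => h z * x.1 z), x.2) | x <- l']); split.
- exact: Cr_mul.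
- exact: mulf_neq0.
- move=> x hx; case: (List.in_app_or _ _ _ hx).
    exact: regular_terms h1' h3 x.
  exact: regular_terms h1 h3' x.
move=> z vs; transitivity (h' z * (h z * w1 z vs) + h z * (h' z * w2 z vs)).
  by rewrite /form_add; ring.
rewrite h4 h4' !mulr_sumr big_cat !big_map.
by congr (_ + _); apply: eq_bigr => x _; rewrite mulrA.
Qed.
End RegularForms.

(** * Additivity and signs of the formal integral *)

Section Integral.
Variables (R : realType) (A : comAlgType rat) (I : integral_data R A).
Hypothesis hI : formal_cell_zeta I.

Section Fixed.
Variables (S : finType) (c : cycord S) (o : orientation R S).
Hypothesis hS : (3 <= #|S|)%N.
Hypothesis ho : is_orientation c o.
Implicit Types (w : form R[i] S).

Lemma cellint_add w1 w2 : top_form c w1 -> top_form c w2 ->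
  I c o (form_add w1 w2) = I c o w1 + I c o w2.
Proof.
case: hI => h _ _ h1 h2; have := h S c o 1 w1 w2 hS ho h1 h2.
rewrite scale1r => <-; congr (I c o _).
by apply/form_ext => z vs; rewrite /form_add rmorph1 mul1r.
Qed.

Lemma top_form0 : top_form c (fun _ _ => 0 : R[i]).
Proof. exact/nice_regular/Nice_zero. Qed.

Lemma cellint0 : I c o (fun _ _ => 0) = 0.
Proof.
have := cellint_add top_form0 top_form0.
rewrite (_ : form_add _ _ = fun _ _ => 0); last first.
  by apply/form_ext => z vs; rewrite /form_add addr0.
by move/eqP; rewrite -subr_eq0 opprD addNKr oppr_eq0 => /eqP.
Qed.

Lemma cellint_opp w : top_form c w -> I c o (form_scale (fun=> -1) w) = - I c o w.
Proof.
case: hI => h _ _ h1; have := h S c o (-1) w _ hS ho h1 top_form0.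
rewrite cellint0 addr0 scaleN1r => <-; congr (I c o _).
by apply/form_ext => z vs; rewrite /form_scale rmorphN1 addr0.
Qed.
End Fixed.

Lemma cellint_sign (S : finType) (c : cycord S) (b b' : bool) (eta : form R S) (w : form R[i] S) :
  (3 <= #|S|)%N -> is_orientation c (orient c eta) -> top_form c w ->
  I c (orient c (form_sign b eta)) (form_sign b' w) =
  (-1) ^+ b * ((-1) ^+ b' * I c (orient c eta) w).
Proof.
move=> hS ho hw; rewrite orient_sign.
have hw' : top_form c (form_sign b' w).
  exact: regular_scale.
have -> : I c (if b then orient_opp (orient c eta) else orient c eta)
    (form_sign b' w) =
  (-1) ^+ b * I c (orient c eta) (form_sign b' w).
  case: b; last by rewrite mul1r.
  by case: hI => _ h _; rewrite h // mulN1r.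
congr (_ * _); case: b' {hw'}; last by rewrite form_scale1 mul1r.
by rewrite cellint_opp // mulN1r.
Qed.
End Integral.

(** * Reversing an interval of cubical coordinates *)

Notation cubn n a b := (cub (pto n) (pti n) (@pt n a) (@pt n b)).
Notation Pn n := (P (pto n) (pti n) (@pt n)).
Notation dlogs F n := (dlogw F (cubical (pto n) (pti n) (@pt n) n)).
Notation arcsn n := (arcs (pto n) (pti n) (@pt n)).

Section PointMaps.
Variables (a b : nat) (g : nat -> nat) (j : embedding 'I_a.+3 'I_b.+3).
Hypothesis jp : forall k, (k <= a)%N -> j (pt a k) = pt b (g k).
Hypothesis jo : j (pto a) = pto b.
Hypothesis ji : j (pti a) = pti b.

Lemma quad_map_pt k l : (k <= a)%N -> (l <= a)%N ->
  quad_map j (cubn a k l) = cubn b (g k) (g l).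
Proof. by move=> hk hl; rewrite /cub /= !jp // jo ji. Qed.

Lemma P_map (F : fieldType) (z : conf F 'I_b.+3) k l : (k <= a)%N -> (l <= a)%N ->
  Pn a k l (emb_comp z j) = Pn b (g k) (g l) z.
Proof. by move=> hk hl; rewrite /P cross_ratio_pull quad_map_pt. Qed.

Lemma arcs_map (F : fieldType) (z : conf F 'I_b.+3) E :
  all (fun e => (e.1 <= a) && (e.2 <= a))%N E ->
  arcsn a E (emb_comp z j) = arcsn b [seq (g e.1, g e.2) | e <- E] z.
Proof.
move=> hE; rewrite /arcs big_map big_seq [RHS]big_seq; apply: eq_bigr => e he /=.
by have /andP[h1 h2] := allP hE _ he; rewrite P_map.
Qed.
End PointMaps.

Section Glue.
Variables (w m q : nat).
Hypothesis hm : (0 < m <= w)%N.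
Hypothesis hq : (0 < q)%N.
Let n := (w.-1 + q)%N.

(* The points of T1 = {0, oo, p_0, ..., p_w} after q - 1 points have been
   inserted between p_(m-1) and p_m *)
Definition ins k := if (k < m)%N then k else (k + q).-1.
Let insv v := if (v < m.+2)%N then v else (v + q).-1.

Lemma insv_bound x : (x < w.+3)%N -> (insv x < n.+3)%N.
Proof. by rewrite /insv /n => hx; case: ifP; lia. Qed.

Lemma insv_mono x y : (x < y)%N -> (insv x < insv y)%N.
Proof. by rewrite /insv => hx; do 2!case: ifP; lia. Qed.

Lemma insv_inj x y : (x < w.+3)%N -> (y < w.+3)%N -> insv x = insv y -> x = y.
Proof. by move=> _ _; case: (ltngtP x y) => // /insv_mono; lia. Qed.

Definition glue1 : embedding 'I_w.+3 'I_n.+3 := ord_emb insv_bound insv_inj.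

Lemma glue1E x : glue1 x = insv x :> nat. Proof. exact: ord_embE. Qed.

Lemma glue1_std : cyc_emb glue1 (std w) (std n).
Proof. by apply: (cyc_emb_mono (f := insv)); [exact: ord_embE|exact: insv_mono]. Qed.

Lemma glue1_pt k : (k <= w)%N -> glue1 (pt w k) = pt n (ins k).
Proof.
move=> hk; apply: ord_inj; rewrite glue1E !val_pt //.
  by rewrite /insv /ins; do 2!case: ifP; lia.
by rewrite /ins /n; case: ifP; lia.
Qed.

Lemma glue1_o : glue1 (pto w) = pto n.
Proof. by apply: ord_inj; rewrite glue1E !val_pto. Qed.

Lemma glue1_i : glue1 (pti w) = pti n.
Proof. by apply: ord_inj; rewrite glue1E !val_pti. Qed.

Let shv v := if (v < 2)%N then v else (v + m.-1)%N.

Lemma shv_bound x : (x < q.+3)%N -> (shv x < n.+3)%N.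
Proof. by rewrite /shv /n => hx; case: ifP; lia. Qed.

Lemma shv_mono x y : (x < y)%N -> (shv x < shv y)%N.
Proof. by rewrite /shv => hx; do 2!case: ifP; lia. Qed.

Lemma shv_inj x y : (x < q.+3)%N -> (y < q.+3)%N -> shv x = shv y -> x = y.
Proof. by move=> _ _; case: (ltngtP x y) => // /shv_mono; lia. Qed.

Definition glue2 : embedding 'I_q.+3 'I_n.+3 := ord_emb shv_bound shv_inj.

Lemma glue2E x : glue2 x = shv x :> nat. Proof. exact: ord_embE. Qed.

Lemma glue2_std : cyc_emb glue2 (std q) (std n).
Proof. by apply: (cyc_emb_mono (f := shv)); [exact: ord_embE|exact: shv_mono]. Qed.

Lemma glue2_pt k : (k <= q)%N -> glue2 (pt q k) = pt n (m.-1 + k).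
Proof.
move=> hk; apply: ord_inj; rewrite glue2E !val_pt //; last by rewrite /n; lia.
by rewrite /shv /=; lia.
Qed.

Lemma glue2_o : glue2 (pto q) = pto n.
Proof. by apply: ord_inj; rewrite glue2E !val_pto. Qed.

Lemma glue2_i : glue2 (pti q) = pti n.
Proof. by apply: ord_inj; rewrite glue2E !val_pti. Qed.

(* 0 and oo, and the two ends of the interval, are exchanged. *)
Let rvv v := if (v < 2)%N then (1 - v)%N else (m + q + 3 - v)%N.

Lemma rvv_bound x : (x < q.+3)%N -> (rvv x < n.+3)%N.
Proof. by rewrite /rvv /n => hx; case: ifP; lia. Qed.

Lemma rvv_inj x y : (x < q.+3)%N -> (y < q.+3)%N -> rvv x = rvv y -> x = y.
Proof. by move=> hx hy; rewrite /rvv; do 2!case: ifP; lia. Qed.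

Definition glue2r : embedding 'I_q.+3 'I_n.+3 := ord_emb rvv_bound rvv_inj.

Lemma glue2rE x : glue2r x = rvv x :> nat. Proof. exact: ord_embE. Qed.

Lemma glue2r_std : cyc_emb glue2r (cyc_rev (std q)) (std n).
Proof.
apply/cyc_embP => x y z; rewrite in_cyc_std !glue2rE {1}/in_cyc /= inE /= in_cyc_std.
have := ltn_ord x; have := ltn_ord y; have := ltn_ord z.
by rewrite /rvv /cyc_nat; do 3!case: ifP; lia.
Qed.

Lemma glue2r_pt k : (k <= q)%N -> glue2r (pt q k) = pt n (m.-1 + q - k).
Proof.
move=> hk; apply: ord_inj; rewrite glue2rE !val_pt //; last by rewrite /n; lia.
by rewrite /rvv /=; lia.
Qed.

Lemma glue2r_o : glue2r (pto q) = pti n.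
Proof. by apply: ord_inj; rewrite glue2rE val_pto val_pti. Qed.

Lemma glue2r_i : glue2r (pti q) = pto n.
Proof. by apply: ord_inj; rewrite glue2rE val_pto val_pti. Qed.

End Glue.

Section GlueForms.
Variables (w m q : nat).
Hypothesis hm : (0 < m <= w)%N.
Hypothesis hq : (0 < q)%N.
Notation n := (w.-1 + q)%N.
Notation j1 := (glue1 hm hq).
Notation j2 := (glue2 hm hq).
Notation j2r := (glue2r hm hq).
Notation ins := (ins m q).
Notation but := (cubical_but (pto w) (pti w) (@pt w) w m).

Let seg1 := [seq cubn n k.-1 k | k <- index_iota 1 m ++ index_iota (m + q) n.+1].

Lemma glue1_but : [seq quad_map j1 x | x <- but] = seg1.
Proof.
rewrite /seg1 /cubical_but -map_comp !map_cat; congr (_ ++ _).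
  apply/eq_in_map => k; rewrite mem_index_iota => hk.
  etransitivity; first by apply: (quad_map_pt (glue1_pt hm hq) (glue1_o hm hq) (glue1_i hm hq)); lia.
  by rewrite /ins; do 2!case: ifP; try lia; move=> _ _.
have -> : index_iota (m + q) n.+1 = [seq (q.-1 + k)%N | k <- index_iota m.+1 w.+1].
  by rewrite /index_iota -iotaDl; congr iota; lia.
rewrite -map_comp; apply/eq_in_map => k; rewrite mem_index_iota => hk.
etransitivity; first by apply: (quad_map_pt (glue1_pt hm hq) (glue1_o hm hq) (glue1_i hm hq)); lia.
by rewrite /ins; do 2!case: ifP; try lia; move=> _ _; congr cub; congr pt; lia.
Qed.

Lemma seg_perm s : perm_eq s (index_iota m (m + q)) ->
  perm_eq (seg1 ++ [seq cubn n k.-1 k | k <- s]) (cubical (pto n) (pti n) (@pt n) n).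
Proof.
move=> hs; rewrite -map_cat perm_map //.
have -> : index_iota 1 n.+1 = index_iota 1 m ++ index_iota m (m + q) ++ index_iota (m + q) n.+1.
  rewrite /index_iota catA (_ : (n.+1 - 1 = (m - 1) + (m + q - m) + (n.+1 - (m + q)))%N); last by lia.
  by rewrite !iotaD; congr ((_ ++ iota _ _) ++ iota _ _); lia.
by rewrite -catA perm_cat2l perm_catC perm_cat2r.
Qed.

Lemma glue2_seg F : pull j2 (dlogs F q) =
  dlogw F [seq cubn n k.-1 k | k <- index_iota m (m + q)].
Proof.
rewrite pull_wedges /cubical -!map_comp; congr wedges.
have -> : index_iota m (m + q) = [seq (m.-1 + k)%N | k <- index_iota 1 q.+1].
  by rewrite /index_iota -iotaDl; congr iota; lia.
rewrite -map_comp; apply/eq_in_map => k; rewrite mem_index_iota => hk.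
etransitivity; first exact: pull_dlog.
rewrite (quad_map_pt (glue2_pt hm hq) (glue2_o hm hq) (glue2_i hm hq)); [|lia|lia].
by congr (dlog _ (cub _ _ _ _)); congr pt; lia.
Qed.

Let revs := [seq (m + q - k)%N | k <- index_iota 1 q.+1].

(** Ratios are inverted twice, by the exchange of 0 and oo and by the reversal of the points, so
    each variable of the second factor becomes a variable of the block, in the opposite order. *)
Lemma glue2r_seg F : pull j2r (dlogs F q) =
  dlogw F [seq cubn n k.-1 k | k <- revs].
Proof.
rewrite pull_wedges /cubical -!map_comp; congr wedges.
apply/eq_in_map => k; rewrite mem_index_iota => hk.
etransitivity; first exact: pull_dlog.
rewrite /quad_map /cub !glue2r_o !glue2r_i !glue2r_pt; [|lia|lia].
rewrite -!/(cub _ _ _ _) dlog_swap.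
by congr (dlog _ (cub _ _ _ _)); congr pt; lia.
Qed.

Notation butform F := (dlogw F but).

Lemma pull_dlogs (F : fieldType) (T S : Type) (j : embedding T S) s :
  pull j (dlogw F s) = dlogw F [seq quad_map j x | x <- s].
Proof. by rewrite pull_wedges -map_comp; congr wedges; apply: eq_map => x; apply: pull_dlog. Qed.

(** The boolean precedes the field in the statement: it is used over R for the orientation and over
    R[i] for the integrand, where the two signs cancel. *)
Lemma glue_sign : exists b : bool, forall F : fieldType,
  wedge (pull j1 (butform F)) (pull j2 (dlogs F q)) = form_sign b (dlogs F n).
Proof.
have [b hb] := wedges_perm (seg_perm (perm_refl _)); exists b => F.
rewrite glue2_seg pull_dlogs glue1_but -wedges_cat -map_cat.
by apply: hb => x; apply: homog_dlog.
Qed.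

Lemma glue_sign_rev : exists b : bool, forall F : fieldType,
  wedge (pull j1 (butform F)) (pull j2r (dlogs F q)) = form_sign b (dlogs F n).
Proof.
have hr : perm_eq revs (index_iota m (m + q)).
  apply: uniq_perm; last 1 first.
  - move=> x; rewrite mem_index_iota; apply/mapP/idP => [[k]|hx].
      by rewrite mem_index_iota => hk ->; lia.
    by exists (m + q - x)%N; rewrite ?mem_index_iota; lia.
  - rewrite map_inj_in_uniq ?iota_uniq // => x y.
    by rewrite !mem_index_iota => hx hy; lia.
  - exact: iota_uniq.
have [b hb] := wedges_perm (seg_perm hr); exists b => F.
rewrite glue2r_seg pull_dlogs glue1_but -wedges_cat -map_cat.
by apply: hb => x; apply: homog_dlog.
Qed.

Lemma ins_ends : ins m.-1 = m.-1 /\ ins m = (m.-1 + q)%N.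
Proof. by rewrite /ins; do 2!case: ifP; lia. Qed.

Lemma glue1_T (F : fieldType) : pull j1 (dcr (cubn w m.-1 m)) =
  @dcr F _ (cubn n m.-1 (m.-1 + q)).
Proof.
have [e1 e2] := ins_ends; rewrite pull_dcr.
by rewrite (quad_map_pt (glue1_pt hm hq) (glue1_o hm hq) (glue1_i hm hq)) ?e1 ?e2 //; lia.
Qed.

Lemma glue2_T (F : fieldType) : pull j2 (dcr (cubn q 0 q)) = @dcr F _ (cubn n m.-1 (m.-1 + q)).
Proof.
rewrite pull_dcr (quad_map_pt (glue2_pt hm hq) (glue2_o hm hq) (glue2_i hm hq)) //.
by rewrite addn0.
Qed.

Lemma glue2r_T (F : fieldType) : pull j2r (dcr (cubn q 0 q)) = @dcr F _ (cubn n m.-1 (m.-1 + q)).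
Proof.
rewrite pull_dcr /quad_map /cub glue2r_o glue2r_i !glue2r_pt //.
by rewrite -!/(cub _ _ _ _) dcr_swap subn0 addnK.
Qed.

Lemma glue1_P (F : fieldType) (z : conf F _) k l : (k <= w)%N -> (l <= w)%N ->
  Pn w k l (emb_comp z j1) = Pn n (ins k) (ins l) z.
Proof. exact: (P_map (glue1_pt hm hq) (glue1_o hm hq) (glue1_i hm hq)). Qed.

Lemma glue2_P (F : fieldType) (z : conf F _) k l : (k <= q)%N -> (l <= q)%N ->
  Pn q k l (emb_comp z j2) = Pn n (m.-1 + k) (m.-1 + l) z.
Proof. exact: (P_map (glue2_pt hm hq) (glue2_o hm hq) (glue2_i hm hq)). Qed.

Lemma glue2r_P (F : fieldType) (z : conf F _) k l : (k <= q)%N -> (l <= q)%N ->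
  Pn q k l (emb_comp z j2r) = Pn n (m.-1 + q - l) (m.-1 + q - k) z.
Proof.
move=> hk hl; rewrite /P cross_ratio_pull /quad_map /cub glue2r_o glue2r_i !glue2r_pt //.
exact: cub_swap.
Qed.

Section Lam.
(** Here [lam] stands for either gluing of the second factor, the direct or the reversed one; the
    hypotheses are what both have in common. *)
Variables (lam : embedding 'I_q.+3 'I_n.+3) (b : bool).
Hypothesis lamT : forall F : fieldType,
  pull lam (dcr (cubn q 0 q)) = @dcr F _ (cubn n m.-1 (m.-1 + q)).
Hypothesis lamP : forall (F : fieldType) (z : conf F _),
  Pn q 0 q (emb_comp z lam) = Pn n m.-1 (m.-1 + q) z.
Hypothesis lamS : forall F : fieldType,
  wedge (pull j1 (butform F)) (pull lam (dlogs F q)) = form_sign b (dlogs F n).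

(* Near T = 0 the differential dT is taken from the second factor, near T = 1 from the first:
   1 = (2 - T) T + (1 - T)^2. *)
Lemma glue_integrand (F : fieldType) (f1 : conf F 'I_w.+3 -> F) (f2 : conf F 'I_q.+3 -> F) psi :
  wedge (dcr (cubn q 0 q)) psi =
    form_scale (fun z => Pn q 0 q z * (Pn q 0 q z * f2 z)) (dlogs F q) ->
  form_add
    (wedge (pull j1 (form_scale (fun z => (2 - Pn w m.-1 m z) * (f1 z / Pn w m.-1 m z))
              (wedge (butform F) (dcr (cubn w m.-1 m)))))
       (pull lam psi))
    (wedge (pull j1 (form_scale (fun z => (1 - Pn w m.-1 m z) ^+ 2 * (f1 z / Pn w m.-1 m z))
              (butform F)))
       (pull lam (form_scale (fun z => Pn q 0 q z * f2 z) (dlogs F q)))) =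
  form_sign b
   (form_scale (fun z => f1 (emb_comp z j1) * f2 (emb_comp z lam)) (dlogs F n)).
Proof.
move=> hpsi; rewrite !pull_scale !wedgeZl wedgeZr pull_wedge glue1_T -lamT wedgeA.
rewrite -pull_wedge hpsi pull_scale wedgeZr lamS.
have [e1 e2] := ins_ends.
apply/form_ext => z vs; rewrite /form_add /form_scale.
rewrite !lamP !glue1_P; try lia.
rewrite e1 e2.
have h : Pn n m.-1 (m.-1 + q) z != 0 by apply: (P_neq0 (chain_std n)); lia.
by field.
Qed.

(* The orientation given by a volume form of T1 and one of T2 with a factor dT removed *)
Lemma glue_orientation (R : realType) (s1 e : bool) (eta2 : form R 'I_q.+3) :
  (forall (z : conf R 'I_n.+3) k, in_cell (std n) z -> (k <= q)%N ->
     0 < Pn q 0 k (emb_comp z lam)) ->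
  wedge (dcr (cubn q 0 q)) eta2 =
    form_sign e (simplicial_vol R (enum 'I_q.+3)) ->
  exists2 vol : form R 'I_n.+3, orient (std n) vol = @o_st R n &
  wedge (dcr (cubn n m.-1 (m.-1 + q)))
    (wedge (pull j1 (form_scale (fun z => (-1) ^+ s1 *
               (\prod_(1 <= k < w.+1) Pn w 0 k z / Pn w m.-1 m z)) (butform R)))
           (pull lam eta2)) =
  form_sign (w.-1 + s1 + e + b) vol.
Proof.
move=> hpos heta.
(* The quotient of the product of the two volume coefficients, divided by T, and the volume
   coefficient of the glued cell; being positive on the cell, it does not affect the orientation. *)
pose g (z : conf R 'I_n.+3) := (\prod_(1 <= k < w.+1) Pn w 0 k (emb_comp z j1)) /
  Pn n m.-1 (m.-1 + q) z * \prod_(1 <= k < q.+1) Pn q 0 k (emb_comp z lam) /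
  \prod_(1 <= k < n.+1) Pn n 0 k z.
have g0 z : in_cell (std n) z -> 0 < g z.
  move=> hz; rewrite /g; apply: divr_gt0; last first.
    by rewrite big_nat prodr_gt0 // => k hk; apply: P_pos => //; lia.
  apply: mulr_gt0; last by rewrite big_nat prodr_gt0 // => k hk; apply: hpos => //; lia.
  apply: divr_gt0; last by apply: P_pos => //; lia.
  rewrite big_nat prodr_gt0 // => k hk; rewrite glue1_P //; last by lia.
  by apply: P_pos => //; rewrite /ins; do 2!case: ifP; lia.
exists (form_scale g (simplicial_vol R (enum 'I_n.+3))); first exact: orient_pos.
rewrite pull_scale !wedgeZl wedgeZr -wedgeA pull_dlogs.
(* The form dT passes the w - 1 other differentials of the first factor to join [eta2]; this is the
   sign (-1)^(w-1). *)
rewrite (wedge_move _ (@homog_dcr R _ _) (@homog_dlog R _)) !wedgeZl wedgeA -pull_dlogs.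
rewrite -lamT -pull_wedge heta simplicial_vol_std !pull_scale !wedgeZr lamS.
rewrite size_map size_cubical_but // simplicial_vol_std.
apply/form_ext => z vs; rewrite /form_scale /g !exprD.
have [e1 e2] := ins_ends.
rewrite !glue1_P; try lia.
rewrite e1 e2.
have h1 : Pn n m.-1 (m.-1 + q) z != 0 by apply: (P_neq0 (chain_std n)); lia.
have h2 : \prod_(1 <= k < n.+1) Pn n 0 k z != 0.
  rewrite prodf_seq_neq0; apply/allP => k; rewrite mem_index_iota => hk; apply/implyP => _.
  by apply: (P_neq0 (chain_std n)); lia.
by field; rewrite h1 h2.
Qed.

End Lam.
End GlueForms.

(** The involution (0 1)(2 3), one of the two elements of the Klein group that reverse the cyclic
    order. On the four chosen points of T2 it exchanges 0 with oo and the first with the last point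
    of the block. *)
Definition klein_fun (x : 'I_4) : 'I_4 := inord (nth 0 [:: 1; 0; 3; 2] x)%N.

Lemma klein_funK : involutive klein_fun.
Proof. by case=> [[|[|[|[|//]]]]] h; apply: ord_inj; rewrite /klein_fun /= !inordK. Qed.

Definition klein_rev : {perm 'I_4} := perm (can_inj klein_funK).

Lemma klein_rev_nontrivial : klein_nontrivial klein_rev.
Proof.
apply/forallP => x; rewrite !permE klein_funK eqxx /=.
by case: x => [[|[|[|[|//]]]]] h; rewrite -val_eqE /klein_fun /= !inordK.
Qed.

Lemma klein_rev_emb : cyc_emb klein_rev (cyc_std 4) (cyc_std 4) = false.
Proof.
apply/negP => /cyc_embP/(_ (inord 0) (inord 1) (inord 2)).
by rewrite !in_cyc_std !permE /klein_fun /cyc_nat !inordK.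
Qed.

Section Reversal.
Variables (w m q : nat).
Hypothesis hm : (0 < m <= w)%N.
Hypothesis hq : (0 < q)%N.
Notation n := (w.-1 + q)%N.
Notation j1 := (glue1 hm hq).
Notation j2 := (glue2 hm hq).
Notation j2r := (glue2r hm hq).
Notation ins := (ins m q).

(** The four points are 0, oo, p_(m-1), p_m in T1 and 0, oo, p_0, p_q in T2. Their cross-ratio is
    x_m on T1 and the product of all variables on T2. *)
Let f1 v := (if v < 2 then v else v + m.-1)%N.
Let f2 v := (if v < 3 then v else v + q.-1)%N.

Lemma four1_bound x : (x < 4)%N -> (f1 x < w.+3)%N.
Proof. by rewrite /f1; case: ifP; lia. Qed.
Lemma four1_inj x y : (x < 4)%N -> (y < 4)%N -> f1 x = f1 y -> x = y.
Proof. by rewrite /f1; do 2!case: ifP; lia. Qed.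
Lemma four2_bound x : (x < 4)%N -> (f2 x < q.+3)%N.
Proof. by rewrite /f2; case: ifP; lia. Qed.
Lemma four2_inj x y : (x < 4)%N -> (y < 4)%N -> f2 x = f2 y -> x = y.
Proof. by rewrite /f2; do 2!case: ifP; lia. Qed.

Definition four1 : embedding 'I_4 'I_w.+3 := ord_emb four1_bound four1_inj.
Definition four2 : embedding 'I_4 'I_q.+3 := ord_emb four2_bound four2_inj.

Lemma four1E x : four1 x = f1 x :> nat. Proof. exact: ord_embE. Qed.
Lemma four2E x : four2 x = f2 x :> nat. Proof. exact: ord_embE. Qed.

Lemma four1_std : cyc_emb four1 (cyc_std 4) (std w).
Proof.
by apply: (cyc_emb_mono four1E) => x y; rewrite /f1; do 2!case: ifP; lia.
Qed.

Lemma four2_std : cyc_emb four2 (cyc_std 4) (std q).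
Proof.
by apply: (cyc_emb_mono four2E) => x y; rewrite /f2; do 2!case: ifP; lia.
Qed.

Lemma four1_t4 : quad_map four1 t4 = cubn w m.-1 m.
Proof.
rewrite /t4 /cub /=; congr (_, _, _, _); apply: ord_inj.
all: rewrite -/(four1 _) four1E ?val_pto ?val_pti ?val_pt ?inordK //= /f1 /=; lia.
Qed.

Lemma four2_t4 : quad_map four2 t4 = cubn q 0 q.
Proof.
rewrite /t4 /cub /=; congr (_, _, _, _); apply: ord_inj.
all: rewrite -/(four2 _) four2E ?val_pto ?val_pti ?val_pt ?inordK //= /f2 /=; lia.
Qed.

Lemma four2_rev_t4 :
  quad_map (emb_comp four2 (emb_perm klein_rev)) t4 = cub (pti q) (pto q) (@pt q q) (@pt q 0).
Proof.
rewrite /t4 /cub /=; congr (_, _, _, _); apply: ord_inj.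
all: rewrite -/(four2 _) four2E permE /klein_fun ?val_pto ?val_pti ?val_pt // ?inordK ?inordK //= /f2 /=; lia.
Qed.

Lemma glue_cover (j : embedding 'I_q.+3 'I_n.+3) :
  (forall k, (k <= q)%N -> exists y, j y = pt n (m.-1 + k)) ->
  forall x, (exists y, j1 y = x) \/ (exists y, j y = x).
Proof.
move=> hj x; have hx := ltn_ord x.
have [h1|h1] := ltnP x m.+2.
  left; exists (inord x); apply: ord_inj; rewrite glue1E inordK; last by lia.
  by rewrite h1.
have [h2|h2] := ltnP (m + q)%N x.
  left; exists (inord (x - q.-1)); apply: ord_inj; rewrite glue1E inordK; last by lia.
  by case: ifP; lia.
right; have [y ey] : exists y, j y = pt n (m.-1 + (x - m.-1.+2)) by apply: hj; lia.
exists y; rewrite ey; apply: ord_inj; rewrite val_pt; lia.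
Qed.

Lemma glue_pushout : is_pushout four1 four2 j1 j2.
Proof.
apply: pushoutP; [exact: emb_inj|exact: emb_inj|..].
- case=> [[|[|[|[|//]]]]] h; apply: ord_inj; rewrite glue1E glue2E four1E four2E /f1 /f2 /=;
    do ?case: ifP; lia.
- by apply: glue_cover => k hk; exists (pt q k); rewrite glue2_pt.
- move=> y1 y2 /(congr1 (@nat_of_ord _)); rewrite glue1E glue2E => e.
  have h1 := ltn_ord y1; have h2 := ltn_ord y2.
  exists (inord (if (y2 < 3)%N then (y2 : nat) else 3)); split; apply: ord_inj.
    by rewrite four1E inordK; [move: e; rewrite /f1|]; do ?case: ifP; lia.
  by rewrite four2E inordK; [move: e; rewrite /f2|]; do ?case: ifP; lia.
Qed.

Lemma glue_pushout_rev : is_pushout four1 (emb_comp four2 (emb_perm klein_rev)) j1 j2r.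
Proof.
apply: pushoutP; [exact: emb_inj|exact: emb_inj|..].
- case=> [[|[|[|[|//]]]]] h; apply: ord_inj;
  rewrite glue1E glue2rE four1E -[emb_comp _ _ _]/(four2 (klein_rev _)) four2E permE /klein_fun /f1 /f2 /= inordK //=;
    do ?case: ifP; lia.
- apply: glue_cover => k hk; exists (pt q (q - k)); rewrite glue2r_pt ?leq_subr //.
  by congr pt; lia.
- move=> y1 y2 /(congr1 (@nat_of_ord _)); rewrite glue1E glue2rE => e.
  have h1 := ltn_ord y1; have h2 := ltn_ord y2.
  exists (inord (nth 2 [:: 1; 0; 3] y2)%N); split; apply: ord_inj.
    move: e h1 h2; rewrite four1E /f1.
    by case: (nat_of_ord y2) => [|[|[|k]]] /=; rewrite ?nth_nil ?inordK //;
      case: (ltnP y1 m.+2) => hy e h1 h2; rewrite ?ltnS ?ltn0 ?leqnn /=; lia.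
  rewrite -[emb_comp _ _ _]/(four2 (klein_rev _)) four2E permE /klein_fun /f2.
  move: e h1 h2.
  case: (nat_of_ord y2) => [|[|[|k]]] /=; rewrite ?nth_nil !inordK //= ?inordK //.
  all: by case: (ltnP y1 m.+2) => hy e h1 h2; rewrite ?ltnS ?ltn0 ?leqnn /=; lia.
Qed.

(** The points of T2 other than the four common ones all lie between p_0 and p_q, where T1 has no
    points, so the two orders interleave in one way only. *)
Lemma glue_uniq (C : cycord 'I_n.+3) :
  cyc_emb j1 (std w) C && cyc_emb j2 (std q) C = (C == cyc_std n.+3).
Proof.
apply/andP/eqP => [[/cyc_embP h1 /cyc_embP h2]|->]; last by split; [exact: glue1_std|exact: glue2_std].
apply: cyc_std_uniq => j j0 jn.
have [a1|a1] := ltnP j m.+1.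
  by apply: (@in_cyc_inord _ C (j1 (inord 0)) (j1 (inord j)) (j1 (inord j.+1)));
    rewrite -?h1 ?in_cyc_std ?glue1E /cyc_nat ?inordK //; do ?case: ifP; lia.
have [a2|a2] := ltnP (m + q)%N j.
  by apply: (@in_cyc_inord _ C (j1 (inord 0)) (j1 (inord (j - q.-1))) (j1 (inord (j - q.-1).+1)));
    rewrite -?h1 ?in_cyc_std ?glue1E /cyc_nat ?inordK //; do ?case: ifP; lia.
by apply: (@in_cyc_inord _ C (j2 (inord 0)) (j2 (inord (j - m.-1))) (j2 (inord (j - m.-1).+1)));
  rewrite -?h2 ?in_cyc_std ?glue2E /cyc_nat ?inordK //; do ?case: ifP; lia.
Qed.

Lemma glue_uniq_rev (C : cycord 'I_n.+3) :
  cyc_emb j1 (std w) C && cyc_emb j2r (cyc_rev (std q)) C = (C == cyc_std n.+3).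
Proof.
apply/andP/eqP => [[/cyc_embP h1 /cyc_emb_rev h2]|->]; last by split; [exact: glue1_std|exact: glue2r_std].
apply: cyc_std_uniq => j j0 jn.
have [a1|a1] := ltnP j m.+1.
  by apply: (@in_cyc_inord _ C (j1 (inord 0)) (j1 (inord j)) (j1 (inord j.+1)));
    rewrite -?h1 ?in_cyc_std ?glue1E /cyc_nat ?inordK //; do ?case: ifP; lia.
have [a2|a2] := ltnP (m + q)%N j.
  by apply: (@in_cyc_inord _ C (j1 (inord 0)) (j1 (inord (j - q.-1))) (j1 (inord (j - q.-1).+1)));
    rewrite -?h1 ?in_cyc_std ?glue1E /cyc_nat ?inordK //; do ?case: ifP; lia.
by apply: (@in_cyc_inord _ C (j2r (inord 1)) (j2r (inord (m + q + 3 - j))) (j2r (inord (m + q + 2 - j))));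
  rewrite -?h2 ?in_cyc_std ?glue2rE /cyc_nat ?inordK //; do ?case: ifP; lia.
Qed.

End Reversal.

Notation fitsn F n := (@fits F _ (std n) (pto n) (pti n) (@pt n) n).
Notation Omegan F n E := (@Omega F _ (pto n) (pti n) (@pt n) n E).

Lemma nu1_form (R : realType) : nonvanishing_1form (@dcr R _ t4).
Proof.
exists (fun=> 1); split; last by rewrite form_scale1.
  by move=> x _; apply: cst_continuous.
by move=> x _; apply: oner_neq0.
Qed.

Section Factor.
Variables (R : realType).

Lemma first_factor w m : (0 < m <= w)%N -> exists s1 : bool,
  wedge (dcr (cubn w m.-1 m))
    (form_scale (fun z => (-1) ^+ s1 * (\prod_(1 <= k < w.+1) Pn w 0 k z / Pn w m.-1 m z))
       (dlogw R (cubical_but (pto w) (pti w) (@pt w) w m))) =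
  simplicial_vol R (enum 'I_w.+3).
Proof.
move=> hm; have ch := chain_std w.
have hp : perm_eq (cubn w m.-1 m :: cubical_but (pto w) (pti w) (@pt w) w m)
    (cubical (pto w) (pti w) (@pt w) w).
  by rewrite -perm_rcons; apply: cubical_but_perm.
have [b hb] := wedges_perm hp; exists b.
have [_ h1 h2] : off (pto w) (pti w) (pt w m.-1).
  by apply: (chain_neq ch); lia.
have [_ h3 h4] : off (pto w) (pti w) (pt w m).
  by apply: (chain_neq ch); lia.
rewrite (dcr_dlog _ h1 h2 h3 h4) wedgeZl [wedge (dlog R _) _]wedgeZr.
have hb' := hb R _ (dlog R) (@homog_dlog R _); rewrite [wedges (map _ (_ :: _))]/(wedge _ (wedges _)) in hb'.
rewrite [wedge (dlog R (cubn w m.-1 m)) _]hb'.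
rewrite simplicial_vol_std; apply/form_ext => z vs; rewrite /form_scale.
have h : Pn w m.-1 m z != 0 by apply: (P_neq0 ch); lia.
have s1 : (-1) ^+ b * (-1) ^+ b = 1 :> R by rewrite -expr2 sqrr_sign.
rewrite -/(Pn w m.-1 m z).
transitivity (((-1) ^+ b * (-1) ^+ b) * (\prod_(1 <= k < w.+1) Pn w 0 k z * dlogs R w z vs)).
  by field.
by rewrite s1 mul1r.
Qed.

(** The logarithmic differential of T is the sum of all q steps; wedged with the first q - 1 of them
    it contributes only the last ([dlog_first]). *)
Lemma second_factor q : (0 < q)%N -> exists h : conf R 'I_q.+3 -> R, exists qs,
  [/\ size qs = q.-1, all (@distinct _) qs &
  wedge (dcr (cubn q 0 q)) (form_scale h (dlogw R qs)) =
  simplicial_vol R (enum 'I_q.+3)].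
Proof.
case: q => // k _; have ch := chain_std k.+1.
exists (fun z => (-1) ^+ k * (\prod_(1 <= j < k.+2) Pn k.+1 0 j z / Pn k.+1 0 k.+1 z)).
exists [seq cubn k.+1 j.-1 j | j <- index_iota 1 k.+1]; split.
- by rewrite size_map size_iota subn1.
- apply/allP => x /mapP[j]; rewrite mem_index_iota => hj ->.
  by apply: (@crossing_distinct _ (cyc_std k.+4)); apply: (crossing_cub ch); lia.
have [_ h1 h2] : off (pto k.+1) (pti k.+1) (pt k.+1 0).
  by apply: (chain_neq ch); lia.
have [_ h3 h4] : off (pto k.+1) (pti k.+1) (pt k.+1 k.+1).
  by apply: (chain_neq ch); lia.
rewrite (dcr_dlog _ h1 h2 h3 h4) wedgeZl [wedge (dlog R _) _]wedgeZr.
have e : wedge (dlog R (cubn k.+1 0 k.+1))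
    (dlogw R [seq cubn k.+1 j.-1 j | j <- index_iota 1 k.+1]) =
    form_sign k (dlogs R k.+1).
  have := dlog_first R ch (leq0n k); rewrite subn0 /cubical => h.
  by rewrite -[in RHS]map_comp; exact: h.
rewrite e simplicial_vol_std; apply/form_ext => z vs; rewrite /form_scale.
have h : Pn k.+1 0 k.+1 z != 0 by apply: (P_neq0 ch); lia.
have s1 : (-1) ^+ k * (-1) ^+ k = 1 :> R by rewrite -expr2 sqrr_sign.
rewrite -/(Pn k.+1 0 k.+1 z).
set W := wedges _ z vs; set Q := \prod_(_ <= _ < _) _.
transitivity (((-1) ^+ k * (-1) ^+ k) * (Q * W)); first by field.
by rewrite s1 mul1r.
Qed.
End Factor.

Section ReversalThm.
Variables (R : realType) (A : comAlgType rat) (I : integral_data R A).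
Hypothesis hI : formal_cell_zeta I.
Hypothesis hst : generalized_stuffle I.

Definition J n E := I (std n) (@o_st R n) (Omegan R[i] n E).

Variables (w m q : nat).
Hypothesis hm : (0 < m <= w)%N.
Hypothesis hq : (0 < q)%N.
Notation n := (w.-1 + q)%N.
Notation j1 := (glue1 hm hq).
Notation j2 := (glue2 hm hq).
Notation j2r := (glue2r hm hq).
Notation but F := (dlogw F (cubical_but (pto w) (pti w) (@pt w) w m)).

Lemma stuffle_std (lam : embedding 'I_q.+3 'I_n.+3) c2 (theta : form R 'I_4)
    (eta1 : form R 'I_w.+3) (eta2 : form R 'I_q.+3) (phi : form R[i] 'I_w.+3)
    (psi : form R[i] 'I_q.+3) :
  (forall C, cyc_emb j1 (std w) C && cyc_emb lam c2 C = (C == cyc_std n.+3)) ->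
  stuffle_sum I (std w) c2 (four1 hm hq) j1 lam theta eta1 eta2 phi psi =
  I (std n) (orient (std n) (wedge (pull (emb_comp j1 (four1 hm hq)) theta)
     (wedge (pull j1 eta1) (pull lam eta2)))) (wedge (pull j1 phi) (pull lam psi)).
Proof. by move=> h; rewrite /stuffle_sum (eq_bigl _ _ h) big_pred1_eq. Qed.

Lemma stuffle_sign_std : stuffle_sign A klein_rev 'I_q.+3 = (-1) ^+ 'C(q.+1, 2).
Proof.
rewrite /stuffle_sign klein_rev_emb card_ord; congr (_ ^+ _).
by rewrite bin2 /= divn2 mulnC; congr (_./2); congr (_ * _)%N; lia.
Qed.

Variables (E1 E2 : seq (nat * nat)).
Hypothesis hE1 : all (fun e => (e.1 <= w) && (e.2 <= w))%N E1.
Hypothesis hE2 : all (fun e => (e.1 <= q) && (e.2 <= q))%N E2.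
Hypothesis fE1 : fitsn R[i] w (arcsn w E1).
Hypothesis fE2 : fitsn R[i] q (fun z => Pn q 0 q z * arcsn q E2 z).

Definition glued := [seq (ins m q e.1, ins m q e.2) | e <- E1] ++
  [seq (m.-1 + e.1, m.-1 + e.2)%N | e <- E2].
Definition glued_rev := [seq (ins m q e.1, ins m q e.2) | e <- E1] ++
  [seq (m.-1 + q - e.2, m.-1 + q - e.1)%N | e <- E2].

Lemma arcs_glued (z : conf R[i] 'I_n.+3) :
  arcsn w E1 (emb_comp z j1) * arcsn q E2 (emb_comp z j2) = arcsn n glued z.
Proof.
rewrite arcs_cat (arcs_map (glue1_pt hm hq) (glue1_o hm hq) (glue1_i hm hq)) //.
by rewrite (arcs_map (glue2_pt hm hq) (glue2_o hm hq) (glue2_i hm hq)).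
Qed.

Lemma arcs_glued_rev (z : conf R[i] 'I_n.+3) :
  arcsn w E1 (emb_comp z j1) * arcsn q E2 (emb_comp z j2r) = arcsn n glued_rev z.
Proof.
rewrite arcs_cat (arcs_map (glue1_pt hm hq) (glue1_o hm hq) (glue1_i hm hq)) //.
congr (_ * _); rewrite /arcs big_map big_seq [RHS]big_seq; apply: eq_bigr => e he /=.
by have /andP[h1 h2] := allP hE2 _ he; rewrite glue2r_P.
Qed.

(** The stuffle relation is used twice, with degrees (w, q - 1) and (w - 1, q) on the two factors;
    by [glue_integrand] the two integrands add up, on either side, to the arc form up to a sign. On
    the second factor only T times the arcs has to fit, since the first one is divided by T. The
    gluing signs cancel between integrand and orientation, and the stuffle sign cancels against that
    of [eta2']. *)
Theorem reversal :
  [/\ top_form (std n) (Omegan R[i] n glued),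
      top_form (std n) (Omegan R[i] n glued_rev) & J n glued = J n glued_rev].
Proof.
have [psia npsia epsia] := nice_interior (chain_std q) hq fE2.
have npsib := nice_fits (chain_std q) fE2.
have nphia := nice_but_top (chain_std w) fE1 hm.
have nphib := nice_but (chain_std w) fE1 hm.
set psib := form_scale _ _ in npsib; set phia := form_scale _ _ in nphia.
set phib := form_scale _ _ in nphib.
have [b hb] := glue_sign hm hq; have [br hbr] := glue_sign_rev hm hq.
have [s1 e1] := first_factor R hm.
have [h2 [qs [sqs dqs e2]]] := second_factor R hq.
set eta1 := form_scale _ _ in e1; set eta2 := form_scale _ _ in e2.
(* The sign of the reversed listing in [rev_listing_std]: the form [eta2'] must orient the reversed
   factor as the stuffle relation prescribes. *)
pose eps := odd 'C(q.+1, 2).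
pose eta2' := form_sign eps eta2.
have lamP2 (F : fieldType) (z : conf F _) : Pn q 0 q (emb_comp z j2) = Pn n m.-1 (m.-1 + q) z.
  by rewrite glue2_P // addn0.
have lamP2r (F : fieldType) (z : conf F _) : Pn q 0 q (emb_comp z j2r) = Pn n m.-1 (m.-1 + q) z.
  by rewrite glue2r_P // subn0 addnK.
have int2 := glue_integrand (glue2_T hm hq) lamP2 hb (arcsn w E1) epsia.
have int2r := glue_integrand (glue2r_T hm hq) lamP2r hbr (arcsn w E1) epsia.
have [vol2 ovol2 or2] : exists2 vol : form R 'I_n.+3, orient (std n) vol = @o_st R n &
    wedge (dcr (cubn n m.-1 (m.-1 + q))) (wedge (pull j1 eta1) (pull j2 eta2)) =
    form_sign (w.-1 + s1 + false + b) vol.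
  apply: (glue_orientation (glue2_T hm hq) hb); last by rewrite e2 form_scale1.
  by move=> z k hz hk; rewrite glue2_P //; apply: P_pos => //; nlia.
have [vol2r ovol2r or2r] : exists2 vol : form R 'I_n.+3, orient (std n) vol = @o_st R n &
    wedge (dcr (cubn n m.-1 (m.-1 + q))) (wedge (pull j1 eta1) (pull j2r eta2')) =
    form_sign (w.-1 + s1 + eps + br) vol.
  apply: (glue_orientation (glue2r_T hm hq) hbr); last by rewrite wedgeZr e2.
  by move=> z k hz hk; rewrite glue2r_P //; apply: P_pos => //; nlia.
have dbut : all (@distinct _) (cubical_but (pto w) (pti w) (@pt w) w m).
  have := cubical_distinct (chain_std w).
  by rewrite -(perm_all _ (cubical_but_perm _ _ _ hm)) all_rcons => /andP[].
have key p' q' phi psi : regular_form (std w) p' phi ->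
    regular_form (std q) q' psi -> (p' + q' = n)%N ->
  I (std n) (orient (std n)
     (form_sign (w.-1 + s1 + false + b) vol2))
     (wedge (pull j1 phi) (pull j2 psi)) =
  (-1) ^+ 'C(q.+1, 2) * I (std n) (orient (std n)
     (form_sign (w.-1 + s1 + eps + br) vol2r))
     (wedge (pull j1 phi) (pull j2r psi)).
  move=> hphi hpsi hpq.
  have d1 : diff_form (#|'I_w.+3| - 4) eta1.
    rewrite card_ord (_ : (w.+3 - 4)%N = w.-1); last by nlia.
    by rewrite -(size_cubical_but (pto w) (pti w) (@pt w) hm); apply: diff_form_dlogs.
  have d2 : diff_form (#|'I_q.+3| - 4) eta2.
    rewrite card_ord (_ : (q.+3 - 4)%N = q.-1); last by nlia.
    by rewrite -sqs; apply: diff_form_dlogs.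
  have d2' : diff_form (#|'I_q.+3| - 4) eta2'.
    rewrite card_ord (_ : (q.+3 - 4)%N = q.-1); last by nlia.
    by rewrite -sqs /eta2' form_scaleA; apply: diff_form_dlogs.
  have o1 : is_orientation (std w)
      (orient (std w) (wedge (pull (four1 hm hq) (dcr t4)) eta1)).
    by rewrite pull_dcr four1_t4 e1; exact: o_st_orientation.
  have o2 : orient (std q) (wedge (pull (four2 hm hq) (dcr t4)) eta2) =
      orient (std q) (simplicial_vol R (enum 'I_q.+3)).
    by rewrite pull_dcr four2_t4 e2.
  have tw : cyc_twist klein_rev (std q) = cyc_rev (std q).
    by rewrite /cyc_twist klein_rev_emb.
  have o2' : orient (cyc_twist klein_rev (std q))
      (wedge (pull (emb_comp (four2 hm hq) (emb_perm klein_rev)) (dcr t4)) eta2') =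
    orient (cyc_twist klein_rev (std q))
      (simplicial_vol R (listing_twist klein_rev (enum 'I_q.+3))).
    (* The involution inverts the coordinate and exchanges the two ends, so dT is again the pullback
       of the 1-form on the four points. *)
    rewrite tw /listing_twist klein_rev_emb pull_dcr four2_rev_t4 dcr_swap wedgeZr e2.
    rewrite rev_listing_std; congr (orient _ (form_scale _ _)).
    by apply/funext => z; rewrite signr_odd.
  have hpq' : (p' + q' + 7 = #|'I_w.+3| + #|'I_q.+3|)%N by rewrite !card_ord hpq; clear -hm hq; lia.
  have := hst (four1_std hm hq) (four2_std hm hq) klein_rev_nontrivial (glue_pushout hm hq)
    (glue_pushout_rev hm hq) (listing_std q.+3) (nu1_form R) d1 o1 d2 o2 d2' o2' hphi hpsi hpq'.
  rewrite tw stuffle_sign_std (stuffle_std _ _ _ _ _ (glue_uniq hm hq)).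
  rewrite (stuffle_std _ _ _ _ _ (glue_uniq_rev hm hq)).
  have -> : pull (emb_comp j1 (four1 hm hq)) (dcr t4) = @dcr R _ (cubn n m.-1 (m.-1 + q)).
    by rewrite pull_dcr -(glue1_T hm hq) pull_dcr -(four1_t4 hm hq).
  by rewrite or2 or2r.
have cn : (#|'I_n.+3| - 3 = n)%N by rewrite card_ord; nlia.
have cn3 : (3 <= #|'I_n.+3|)%N by rewrite card_ord.
have nice1 k w1 : nice (std w) k w1 -> nice (std n) k (pull j1 w1).
  by apply: nice_pull; left; apply: glue1_std.
have nice2 k w1 : nice (std q) k w1 -> nice (std n) k (pull j2 w1).
  by apply: nice_pull; left; apply: glue2_std.
have nice2r k w1 : nice (std q) k w1 -> nice (std n) k (pull j2r w1).
  by apply: nice_pull; right; apply: glue2r_std.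
have na : nice (std n) n (wedge (pull j1 phia) (pull j2 psia)).
  rewrite [X in nice _ X](_ : _ = (w + q.-1)%N); last by nlia.
  by apply: nice_wedge; [apply: nice1|apply: nice2].
have nb : nice (std n) n (wedge (pull j1 phib) (pull j2 psib)).
  by apply: nice_wedge; [apply: nice1|apply: nice2].
have nar : nice (std n) n (wedge (pull j1 phia) (pull j2r psia)).
  rewrite [X in nice _ X](_ : _ = (w + q.-1)%N); last by nlia.
  by apply: nice_wedge; [apply: nice1|apply: nice2r].
have nbr : nice (std n) n (wedge (pull j1 phib) (pull j2r psib)).
  by apply: nice_wedge; [apply: nice1|apply: nice2r].
have top k1 : nice (std n) n k1 -> top_form (std n) (k1 : form R[i] _).
  by move=> hk; rewrite /top_form cn; apply: nice_regular.
rewrite -/phia -/phib -/psib in int2 int2r.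
have om : form_scale (fun z => arcsn w E1 (emb_comp z j1) * arcsn q E2 (emb_comp z j2))
   (dlogs R[i] n) = Omegan R[i] n glued.
  by congr form_scale; apply/funext => z; rewrite arcs_glued.
have omr : form_scale (fun z => arcsn w E1 (emb_comp z j1) * arcsn q E2 (emb_comp z j2r))
   (dlogs R[i] n) = Omegan R[i] n glued_rev.
  by congr form_scale; apply/funext => z; rewrite arcs_glued_rev.
rewrite om in int2; rewrite omr in int2r.
have sgn_inv (e : bool) (u v : form R[i] 'I_n.+3) : u = form_sign e v ->
    v = form_sign e u.
  move=> ->; rewrite form_scaleA -[LHS]form_scale1; congr form_scale.
  by apply/funext => z; rewrite -expr2 sqrr_sign.
have topO : top_form (std n) (Omegan R[i] n glued).
  by rewrite (sgn_inv _ _ _ int2); apply: regular_scale; apply: top; apply: Nice_add.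
have topOr : top_form (std n) (Omegan R[i] n glued_rev).
  by rewrite (sgn_inv _ _ _ int2r); apply: regular_scale; apply: top; apply: Nice_add.
split=> //.
have ka := key w q.-1 phia psia (nice_regular nphia) (nice_regular npsia) ltac:(nlia).
have kb := key w.-1 q phib psib (nice_regular nphib) (nice_regular npsib) ltac:(nlia).
have := congr2 +%R ka kb; rewrite -mulrDr {ka kb key}.
have sodd (N : nat) (v : form R 'I_n.+3) : form_sign N v =
    form_sign (odd N) v.
  by congr form_scale; apply/funext => z; rewrite signr_odd.
have isor (e : bool) (v : form R 'I_n.+3) : orient (std n) v = @o_st R n ->
    is_orientation (std n) (orient (std n) (form_sign e v)).
  move=> ev; rewrite orient_sign ev; case: e; last exact: o_st_orientation.
  by apply: is_orientation_opp; exact: o_st_orientation.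
rewrite (sodd (w.-1 + s1 + false + b)%N) (sodd (w.-1 + s1 + eps + br)%N) -!cellint_add //; try (by apply: isor); try (by apply: top).
rewrite int2 int2r.
rewrite (cellint_sign hI) //; last by rewrite ovol2; exact: o_st_orientation.
rewrite (cellint_sign hI) //; last by rewrite ovol2r; exact: o_st_orientation.
rewrite ovol2 ovol2r -!/(J _ _) !signr_odd.
have sq (N : nat) : (-1) ^+ N * (-1) ^+ N = 1 :> A by rewrite -expr2 sqrr_sign.
have l1 : (-1) ^+ (w.-1 + s1 + false + b) * ((-1) ^+ b * J n glued) =
    (-1) ^+ (w.-1 + s1) * J n glued.
  by rewrite addn0 exprD -mulrA [X in _ * X]mulrA sq mul1r.
have l2 : (-1) ^+ 'C(q.+1, 2) *
    ((-1) ^+ (w.-1 + s1 + eps + br) * ((-1) ^+ br * J n glued_rev)) =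
    (-1) ^+ (w.-1 + s1) * J n glued_rev.
  rewrite exprD -mulrA [X in _ * (_ * X)]mulrA sq mul1r exprD signr_odd.
  by rewrite -mulrA [_ * (_ * (_ * _))]mulrCA [X in _ * X]mulrA sq mul1r.
rewrite l1 l2 => /(congr1 (fun x => (-1) ^+ (w.-1 + s1) * x)).
by rewrite !mulrA sq !mul1r.
Qed.
End ReversalThm.

(** * From multiple zeta forms to arcs *)

Section Fits.
Variables (F : fieldType) (n : nat).

Lemma arcsE E (z : conf F 'I_n.+3) : arcsn n E z =
  (\prod_(e <- E) Pn n e.1 e.2 z) * \prod_(e <- E) (1 - Pn n e.1 e.2 z)^-1.
Proof. by rewrite /arcs -big_split. Qed.

Lemma arcs_perm E E' : perm_eq E E' -> arcsn n E = arcsn n E' :> (conf F 'I_n.+3 -> F).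
Proof. by move=> h; apply/funext => z; rewrite /arcs (perm_big _ h). Qed.

Lemma cpoly_arcs E : all (fun e => (e.1 <= e.2 <= n)%N) E ->
  cpoly (std n) (fun z : conf F _ => \prod_(e <- E) Pn n e.1 e.2 z).
Proof.
move=> hE; apply: (@cpoly_ext _ _ _ (fun z => \prod_(e <- E | e \in E) Pn n e.1 e.2 z)).
  by move=> z; rewrite -big_seq.
apply: cpoly_prod => e /(allP hE) he; apply: (cpoly_P _ (chain_std n)); nlia.
Qed.

Lemma fits_arcs (T : seq (nat * nat * nat)) : uniq [seq t.2 | t <- T] ->
  all (fun t => (t.1.1 < t.2 < t.1.2)%N && (t.1.2 <= n)%N) T ->
  fitsn F n (fun z => Pn n 0 n z * arcsn n [seq t.1 | t <- T] z).
Proof.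
move=> uT aT; have [N hN e] := arcs_peaks F (chain_std n) uT aT.
exists (fun z => (\prod_(e <- [seq t.1 | t <- T]) Pn n e.1 e.2 z) * N z).
  apply: Cpoly_mul => //; apply: cpoly_arcs; rewrite all_map.
  by apply: sub_all aT => t /= /andP[]; lia.
by move=> z; rewrite arcsE [X in _ * (_ * X)]big_map e; ring.
Qed.

(** The numerator of the arc (0, n) is the factor P 0 n in the coefficient of Theta. *)
Lemma fits_arcs_full (T : seq (nat * nat * nat)) : uniq [seq t.2 | t <- T] ->
  all (fun t => (t.1.1 < t.2 < t.1.2)%N && (t.1.2 <= n)%N) T ->
  (0, n)%N \in [seq t.1 | t <- T] ->
  fitsn F n (arcsn n [seq t.1 | t <- T]).
Proof.
move=> uT aT mT; have [N hN e] := arcs_peaks F (chain_std n) uT aT.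
exists (fun z => (\prod_(e <- rem (0, n)%N [seq t.1 | t <- T]) Pn n e.1 e.2 z) * N z).
  apply: Cpoly_mul => //; apply: cpoly_arcs.
  apply/allP => u /mem_rem/mapP[t /(allP aT) + ->].
  by move=> /andP[]; lia.
by move=> z; rewrite arcsE [X in _ * X]big_map e (perm_big _ (perm_to_rem mT)) /= big_cons; ring.
Qed.

(* B lists the right ends of arcs starting at 0. *)
Definition ends w (B : seq nat) := [&& uniq B, all (fun b => (1 < b <= w)%N) B & w \in B].

(** The arc (0, b) takes the peak b - 1, which is positive as b > 1; for multiple zeta forms this is
    the convergence condition k_1 >= 2. *)
Lemma fits_ends B : ends n B -> fitsn F n (arcsn n [seq (0, b)%N | b <- B]).
Proof.
case/and3P=> uB aB nB.
have := @fits_arcs_full [seq (0, b, b.-1)%N | b <- B].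
rewrite -!map_comp; apply.
- rewrite (eq_map (g := predn)) // map_inj_in_uniq // => x y /(allP aB) hx /(allP aB) hy.
  by lia.
- by rewrite all_map; apply: sub_all aB => b /=; lia.
- by apply/mapP; exists n.
Qed.

Lemma fits_shift1 q B : n = q.+1 -> ends q B ->
  fitsn F n (fun z => Pn n 0 n z * arcsn n [seq (1, b.+1)%N | b <- B] z).
Proof.
move=> en /and3P[uB aB nB].
have := @fits_arcs [seq (1, b.+1, b)%N | b <- B].
rewrite -!map_comp; apply; first by rewrite map_id.
by rewrite all_map; apply: sub_all aB => b /=; lia.
Qed.

(** All arcs end at n, so distinct peaks are found next to their distinct left ends. *)
Lemma fits_right B : ends n B ->
  fitsn F n (fun z => Pn n 0 n z * arcsn n [seq (n - b, n)%N | b <- B] z).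
Proof.
move=> /and3P[uB aB nB].
have := @fits_arcs [seq (n - b, n, (n - b).+1)%N | b <- B].
rewrite -!map_comp; apply.
  rewrite map_inj_in_uniq // => x y /(allP aB) hx /(allP aB) hy /=; lia.
by rewrite all_map; apply: sub_all aB => b /=; lia.
Qed.
End Fits.

Notation psums k := (scanl addn 0%N k).

Lemma scanl_shift a k : scanl addn a k = [seq (a + b)%N | b <- psums k].
Proof.
elim: k a => //= x k IH a; rewrite IH [in RHS]IH -map_comp add0n; congr (_ :: _).
by apply: eq_map => b /=; rewrite addnA.
Qed.

Lemma psums_cons x k : psums (x :: k) = x :: [seq (x + b)%N | b <- psums k].
Proof. by rewrite /= add0n scanl_shift. Qed.

Lemma psums_cat k l : psums (k ++ l) = psums k ++ [seq (sumn k + b)%N | b <- psums l].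
Proof.
elim: k => [|x k IH]; first by rewrite /= map_id.
rewrite cat_cons !psums_cons IH map_cat -map_comp /=; congr (_ :: (_ ++ _)).
by apply: eq_map => b /=; rewrite addnA.
Qed.

Lemma psums_bounds k b : all (ltn 0) k -> b \in psums k -> (0 < b <= sumn k)%N.
Proof.
elim: k b => [|x k IH] b //=; rewrite add0n scanl_shift inE => /andP[x0 hk].
case/predU1P => [->|/mapP[d /(IH _ hk) hd ->]]; lia.
Qed.

Lemma psums_uniq k : all (ltn 0) k -> uniq (psums k).
Proof.
elim: k => [|x k IH] // /andP[x0 hk]; rewrite psums_cons /= map_inj_uniq ?IH ?andbT //.
  apply/mapP => -[d /(psums_bounds hk)]; lia.
by move=> a b /addnI.
Qed.

Lemma psums_last k : k != [::] -> sumn k \in psums k.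
Proof.
elim: k => [|x [|y k] IH] // _; first by rewrite /= addn0 add0n mem_seq1.
rewrite psums_cons inE [sumn _]/(x + sumn (y :: k))%N map_f ?orbT //.
exact: IH.
Qed.

Lemma ends_psums k : convergent k -> ends (sumn k) (psums k).
Proof.
case/and3P=> k0 hk h2; rewrite /ends psums_uniq // psums_last // andbT /=.
apply/allP => b hb; have /andP[_ ->] := psums_bounds hk hb; rewrite andbT.
case: k k0 hk h2 hb => // x k _ /andP[x0 hk] /= h2.
by rewrite add0n scanl_shift inE => /predU1P[->//|/mapP[d _ ->]]; lia.
Qed.

Section Letters.
Variables (R : realType) (n : nat).

Definition letters (bt : nat -> bool) (s : seq nat) : form R[i] 'I_n.+3 :=
  wedges [seq zeta_letter (bt m) (cubn n 0 m) | m <- s].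

(** dt / (1 - t) is t / (1 - t) times dt / t, and by [wedges_from0] the wedge of the dt_m / t_m is
    that of the dx_m / x_m. *)
Lemma Omega_letters B : uniq B -> all (fun b => 0 < b <= n)%N B ->
  Omegan R[i] n [seq (0, b)%N | b <- B] = letters (fun m => m \in B) (iota 1 n).
Proof.
move=> uB aB; have ch := chain_std n.
rewrite /Omega -(wedges_from0 _ ch) iota_index.
pose g m (z : conf R[i] 'I_n.+3) := if m \in B then Pn n 0 m z / (1 - Pn n 0 m z) else 1.
symmetry; transitivity (wedges [seq form_scale (g m) (dlog R[i] (cubn n 0 m)) | m <- iota 1 n]).
  congr wedges; apply/eq_in_map => m; rewrite mem_iota => hm.
  have [oi h1 h2] := chain_neq ch (isT : (0 <= 0 <= n)%N).
  have [_ h3 h4] : off (pto n) (pti n) (pt n m).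
    by apply: (chain_neq ch); lia.
  rewrite /= /zeta_letter (dcr_dlog _ h1 h2 h3 h4) form_scaleA; congr form_scale.
  apply/funext => z; rewrite /g -/(Pn n 0 m z).
  have h : Pn n 0 m z != 0 by apply: (P_neq0 ch); lia.
  by case: ifP => _; rewrite ?mulVf // mulrC.
rewrite wedges_scale; congr form_scale; apply/funext => z.
rewrite /arcs big_map /g -big_mkcond /= -big_filter; apply: perm_big.
apply: uniq_perm; rewrite ?filter_uniq ?iota_uniq // => b.
rewrite mem_filter mem_iota; case hb: (b \in _) => //=.
by have := allP aB _ hb; lia.
Qed.
End Letters.
Arguments letters R n bt s : clear implicits.

Lemma zeta_form_letters (R : realType) k :
  @zeta_form R k = letters R (sumn k) (fun m => m \in psums k) (iota 1 (sumn k)).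
Proof.
by rewrite /zeta_form simplicial_std iota_index -{1}[iota 1 _]map_id zip_map -map_comp.
Qed.

Lemma zeta_formE (R : realType) k : all (ltn 0) k ->
  @zeta_form R k = Omegan R[i] (sumn k) [seq (0, b)%N | b <- psums k].
Proof.
move=> hk; rewrite Omega_letters ?psums_uniq ?zeta_form_letters //.
by apply/allP => b /(psums_bounds hk).
Qed.

(** * Stuffle relations *)

Section Stuffle.
Variables (R : realType) (A : comAlgType rat) (I : integral_data R A).
Hypothesis hI : formal_cell_zeta I.
Hypothesis hst : generalized_stuffle I.
Notation J := (J I).
Notation top n E := (top_form (std n) (Omegan R[i] n E)).

(* q variables carrying the arcs (0, L), for L in Ls, are inserted after the p-th of the variables
   carrying the arcs (0, b), for b in B; the arcs with b >= m are lengthened. *)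
Definition inserted B m q Ls p : seq (nat * nat) :=
  [seq (0, if b < m then b else b + q)%N | b <- B] ++ [seq (p, p + L)%N | L <- Ls].

Lemma inserted_step w B m q Ls : (0 < m <= w)%N -> (0 < q)%N -> ends w B -> ends q Ls ->
  [/\ top (w + q) (inserted B m q Ls m), top (w + q) (inserted B m q Ls m.-1) &
      J (w + q) (inserted B m q Ls m) = J (w + q) (inserted B m q Ls m.-1)].
Proof.
move=> hm hq hB hL; case/and3P: (hB) => uB aB wB; case/and3P: (hL) => uL aL qL.
have hm1 : (0 < m <= w.+1)%N by nlia.
have en1 : (w.-1 + q.+1 = w + q)%N by nlia.
have en2 : (w.+1.-1 + q = w + q)%N by nlia.
(* The block to be reversed has q + 1 variables, the first of them free of the arcs of Ls, which
   become (1, L + 1). Reversal moves the free variable to the right end and mirrors these arcs. *)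
have [t1 t1r e1] : [/\ top (w + q) (inserted B m q Ls m),
   top (w + q) ([seq (0, if b < m then b else b + q)%N | b <- B] ++
        [seq (m.-1 + q - L, m.-1 + q)%N | L <- Ls]) &
   J (w + q) (inserted B m q Ls m) =
   J (w + q) ([seq (0, if b < m then b else b + q)%N | b <- B] ++
        [seq (m.-1 + q - L, m.-1 + q)%N | L <- Ls])].
  have := reversal hI hst hm (ltn0Sn q) (E1 := [seq (0, b)%N | b <- B])
     (E2 := [seq (1, L.+1)%N | L <- Ls]).
  rewrite en1 /glued /glued_rev -!map_comp.
  have -> : [seq ((fun e => (ins m q.+1 e.1, ins m q.+1 e.2)) \o (fun b => (0, b)%N)) b | b <- B] =
     [seq (0, if b < m then b else b + q)%N | b <- B].
    apply: eq_map => b /=; rewrite /ins; congr (_, _); first by case: ifP; nlia.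
    by case: ifP => // _; nlia.
  have -> : [seq ((fun e => (m.-1 + e.1, m.-1 + e.2)%N) \o (fun L => (1, L.+1)%N)) L | L <- Ls] =
     [seq (m, m + L)%N | L <- Ls].
    by apply: eq_map => L /=; congr (_, _); nlia.
  have -> : [seq ((fun e => (m.-1 + q.+1 - e.2, m.-1 + q.+1 - e.1)%N) \o (fun L => (1, L.+1)%N)) L
     | L <- Ls] = [seq (m.-1 + q - L, m.-1 + q)%N | L <- Ls].
    by apply: eq_map => L /=; congr (_, _); nlia.
  apply.
  - by rewrite all_map; apply: sub_all aB => b /=; nlia.
  - by rewrite all_map; apply: sub_all aL => b /=; nlia.
  - exact: fits_ends.
  - exact: fits_shift1.
(* The second block has only the q variables of the mirrored arcs, and its reversal mirrors them
   back. The free variable now belongs to the first factor, which has w + 1 variables. *)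
have [t2 t2r e2] : [/\ top (w + q) ([seq (0, if b < m then b else b + q)%N | b <- B] ++
        [seq (m.-1 + q - L, m.-1 + q)%N | L <- Ls]),
   top (w + q) (inserted B m q Ls m.-1) &
   J (w + q) ([seq (0, if b < m then b else b + q)%N | b <- B] ++
        [seq (m.-1 + q - L, m.-1 + q)%N | L <- Ls]) = J (w + q) (inserted B m q Ls m.-1)].
  have := reversal hI hst hm1 hq
     (E1 := [seq (0, b)%N | b <- [seq (if b < m then b else b.+1)%N | b <- B]])
     (E2 := [seq (q - L, q)%N | L <- Ls]).
  rewrite en2 /glued /glued_rev -!map_comp.
  have -> : [seq ((fun e => (ins m q e.1, ins m q e.2)) \o ((fun b => (0, b)%N)
       \o (fun b => if b < m then b else b.+1)%N)) b | b <- B] =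
     [seq (0, if b < m then b else b + q)%N | b <- B].
    apply: eq_map => b /=; rewrite /ins; congr (_, _); first by case: ifP; nlia.
    by case: (ltnP b m) => hb; [rewrite hb|case: ifP; nlia].
  have -> : [seq ((fun e => (m.-1 + e.1, m.-1 + e.2)%N) \o (fun L => (q - L, q)%N)) L | L <- Ls] =
     [seq (m.-1 + q - L, m.-1 + q)%N | L <- Ls].
    apply/eq_in_map => L /(allP aL) hL' /=; congr (_, _); nlia.
  have -> : [seq ((fun e => (m.-1 + q - e.2, m.-1 + q - e.1)%N) \o (fun L => (q - L, q)%N)) L
     | L <- Ls] = [seq (m.-1, m.-1 + L)%N | L <- Ls].
    by apply/eq_in_map => L /(allP aL) hL' /=; congr (_, _); nlia.
  apply.
  - by rewrite all_map; apply: sub_all aB => b /=; case: ifP; nlia.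
  - by rewrite all_map; apply: sub_all aL => b /=; nlia.
  - rewrite map_comp; apply: fits_ends; apply/and3P; split.
    + rewrite map_inj_in_uniq // => x y /(allP aB) hx /(allP aB) hy.
      by do 2!case: ifP; nlia.
    + by rewrite all_map; apply: sub_all aB => b /=; case: ifP; nlia.
    + by apply/mapP; exists w => //; case: ifP; nlia.
  - exact: fits_right.
by split; rewrite // e1.
Qed.

(* The insertion moves to the left as long as it stays in the same block. *)
Lemma inserted_move w B m q Ls m0 : (m0 <= m <= w)%N -> ends w B ->
  ends q Ls \/ (q = 0%N /\ Ls = [::]) ->
  (forall b, b \in B -> (b < m)%N -> (b <= m0)%N) ->
  J (w + q) (inserted B m q Ls m) = J (w + q) (inserted B m q Ls m0).
Proof.
move=> hm hB [hL|[-> ->]] // hb.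
have hq : (0 < q)%N by case/and3P: hL => _ aL qL; have := allP aL _ qL; nlia.
elim: m hm hb => [|m IH] hm hb; first by congr J; congr inserted; nlia.
have [<-|nm] := eqVneq m0 m.+1 => //.
have hm' : (0 < m.+1 <= w)%N by nlia.
have [_ _ ->] := inserted_step hm' hq hB hL.
have [->|nm0] := eqVneq m0 m => //.
have eB p : inserted B m.+1 q Ls p = inserted B m q Ls p.
  congr (_ ++ _); apply/eq_in_map => b hbB; have := hb b hbB.
  by do 2!case: ifP => //; nlia.
rewrite !eB IH //; first by nlia.
by move=> b hbB hbm; apply: hb => //; nlia.
Qed.

Lemma top_ends w B : ends w B -> top w [seq (0, b)%N | b <- B].
Proof.
move=> hB; rewrite /top_form card_ord (_ : (w.+3 - 3)%N = w); last by nlia.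
by apply/nice_regular/(nice_fits (chain_std w)); apply: fits_ends.
Qed.

Lemma top_inserted w B m q Ls : (0 < m <= w)%N -> ends w B -> ends q Ls \/ (q = 0%N /\ Ls = [::]) ->
  top (w + q) (inserted B m q Ls m) /\ top (w + q) (inserted B m q Ls m.-1).
Proof.
move=> hm hB [hL|[-> ->]].
  have hq : (0 < q)%N by case/and3P: hL => _ aL qL; have := allP aL _ qL; nlia.
  by have [] := inserted_step hm hq hB hL.
rewrite /inserted /= !cats0 addn0.
have -> : [seq (0, if b < m then b else b + 0)%N | b <- B] = [seq (0, b)%N | b <- B].
  by apply: eq_map => b; rewrite addn0; case: ifP.
by split; apply: top_ends.
Qed.

End Stuffle.

Section StuffleRec.
Variables (R : realType) (A : comAlgType rat) (I : integral_data R A).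
Hypothesis hI : formal_cell_zeta I.
Hypothesis hst : generalized_stuffle I.
Notation J := (J I).
Notation top n E := (top_form (std n) (Omegan R[i] n E)).

Lemma J_perm n E E' : perm_eq E E' -> J n E = J n E'.
Proof. by move=> h; rewrite /J /Omega (arcs_perm _ _ h). Qed.

Lemma top_perm n E E' : perm_eq E E' -> top n E -> top n E'.
Proof. by move=> h; rewrite /Omega (arcs_perm _ _ h). Qed.

(* The arcs of k and l, on separate sets of variables, followed by the arcs of r on all variables *)
Definition mixed k l r : seq (nat * nat) :=
  [seq (0, b)%N | b <- psums k] ++ [seq (sumn k, sumn k + L)%N | L <- psums l] ++
  [seq (0, sumn k + sumn l + b)%N | b <- psums r].

Definition mixedJ k l r := J (sumn k + sumn l + sumn r) (mixed k l r).

Lemma zetaI_J k : all (ltn 0) k -> zetaI I k = J (sumn k) [seq (0, b)%N | b <- psums k].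
Proof. by move=> hk; rewrite /zetaI zeta_formE. Qed.

Lemma mixed_nil_l l r : all (ltn 0) l -> all (ltn 0) r -> mixedJ [::] l r = zetaI I (l ++ r).
Proof.
move=> hl hr; rewrite zetaI_J ?all_cat ?hl // psums_cat map_cat -map_comp sumn_cat.
by rewrite /mixedJ /mixed /= !add0n.
Qed.

Lemma mixed_nil_r k r : all (ltn 0) k -> all (ltn 0) r -> mixedJ k [::] r = zetaI I (k ++ r).
Proof.
move=> hk hr; rewrite zetaI_J ?all_cat ?hk // psums_cat map_cat -map_comp sumn_cat.
by rewrite /mixedJ /mixed /= !addn0.
Qed.

Lemma convergent_pos k : convergent k -> all (ltn 0) k.
Proof. by case/and3P. Qed.

Lemma convergent_cat k l : convergent k -> all (ltn 0) l -> convergent (k ++ l).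
Proof. by case: k => // x k /and3P[_ hk hx] hl; apply/and3P; split; rewrite // all_cat hk hl. Qed.

Lemma convergent_grow k x y r : convergent (rcons k x) -> all (ltn 0) r ->
  convergent (k ++ (x + y)%N :: r).
Proof.
move=> /and3P[_]; rewrite all_rcons => /andP[x0 hk] hd hr.
apply/and3P; split; first by case: (k).
  by rewrite all_cat hk /= hr andbT ltn_addr.
by case: k hd {hk} => //=; lia.
Qed.

Lemma psums_rcons k x : psums (rcons k x) = rcons (psums k) (sumn k + x)%N.
Proof. by rewrite -cats1 psums_cat /= add0n cats1. Qed.

Lemma sumn_rcons' k x : sumn (rcons k x) = (sumn k + x)%N.
Proof. by rewrite sumn_rcons. Qed.

Lemma prefix_ends l y : convergent (rcons l y) ->
  ends (sumn l) (psums l) \/ (sumn l = 0%N /\ psums l = [::]).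
Proof.
case: l => [|a l] h; [by right|left; apply: ends_psums].
move: h => /and3P[_ hl ha]; apply/and3P; split=> //.
by move: hl; rewrite all_rcons => /andP[].
Qed.

(** In the two terms with k alone on the left, the block of l is carried to the right through x
    variables of the next entry, where no arc from 0 ends. All four integrals then share the arcs of
    k, l and r and differ only by those in [arcs_stuffle]. *)
Lemma mixed_rec k x l y r : convergent (rcons k x) -> convergent (rcons l y) -> all (ltn 0) r ->
  mixedJ (rcons k x) (rcons l y) r =
  mixedJ (rcons k x) l (y :: r) + mixedJ k (rcons l y) (x :: r) + mixedJ k l ((x + y)%N :: r).
Proof.
move=> hk hl hr.
have /andP[x0 pk] : (0 < x)%N && all (ltn 0) k.
  by have := convergent_pos hk; rewrite all_rcons.
have /andP[y0 pl] : (0 < y)%N && all (ltn 0) l.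
  by have := convergent_pos hl; rewrite all_rcons.
set m := (sumn k + x)%N; set q := sumn l; set rho := sumn r; set N := (m + (q + y) + rho)%N.
pose A0 := [seq (0, b)%N | b <- psums k].
pose Y p := [seq (p, p + L)%N | L <- psums l].
pose R0 := [seq (0, m + (q + y) + b)%N | b <- psums r].
have bk b : b \in psums k -> (0 < b <= sumn k)%N by apply: psums_bounds.
have br b : b \in psums r -> (0 < b)%N by move=> /(psums_bounds hr)/andP[].
have count_perm (s1 s2 : seq (nat * nat)) : (forall a, count a s1 = count a s2) -> perm_eq s1 s2.
  by move=> h; apply/seq.permP.
have e0 : mixedJ (rcons k x) (rcons l y) r =
    J N ([:: (0, m); (m, m + (q + y))] ++ (A0 ++ Y m ++ R0))%N.
  rewrite /mixedJ /mixed !psums_rcons !sumn_rcons' -/m -/q; apply: J_perm.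
  rewrite !map_rcons -!cats1; apply: count_perm => a.
  by rewrite !count_cat /= -/A0 -/(Y m) -/R0; nlia.
have e1 : mixedJ (rcons k x) l (y :: r) =
    J N ([:: (0, m + (q + y)); (0, m)] ++ (A0 ++ Y m ++ R0))%N.
  rewrite /mixedJ /mixed !psums_rcons !sumn_rcons' -/m -/q.
  rewrite (_ : (m + q + sumn (y :: r))%N = N); last by rewrite /N /=; nlia.
  rewrite psums_cons map_rcons map_cons -map_comp.
  rewrite [map (_ \o _) _](_ : _ = R0); last by apply: eq_map => b /=; congr (_, _); nlia.
  rewrite (_ : (m + q + y)%N = (m + (q + y))%N); last by nlia.
  apply: J_perm; rewrite -!cats1; apply: count_perm => a.
  by rewrite !count_cat /= -/A0 -/(Y m); nlia.
have eB2 : [seq (0, if b < m then b else b + (q + y))%N | b <- psums (k ++ x :: r)] =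
    A0 ++ (0, m + (q + y))%N :: R0.
  rewrite psums_cat psums_cons !map_cat /= -!map_comp ltnn; congr (_ ++ _ :: _).
    by apply/eq_in_map => b /bk hb; rewrite ifT // /m; nlia.
  by apply/eq_in_map => b /br hb /=; rewrite ifF /m; [congr (_, _)|]; nlia.
have eB3 : [seq (0, if b < m then b else b + q)%N | b <- psums (k ++ (x + y)%N :: r)] =
    A0 ++ (0, m + (q + y))%N :: R0.
  rewrite psums_cat psums_cons !map_cat /= -!map_comp ifF; last by rewrite /m; nlia.
  congr (_ ++ _ :: _); last 1 first.
  - by apply/eq_in_map => b /br hb /=; rewrite ifF /m; [congr (_, _)|]; nlia.
  - by apply/eq_in_map => b /bk hb; rewrite ifT // /m; nlia.
  - by congr (_, _); rewrite /m; nlia.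
have hB2 : ends (m + rho) (psums (k ++ x :: r)).
  rewrite (_ : (m + rho)%N = sumn (k ++ x :: r)); last by rewrite sumn_cat /= /m; nlia.
  by apply: ends_psums; rewrite -cat_rcons; apply: convergent_cat.
have hB3 : ends (m + y + rho) (psums (k ++ (x + y)%N :: r)).
  rewrite (_ : (m + y + rho)%N = sumn (k ++ (x + y)%N :: r)); last by rewrite sumn_cat /= /m; nlia.
  by apply: ends_psums; apply: convergent_grow.
have hL : ends (q + y) (psums (rcons l y)).
  by rewrite -sumn_rcons'; apply: ends_psums.
have N2 : (m + rho + (q + y) = N)%N by rewrite /N; nlia.
have N3 : (m + y + rho + q = N)%N by rewrite /N; nlia.
have p2 : perm_eq (inserted (psums (k ++ x :: r)) m (q + y) (psums (rcons l y)) m)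
    ([:: (0, m + (q + y)); (m, m + (q + y))] ++ (A0 ++ Y m ++ R0))%N.
  rewrite /inserted eB2 psums_rcons -/q map_rcons -cats1; apply: count_perm => a.
  by rewrite !count_cat /= -/(Y m); nlia.
have p3 : perm_eq (inserted (psums (k ++ (x + y)%N :: r)) m q (psums l) m)
    ([:: (0, m + (q + y))] ++ (A0 ++ Y m ++ R0))%N.
  rewrite /inserted eB3; apply: count_perm => a.
  by rewrite !count_cat /= -/(Y m); nlia.
(* The block of l followed by y is moved from the position after k to the end m of the x
   variables. *)
have e2 : mixedJ k (rcons l y) (x :: r) =
    J N ([:: (0, m + (q + y)); (m, m + (q + y))] ++ (A0 ++ Y m ++ R0))%N.
  rewrite -(J_perm _ p2) -N2 (inserted_move hI hst (m0 := sumn k) _ hB2); first last.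
  - move=> b; rewrite psums_cat mem_cat psums_cons => /orP[/bk|]; first by nlia.
    by move=> /mapP[d]; rewrite inE => /predU1P[->|/mapP[d' _ ->]] ->; rewrite /m; nlia.
  - by left.
  - by rewrite /m; nlia.
  rewrite /mixedJ sumn_rcons' (_ : (_ + sumn (x :: r))%N = (m + rho + (q + y))%N); last first.
    by rewrite /= /m; nlia.
  apply: J_perm; rewrite /mixed /inserted eB2 sumn_rcons' psums_cons map_cons -map_comp.
  rewrite [map (_ \o _) _](_ : _ = R0); last first.
    by apply: eq_map => b /=; congr (_, _); rewrite /m; nlia.
  rewrite (_ : (sumn k + (sumn l + y) + x)%N = (m + (q + y))%N); last by rewrite /m; nlia.
  by apply: count_perm => a; rewrite !count_cat /= -/A0; nlia.
(* Here the block is that of l alone, and it comes to lie between the x and the y variables of the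
   entry x + y. *)
have e3 : mixedJ k l ((x + y)%N :: r) =
    J N ([:: (0, m + (q + y))] ++ (A0 ++ Y m ++ R0))%N.
  rewrite -(J_perm _ p3) -N3 (inserted_move hI hst (m0 := sumn k) _ hB3); first last.
  - move=> b; rewrite psums_cat mem_cat psums_cons => /orP[/bk|]; first by nlia.
    by move=> /mapP[d]; rewrite inE => /predU1P[->|/mapP[d' _ ->]] ->; rewrite /m; nlia.
  - exact: prefix_ends hl.
  - by rewrite /m; nlia.
  rewrite /mixedJ (_ : (_ + sumn (_ :: r))%N = (m + y + rho + q)%N); last first.
    by rewrite /= /m; nlia.
  apply: J_perm; rewrite /mixed /inserted eB3 psums_cons map_cons -map_comp.
  rewrite [map (_ \o _) _](_ : _ = R0); last first.
    by apply: eq_map => b /=; congr (_, _); rewrite /m; nlia.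
  rewrite (_ : (sumn k + sumn l + (x + y))%N = (m + (q + y))%N); last by rewrite /m; nlia.
  by apply: count_perm => a; rewrite !count_cat /= -/A0; nlia.
have t1 : top N ([:: (0, m + (q + y)); (0, m)] ++ (A0 ++ Y m ++ R0))%N.
  have hB1 : ends (m + y + rho) (psums (rcons k x ++ y :: r)).
    rewrite (_ : (m + y + rho)%N = sumn (rcons k x ++ y :: r)); last first.
      by rewrite sumn_cat sumn_rcons' /= /m; nlia.
    by apply: ends_psums; apply: convergent_cat => //=; rewrite hr andbT.
  (* The threshold m + 1 keeps the arc (0, m) unchanged while the block is inserted at m. *)
  have hm : (0 < m.+1 <= m + y + rho)%N by nlia.
  have [_] := top_inserted hI hst hm hB1 (prefix_ends hl).
  rewrite -/q N3; apply: top_perm; rewrite /inserted.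
  have -> : [seq (0, if b < m.+1 then b else b + q)%N | b <- psums (rcons k x ++ y :: r)] =
      A0 ++ [:: (0, m); (0, m + (q + y))]%N ++ R0.
    rewrite psums_cat psums_rcons psums_cons !map_cat map_rcons /= -!map_comp sumn_rcons' -/m ltnSn.
    rewrite cat_rcons ifF; last by nlia.
    congr (_ ++ _ :: _ :: _); last 1 first.
    - by apply/eq_in_map => b /br hb /=; rewrite ifF; [congr (_, _)|]; nlia.
    - by apply/eq_in_map => b /bk hb; rewrite ifT // /m; nlia.
    - by congr (_, _); nlia.
  by apply: count_perm => a; rewrite !count_cat /= -/(Y m); nlia.
have t2 : top N ([:: (0, m + (q + y)); (m, m + (q + y))] ++ (A0 ++ Y m ++ R0))%N.
  have hm : (0 < m <= m + rho)%N by rewrite /m; nlia.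
  have [h _] := top_inserted hI hst hm hB2 (or_introl hL).
  by rewrite N2 in h; apply: top_perm h.
have t3 : top N ([:: (0, m + (q + y))] ++ (A0 ++ Y m ++ R0))%N.
  have hm : (0 < m <= m + y + rho)%N by rewrite /m; nlia.
  have [h _] := top_inserted hI hst hm hB3 (prefix_ends hl).
  by rewrite -/q N3 in h; apply: top_perm h.
rewrite e0 e1 e2 e3 /J.
have cn : (3 <= #|'I_N.+3|)%N by rewrite card_ord.
rewrite -!(cellint_add hI cn (o_st_orientation R N)) //; last by apply: regular_add.
congr (I _ _ _); apply/form_ext => z vs; rewrite /Omega /form_add /form_scale -!mulrDl.
congr (_ * _); rewrite !arcs_cat -!mulrDl; congr (_ * _).
by apply: (arcs_stuffle (chain_std N)); rewrite /N /m; nlia.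
Qed.

End StuffleRec.

Section StuffleSum.
Variables (R : realType) (A : comAlgType rat) (I : integral_data R A).
Hypothesis hI : formal_cell_zeta I.
Hypothesis hst : generalized_stuffle I.

(** The recursion removes last entries, so it passes through initial segments, the empty one
    included. *)
Definition convergent_nil k := (k == [::]) || convergent k.

Lemma convergent_nil_pos k : convergent_nil k -> all (ltn 0) k.
Proof. by case/predU1P => [->//|]; apply: convergent_pos. Qed.

Lemma convergent_nil_rcons k x : convergent_nil (rcons k x) ->
  [/\ convergent (rcons k x), convergent_nil k & (0 < x)%N].
Proof.
rewrite /convergent_nil (_ : rcons k x == [::] = false) /=; last by case: k.
move=> h; split=> //; have := convergent_pos h; rewrite all_rcons => /andP[x0 hk] //.
case: k h hk => //= a k /and3P[_ _ ha] /andP[a0 hk].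
by apply/and3P; split=> //=; rewrite a0.
Qed.

(** The recursion of the stuffle product works from the last entries; r accumulates the entries of
    the result that are already determined. *)
Lemma mixed_st k l r : convergent_nil (rev k) -> convergent_nil (rev l) -> all (ltn 0) r ->
  mixedJ I (rev k) (rev l) r = \sum_(s <- st_rev k l) zetaI I (rev s ++ r).
Proof.
elim: k l r => [|x k IHk] l r hk hl hr.
  by rewrite /= big_seq1 mixed_nil_l // convergent_nil_pos.
elim: l r hl hr => [|y l IHl] r hl hr.
  by rewrite /= big_seq1 mixed_nil_r // convergent_nil_pos.
move: (hk) (hl); rewrite !rev_cons => /convergent_nil_rcons[ck nk x0] /convergent_nil_rcons[cl nl y0].
rewrite (mixed_rec hI hst ck cl hr) -!rev_cons.
rewrite IHl ?IHk //=; try by rewrite ?x0 ?y0 ?addn_gt0 ?x0.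
rewrite !big_cat !big_map /= addrA.
by congr (_ + _ + _); apply: eq_bigr => s _; rewrite rev_cons cat_rcons.
Qed.

End StuffleSum.

(** * Products of two zeta integrals as mixed arc integrals *)

Section ThreePoints.
Variable m : nat.
Lemma three_bound x : (x < 3)%N -> (x < m.+3)%N. Proof. lia. Qed.
Lemma three_inj x y : (x < 3)%N -> (y < 3)%N -> x = y -> x = y. Proof. by []. Qed.
Definition three : embedding 'I_3 'I_m.+3 := ord_emb three_bound three_inj.
Lemma threeE x : three x = x :> nat. Proof. exact: ord_embE. Qed.
Lemma three_std : cyc_emb three (cyc_std 3) (std m).
Proof. exact: (cyc_emb_mono (f := id) threeE). Qed.
End ThreePoints.

Section Product.
Variables (w q : nat).
Hypothesis hq : (0 < q)%N.
Notation n := (w + q)%N.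

Let hw : (0 < w.+1 <= w.+1)%N. Proof. by rewrite leqnn. Qed.

Lemma first_bound x : (x < w.+3)%N -> (x < n.+3)%N. Proof. lia. Qed.
Lemma first_inj x y : (x < w.+3)%N -> (y < w.+3)%N -> x = y -> x = y. Proof. by []. Qed.
Definition first_pts : embedding 'I_w.+3 'I_n.+3 := ord_emb first_bound first_inj.
Lemma first_ptsE x : first_pts x = x :> nat. Proof. exact: ord_embE. Qed.

(** A block gluing at the end: the last of w + 1 variables is replaced by q new ones. *)
Definition last_pts : embedding 'I_q.+3 'I_n.+3 := glue2 hw hq.
Lemma last_ptsE x : last_pts x = (if x < 2 then x : nat else x + w)%N :> nat.
Proof. exact: (glue2E hw hq). Qed.

(** The three points are 0, oo, p_w in T1 and 0, oo, p_0 in T2. As T1 has no points between p_w and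
    0 and T2 none between oo and p_0, there is one cyclic order on the pushout, and the variables of
    T2 follow those of T1. *)
Let f1 v := (if v < 2 then v else v + w)%N.
Lemma three1_bound x : (x < 3)%N -> (f1 x < w.+3)%N. Proof. by rewrite /f1; case: ifP; lia. Qed.
Lemma three1_inj x y : (x < 3)%N -> (y < 3)%N -> f1 x = f1 y -> x = y.
Proof. by rewrite /f1; do 2!case: ifP; lia. Qed.

Definition three1 : embedding 'I_3 'I_w.+3 := ord_emb three1_bound three1_inj.
Lemma three1E x : three1 x = f1 x :> nat. Proof. exact: ord_embE. Qed.

Lemma three1_std : cyc_emb three1 (cyc_std 3) (std w).
Proof. by apply: (cyc_emb_mono three1E) => x y; rewrite /f1; do 2!case: ifP; lia. Qed.
Lemma first_std : cyc_emb first_pts (std w) (std n).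
Proof. exact: (cyc_emb_mono (f := id) first_ptsE). Qed.

Lemma last_std : cyc_emb last_pts (std q) (std n).
Proof. exact: (glue2_std hw hq). Qed.

Lemma product_pushout : is_pushout three1 (three q) first_pts last_pts.
Proof.
apply: pushoutP; [exact: emb_inj|exact: emb_inj|..].
- case=> [[|[|[|//]]]] h; apply: ord_inj; rewrite first_ptsE last_ptsE three1E threeE /f1 //=.
- move=> x; have hx := ltn_ord x; have [h|h] := ltnP x w.+3.
    by left; exists (inord x); apply: ord_inj; rewrite first_ptsE inordK.
  right; exists (inord (x - w)); apply: ord_inj; rewrite last_ptsE inordK; last by lia.
  by case: ifP; lia.
- move=> y1 y2 /(congr1 (@nat_of_ord _)); rewrite first_ptsE last_ptsE => e.
  have h1 := ltn_ord y1; have h2 := ltn_ord y2.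
  exists (inord y2); split; apply: ord_inj.
    by rewrite three1E inordK; move: e; rewrite /f1; do ?case: ifP; lia.
  by rewrite threeE inordK //; move: e; case: ifP; lia.
Qed.

Lemma product_uniq (C : cycord 'I_n.+3) :
  cyc_emb first_pts (std w) C && cyc_emb last_pts (std q) C = (C == cyc_std n.+3).
Proof.
apply/andP/eqP => [[/cyc_embP h1 /cyc_embP h2]|->]; last by split; [exact: first_std|exact: last_std].
apply: cyc_std_uniq => j j0 jn.
have [a1|a1] := ltnP j w.+2.
  by apply: (@in_cyc_inord _ C (first_pts (inord 0)) (first_pts (inord j)) (first_pts (inord j.+1)));
    rewrite -?h1 ?in_cyc_std ?first_ptsE /cyc_nat ?inordK //; do ?case: ifP; lia.
by apply: (@in_cyc_inord _ C (last_pts (inord 0)) (last_pts (inord (j - w))) (last_pts (inord (j - w).+1)));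
  rewrite -?h2 ?in_cyc_std ?last_ptsE /cyc_nat ?inordK //; do ?case: ifP; lia.
Qed.

Lemma first_pt k : (k <= w)%N -> first_pts (pt w k) = pt n k.
Proof. by move=> hk; apply: ord_inj; rewrite first_ptsE !val_pt //; lia. Qed.
Lemma first_o : first_pts (pto w) = pto n.
Proof. by apply: ord_inj; rewrite first_ptsE !val_pto. Qed.
Lemma first_i : first_pts (pti w) = pti n.
Proof. by apply: ord_inj; rewrite first_ptsE !val_pti. Qed.
Lemma last_pt k : (k <= q)%N -> last_pts (pt q k) = pt n (w + k).
Proof. exact: (glue2_pt hw hq). Qed.
Lemma last_o : last_pts (pto q) = pto n. Proof. exact: (glue2_o hw hq). Qed.
Lemma last_i : last_pts (pti q) = pti n. Proof. exact: (glue2_i hw hq). Qed.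

Lemma product_dlogs F : wedge (pull first_pts (dlogs F w)) (pull last_pts (dlogs F q)) = dlogs F n.
Proof.
have e : pull last_pts (dlogs F q) =
    dlogw F [seq cubn n k.-1 k | k <- index_iota w.+1 (w.+1 + q)].
  exact: (glue2_seg hw hq F).
rewrite e !pull_dlogs -wedges_cat -map_cat; congr (wedges (map _ _)).
rewrite /cubical -map_comp.
have -> : index_iota 1 n.+1 = index_iota 1 w.+1 ++ index_iota w.+1 (w.+1 + q).
  rewrite /index_iota (_ : (n.+1 - 1 = (w.+1 - 1) + (w.+1 + q - w.+1))%N); last by lia.
  by rewrite iotaD; congr (_ ++ iota _ _); lia.
rewrite map_cat; congr (_ ++ _); apply/eq_in_map => k; rewrite mem_index_iota => hk.
by apply: (quad_map_pt first_pt first_o first_i); lia.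
Qed.

Lemma product_volume (R : realType) :
  orient (std n) (wedge (pull first_pts (simplicial_vol R (enum 'I_w.+3)))
      (pull last_pts (simplicial_vol R (enum 'I_q.+3)))) = @o_st R n.
Proof.
rewrite /o_st !simplicial_vol_std !pull_scale wedgeZl wedgeZr form_scaleA product_dlogs.
pose g (z : conf R 'I_n.+3) := (\prod_(1 <= k < w.+1) Pn n 0 k z) *
  (\prod_(1 <= k < q.+1) Pn n w (w + k) z) / \prod_(1 <= k < n.+1) Pn n 0 k z.
have hn z : \prod_(1 <= k < n.+1) Pn n 0 k z != 0 :> R.
  rewrite prodf_seq_neq0; apply/allP => k; rewrite mem_index_iota => hk; apply/implyP => _.
  by apply: (P_neq0 (chain_std n)); lia.
rewrite -[RHS](@orient_pos _ _ _ g).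
  rewrite form_scaleA; congr (orient _ (form_scale _ _)); apply/funext => z.
  rewrite /g divfK //; congr (_ * _); apply: eq_big_nat => k hk.
    by rewrite (P_map first_pt first_o first_i) //; lia.
  by rewrite (P_map last_pt last_o last_i) ?addn0 //; lia.
move=> z hz; rewrite /g; apply: divr_gt0; last first.
  by rewrite big_nat prodr_gt0 // => k hk; apply: P_pos => //; lia.
by apply: mulr_gt0; rewrite big_nat prodr_gt0 // => k hk; apply: P_pos => //; lia.
Qed.

End Product.

Section ProductRelation.
Variables (R : realType) (A : comAlgType rat) (I : integral_data R A).
Hypothesis hI : formal_cell_zeta I.
Hypothesis hsh : generalized_shuffle I.

Lemma diff_form_std n : diff_form (#|'I_n.+3| - 3) (simplicial_vol R (enum 'I_n.+3)).
Proof.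
have ch := chain_std n; rewrite card_ord (_ : (n.+3 - 3)%N = n); last by lia.
move=> z; exists [:: (1, simplicial (enum 'I_n.+3))]; split.
  rewrite /= andbT simplicial_std size_map size_iota subn1 eqxx /=.
  apply/allP => x /mapP[k]; rewrite mem_index_iota => hk ->.
  by apply: (@crossing_distinct _ (std n)); apply: (crossing_cub ch); lia.
by move=> vs; rewrite big_seq1 mul1r.
Qed.

Lemma top_zeta k : convergent k -> top_form (cyc_std (sumn k).+3) (@zeta_form R k).
Proof.
by move=> hk; rewrite zeta_formE ?convergent_pos //; apply/top_ends/ends_psums.
Qed.

Lemma zetaI_product k l : convergent k -> convergent l ->
  zetaI I k * zetaI I l = mixedJ I k l [::].
Proof.
move=> hk hl; set w := sumn k; set q := sumn l.
have hq : (0 < q)%N.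
  by case/and3P: (ends_psums hl) => _ aL qL; have := allP aL _ qL; rewrite -/q; lia.
have := hsh (three1_std w hq) (three_std _) (product_pushout w hq)
  (@diff_form_std w) (o_st_orientation R w) (@diff_form_std q) (o_st_orientation R q)
  (top_zeta hk) (top_zeta hl).
rewrite -!/(o_st _) -!/(zetaI _ _) => ->.
rewrite (eq_bigl _ _ (product_uniq (w := w) hq)) big_pred1_eq product_volume.
rewrite /mixedJ addn0 /J; congr (I _ _ _).
rewrite !zeta_formE ?convergent_pos // /Omega !pull_scale wedgeZl wedgeZr form_scaleA product_dlogs.
congr form_scale; apply/funext => z.
rewrite (arcs_map (@first_pt w q hq) (@first_o w q hq) (@first_i w q hq)); last first.
  rewrite all_map; apply/allP => b /(psums_bounds (convergent_pos hk)) /=; lia.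
rewrite (arcs_map (@last_pt w q hq) (@last_o w q hq) (@last_i w q hq)); last first.
  rewrite all_map; apply/allP => b /(psums_bounds (convergent_pos hl)) /=; lia.
rewrite -arcs_cat /mixed /= cats0 -!map_comp; congr (arcsn _ (_ ++ _) z).
by apply: eq_map => b /=; rewrite addn0.
Qed.

Lemma stuffle_relation (hst : generalized_stuffle I) k l : convergent k -> convergent l ->
  zetaI I k * zetaI I l = \sum_(s <- st k l) zetaI I s.
Proof.
move=> hk hl; rewrite zetaI_product // -{1}(revK k) -{1}(revK l) (mixed_st hI hst) //.
- by rewrite /st big_map; apply: eq_bigr => s _; rewrite cats0.
- by rewrite revK /convergent_nil hk orbT.
- by rewrite revK /convergent_nil hl orbT.
Qed.
End ProductRelation.

(** * Shuffle relations *)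

Section Shuffles.
Variable T : Type.

(** Shuffles of lists of distinct labels form a set without repetitions, in bijection with cyclic
    orders; the multiset of shuffled words is its image under the map from labels to letters
    ([sh_word_map]). *)
Fixpoint shuffles (s1 : seq T) : seq T -> seq (seq T) :=
  if s1 is v :: s1' then
    fix shuffles1 (s2 : seq T) : seq (seq T) :=
      if s2 is u :: s2' then
        [seq v :: z | z <- shuffles s1' s2] ++ [seq u :: z | z <- shuffles1 s2']
      else [:: s1]
  else fun s2 => [:: s2].

Lemma shuffles_cons v s1 u s2 : shuffles (v :: s1) (u :: s2) =
  [seq v :: z | z <- shuffles s1 (u :: s2)] ++ [seq u :: z | z <- shuffles (v :: s1) s2].
Proof. by []. Qed.

Lemma shuffles_nil s : shuffles s [::] = [:: s].
Proof. by case: s. Qed.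
End Shuffles.

Lemma sh_word_map (T : Type) (f : T -> bool) s1 s2 :
  sh_word [seq f x | x <- s1] [seq f x | x <- s2] =
  [seq [seq f x | x <- s] | s <- shuffles s1 s2].
Proof.
elim: s1 s2 => [|v s1 IH1] //; elim=> [|u s2 IH2] //.
rewrite shuffles_cons map_cat -!map_comp.
rewrite -[sh_word _ _]/([seq f v :: z | z <- sh_word (map f s1) (map f (u :: s2))] ++
  [seq f u :: z | z <- sh_word (map f (v :: s1)) (map f s2)]).
by rewrite IH1 IH2 -!map_comp.
Qed.

Section ShufflesEq.
Variable T : eqType.
Implicit Types s : seq T.

Lemma mem_map_cons (x y : T) s (X : seq (seq T)) :
  (x :: s \in [seq y :: z | z <- X]) = (x == y) && (s \in X).
Proof.
apply/mapP/andP => [[z hz [-> ->]]|[/eqP-> hs]]; first by rewrite eqxx.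
by exists s.
Qed.

Lemma filter_mem_id s : [seq x <- s | x \in s] = s.
Proof. exact/all_filterP/allP. Qed.

Lemma mem_shuffles s1 s2 s : uniq (s1 ++ s2) ->
  (s \in shuffles s1 s2) =
  [&& perm_eq s (s1 ++ s2), [seq x <- s | x \in s1] == s1 & [seq x <- s | x \in s2] == s2].
Proof.
elim: s s1 s2 => [|h z IH] [|v s1] [|u s2] us.
- by [].
- by rewrite mem_seq1; apply/esym/negP => /and3P[/perm_size].
- by rewrite shuffles_nil mem_seq1; apply/esym/negP => /and3P[/perm_size].
- rewrite shuffles_cons mem_cat; apply/orP/and3P => [[] /mapP[]//|[/perm_size]//].
- by rewrite mem_seq1; apply/esym/negP => /and3P[/perm_size].
- rewrite mem_seq1; apply/eqP/and3P => [->|[hp _ /eqP hf]].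
    by split; rewrite ?filter_pred0 ?filter_mem_id.
  rewrite -hf; apply/esym/all_filterP/allP => x.
  by rewrite (perm_mem hp).
- rewrite shuffles_nil cats0 mem_seq1; apply/eqP/and3P => [->|[hp /eqP hf _]].
    by split; rewrite ?filter_pred0 ?filter_mem_id.
  rewrite -hf; apply/esym/all_filterP/allP => x.
  by rewrite (perm_mem hp).
rewrite shuffles_cons mem_cat !mem_map_cons.
move: (us); rewrite cat_uniq => /and3P[us1 /hasPn hd us2].
have vu : v != u.
  by apply: contraTneq (hd u (mem_head _ _)) => <-; rewrite mem_head.
have v2 : v \notin u :: s2.
  by apply/negP => /hd; rewrite mem_head.
have u1 : u \notin v :: s1 by apply: hd; apply: mem_head.
have fc (a : pred T) x r : [seq y <- x :: r | a y] =
    if a x then x :: [seq y <- r | a y] else [seq y <- r | a y] by [].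
have [->|hv] := eqVneq h v.
  rewrite (negbTE vu) orbF IH; last by case/andP: us.
  rewrite andTb cat_cons perm_cons !fc; apply: andb_id2l => hp.
  have vz : v \notin z by rewrite (perm_mem hp); case/andP: us.
  rewrite mem_head (negbTE v2) eqseq_cons eqxx andTb; congr (_ && _).
  congr (_ == _); apply: eq_in_filter => x xz; rewrite inE.
  by case: eqVneq => // e; rewrite -e xz in vz.
have [->|hu] := eqVneq h u.
  have us' : uniq ((v :: s1) ++ s2).
    by apply: subseq_uniq us; apply: cat_subseq; rewrite ?subseq_cons.
  rewrite orFb andTb IH // (_ : perm_eq (u :: z) _ = perm_eq z ((v :: s1) ++ s2)); last first.
    by rewrite -[_ ++ u :: _]/((v :: s1) ++ [:: u] ++ s2) (permPr (permEl (perm_catCA _ _ _))) perm_cons.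
  rewrite !fc.
  apply: andb_id2l => hp.
  have uz : u \notin z.
    rewrite (perm_mem hp) mem_cat negb_or u1.
    by move: us2 => /andP[].
  rewrite mem_head (negbTE u1) eqseq_cons eqxx andTb; congr (_ && _).
  congr (_ == _); apply: eq_in_filter => x xz; rewrite inE.
  by case: eqVneq => // e; rewrite -e xz in uz.
apply/esym/negP => /and3P[hp /eqP e1 /eqP e2].
have : h \in (v :: s1) ++ u :: s2 by rewrite -(perm_mem hp) mem_head.
rewrite mem_cat => /orP[h1|h1].
  by move: e1 => /=; rewrite h1 => -[] e; rewrite e eqxx in hv.
by move: e2 => /=; rewrite h1 => -[] e; rewrite e eqxx in hu.
Qed.

Lemma uniq_shuffles s1 s2 : uniq (s1 ++ s2) -> uniq (shuffles s1 s2).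
Proof.
elim: s1 s2 => [|v s1 IH1] //; elim=> [|u s2 IH2] // us.
have inj (x : T) : injective (cons x) by move=> a b [].
rewrite shuffles_cons cat_uniq !map_inj_uniq // IH1 ?IH2 ?andbT /=.
- apply/hasPn => z /mapP[z' _ ->]; apply/mapP => -[z'' _ [e _]].
  by move: us; rewrite e /= mem_cat mem_head orbT.
- rewrite -[_ && _]/(uniq ((v :: s1) ++ s2)).
  by apply: subseq_uniq us; apply: cat_subseq; rewrite ?subseq_cons.
- by case/andP: us.
Qed.
End ShufflesEq.

(** * Cyclic orders and shuffles *)

Lemma listing_exists (S : finType) (q : seq S) : uniq q -> (forall a, a \in q) ->
  exists C : cycord S, listing C q.
Proof.
move=> uq aq.
have ii a b : index a q = index b q -> a = b.
  by move=> e; rewrite -(nth_index a (aq a)) e nth_index.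
have cx : cyc_axiom [set x : S * S * S | cyc_nat (index x.1.1 q) (index x.1.2 q) (index x.2 q)].
  apply/cyc_axiomP; rewrite /cyc_nat; split=> [a b d|a b d|a b d e|a b d]; rewrite !inE /=; try lia.
  rewrite !inE !negb_or andbT => /andP[/andP[/eqP ab /eqP ad] /eqP bd].
  have h1 : index a q <> index b q by move/ii.
  have h2 : index a q <> index d q by move/ii.
  have h3 : index b q <> index d q by move/ii.
  by move: h1 h2 h3; lia.
exists (exist (fun c => is_true (cyc_axiom c)) _ cx); apply/and3P; split=> //.
  exact/forallP.
by do 3![apply/forallP => ?]; rewrite /in_cyc inE.
Qed.

(** Cut at x, a cyclic order becomes the linear order [in_cyc C x], and a sorted list is determined
    by its elements. *)
Lemma listing_same (S : finType) (C : cycord S) x r r' :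
  listing C (x :: r) -> listing C (x :: r') -> r = r'.
Proof.
have srt q : listing C (x :: q) -> sorted (in_cyc C x) q.
  move=> lq; have /and3P[uq _ _] := lq; case: q lq uq => // y q lq uq.
  apply/(sortedP x) => i hi; rewrite (listing_cyc _ _ _ lq).
  have e k : nth x (y :: q) k = nth x [:: x, y & q] k.+1 by [].
  rewrite !e -{1}[x]/(nth x [:: x, y & q] 0) !index_uniq //; first by rewrite /cyc_nat; lia.
  by rewrite ltnW.
move=> h h'; have /and3P[u /forallP m _] := h; have /and3P[u' /forallP m' _] := h'.
apply: (@irr_sorted_eq _ (in_cyc C x)); [|..|exact: srt|exact: srt|].
- by move=> b a d; apply: cyc_trans.
- by move=> a; apply/negP => /cyc_uniq/and3P[_]; rewrite eqxx.
- move=> a; have := m a; have := m' a; rewrite !inE.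
  by case: eqVneq => [->|_ /= -> ->//]; move: u u' => /= /andP[/negbTE -> _] /andP[/negbTE -> _].
Qed.

Section ListingOf.
Variable n : nat.
Definition order_list (s : seq nat) : seq 'I_n.+3 :=
  [:: pto n, pti n, pt n 0 & [seq pt n k | k <- s]].

Lemma order_list_iota : order_list (iota 1 n) = enum 'I_n.+3.
Proof. by rewrite enum_std. Qed.

Lemma order_list_perm s : perm_eq s (iota 1 n) -> perm_eq (order_list s) (enum 'I_n.+3).
Proof. by move=> hs; rewrite -order_list_iota !perm_cons perm_map. Qed.

Lemma order_list_uniq s : perm_eq s (iota 1 n) -> uniq (order_list s).
Proof. by move=> /order_list_perm/perm_uniq->; apply: enum_uniq. Qed.

Lemma order_list_mem s x : perm_eq s (iota 1 n) -> x \in order_list s.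
Proof. by move=> /order_list_perm/perm_mem->; rewrite mem_enum. Qed.

Lemma index_order_list s k : perm_eq s (iota 1 n) -> (0 < k <= n)%N ->
  index (pt n k) (order_list s) = (index k s).+3.
Proof.
move=> hs hk; have ks : k \in s by rewrite (perm_mem hs) mem_iota; lia.
rewrite -[in LHS](nth_index 0 ks) -(nth_map 0 (pto n)) ?index_mem //.
rewrite -[nth _ _ _]/(nth (pto n) (order_list s) (index k s).+3).
by rewrite index_uniq ?order_list_uniq //= !ltnS size_map index_mem.
Qed.

Lemma index_order_list_o s : perm_eq s (iota 1 n) -> index (pto n) (order_list s) = 0%N.
Proof. by move=> hs; rewrite /= eqxx. Qed.

Lemma index_order_list_i s : perm_eq s (iota 1 n) -> index (pti n) (order_list s) = 1%N.
Proof. by move=> hs; rewrite -[pti n]/(nth (pto n) (order_list s) 1) index_uniq ?order_list_uniq. Qed.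

Lemma index_order_list_0 s : perm_eq s (iota 1 n) -> index (pt n 0) (order_list s) = 2.
Proof. by move=> hs; rewrite -[pt n 0]/(nth (pto n) (order_list s) 2) index_uniq ?order_list_uniq. Qed.

(** The value [std n] is a mere default: for a permutation of 1, ..., n an order with this listing
    exists. *)
Definition cyc_order s : cycord 'I_n.+3 := odflt (std n) [pick C | listing C (order_list s)].

Lemma cyc_orderP s : perm_eq s (iota 1 n) -> listing (cyc_order s) (order_list s).
Proof.
move=> hs; rewrite /cyc_order; case: pickP => // h.
have [C] := listing_exists (order_list_uniq hs) (fun x => order_list_mem x hs).
by rewrite h.
Qed.

Lemma order_list_inj s s' : perm_eq s (iota 1 n) -> perm_eq s' (iota 1 n) ->
  order_list s = order_list s' -> s = s'.
Proof.
move=> hs hs' [] e; have h r : perm_eq r (iota 1 n) -> [seq (nat_of_ord x).-2 | x <- [seq pt n k | k <- r]] = r.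
  move=> hr; rewrite -map_comp -[RHS]map_id; apply/eq_in_map => k.
  by rewrite (perm_mem hr) mem_iota => hk /=; rewrite val_pt //; lia.
by rewrite -(h s) // e h.
Qed.

End ListingOf.

Lemma filter_index (T : eqType) (s : seq T) (a : pred T) x0 i j : uniq s ->
  (i < j < size [seq x <- s | a x])%N ->
  (index (nth x0 [seq x <- s | a x] i) s < index (nth x0 [seq x <- s | a x] j) s)%N.
Proof.
move=> us hij; pose e x y := (index x s < index y s)%N.
have te : transitive e by move=> y x z; apply: ltn_trans.
have ss : sorted e s.
  by apply/(sortedP x0) => k hk; rewrite /e !index_uniq // ltnW.
have := sorted_filter te a ss => /(sorted_ltn_nth te x0).
by case/andP: hij => h1 h2; apply; rewrite ?inE // (ltn_trans h1 h2).
Qed.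

Section Merge.
Variables (w q : nat).
Hypothesis hq : (0 < q)%N.
Notation n := (w + q)%N.

Let f v := (if v < 3 then v else v + w)%N.
Lemma rest_bound x : (x < q.+3)%N -> (f x < n.+3)%N. Proof. by rewrite /f; case: ifP; lia. Qed.
Lemma rest_inj x y : (x < q.+3)%N -> (y < q.+3)%N -> f x = f y -> x = y.
Proof. by rewrite /f; do 2!case: ifP; lia. Qed.
Definition rest_pts : embedding 'I_q.+3 'I_n.+3 := ord_emb rest_bound rest_inj.
Lemma rest_ptsE x : rest_pts x = (if x < 3 then x : nat else x + w)%N :> nat.
Proof. exact: ord_embE. Qed.

Lemma merge_pushout : is_pushout (three w) (three q) (first_pts w hq) rest_pts.
Proof.
apply: pushoutP; [exact: emb_inj|exact: emb_inj|..].
- by move=> k; have hk := ltn_ord k; apply: ord_inj; rewrite first_ptsE rest_ptsE !threeE hk.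
- move=> x; have hx := ltn_ord x; have [h|h] := ltnP x w.+3.
    by left; exists (inord x); apply: ord_inj; rewrite first_ptsE inordK.
  right; exists (inord (x - w)); apply: ord_inj; rewrite rest_ptsE inordK; last by lia.
  by case: ifP; lia.
- move=> y1 y2 /(congr1 (@nat_of_ord _)); rewrite first_ptsE rest_ptsE => e.
  have h1 := ltn_ord y1; have h2 := ltn_ord y2.
  exists (inord y2); split; apply: ord_inj.
    by rewrite threeE inordK; move: e; case: ifP; lia.
  by rewrite threeE inordK //; move: e; case: ifP; lia.
Qed.

Lemma rest_o : rest_pts (pto q) = pto n.
Proof. by apply: ord_inj; rewrite rest_ptsE !val_pto. Qed.
Lemma rest_i : rest_pts (pti q) = pti n.
Proof. by apply: ord_inj; rewrite rest_ptsE !val_pti. Qed.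
Lemma rest_0 : rest_pts (pt q 0) = pt n 0.
Proof. by apply: ord_inj; rewrite rest_ptsE !val_pt. Qed.
Lemma rest_pt k : (0 < k <= q)%N -> rest_pts (pt q k) = pt n (w + k).
Proof. by move=> hk; apply: ord_inj; rewrite rest_ptsE !val_pt; try lia; case: ifP; lia. Qed.

Definition merges (C : cycord 'I_n.+3) :=
  cyc_emb (first_pts w hq) (std w) C && cyc_emb rest_pts (std q) C.

Notation L1 := (iota 1 w).
Notation L2 := (iota w.+1 q).

Lemma labels_cat : L1 ++ L2 = iota 1 n.
Proof. by rewrite iotaD add1n. Qed.

Lemma labels_uniq : uniq (L1 ++ L2).
Proof. by rewrite labels_cat iota_uniq. Qed.

Lemma cyc_emb_index a b (j : embedding 'I_a 'I_b) (C : cycord 'I_b) s : listing C s ->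
  (forall x y : 'I_a, (x < y)%N -> (index (j x) s < index (j y) s)%N) ->
  cyc_emb j (cyc_std a) C.
Proof.
move=> ls h; apply/cyc_embP => x y z; rewrite in_cyc_std (listing_cyc _ _ _ ls) /cyc_nat.
have ff u v : (index (j u) s < index (j v) s)%N = (u < v)%N.
  case: (ltngtP u v) => [/h->//|/h h'|/ord_inj->]; rewrite ?ltnn //.
  by rewrite ltnNge (ltnW h').
by rewrite !ff.
Qed.

Lemma shuffle_merges s : s \in shuffles L1 L2 -> merges (cyc_order n s).
Proof.
rewrite mem_shuffles ?labels_uniq // labels_cat => /and3P[hs /eqP f1 /eqP f2].
have us : uniq s by rewrite (perm_uniq hs) iota_uniq.
have ls := cyc_orderP hs.
have i1 x y : (0 < x < y)%N -> (y <= w)%N -> (index x s < index y s)%N.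
  move=> hx hy; have := @filter_index _ s (mem L1) 0 x.-1 y.-1 us.
  rewrite [X in size X]f1 [X in nth _ X]f1 size_iota !nth_iota ?add1n ?prednK //; lia.
have i2 x y : (0 < x < y)%N -> (y <= q)%N -> (index (w + x)%N s < index (w + y)%N s)%N.
  move=> hx hy; have := @filter_index _ s (mem L2) 0 x.-1 y.-1 us.
  rewrite [X in size X]f2 [X in nth _ X]f2 size_iota !nth_iota; try lia.
  by rewrite !addSnnS !prednK; lia.
have sp m (x : 'I_m.+3) : [\/ x = pto m, x = pti m, x = pt m 0 | exists2 k, x = pt m k & (0 < k <= m)%N].
  have hx := ltn_ord x; case e : (nat_of_ord x) => [|[|[|k]]].
  - by apply: Or41; apply: ord_inj; rewrite val_pto.
  - by apply: Or42; apply: ord_inj; rewrite val_pti.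
  - by apply: Or43; apply: ord_inj; rewrite val_pt.
  - by apply: Or44; exists k.+1; [apply: ord_inj; rewrite val_pt //; lia|lia].
apply/andP; split; apply: (cyc_emb_index ls) => x y.
  case: (sp _ x) => [->|->|->|[k -> hk]]; case: (sp _ y) => [->|->|->|[l -> hl]];
  rewrite ?first_o ?first_i ?first_pt ?index_order_list_o ?index_order_list_i ?index_order_list_0
    ?index_order_list ?val_pto ?val_pti ?val_pt //; try lia.
  by move=> kl; rewrite !ltnS; apply: i1; lia.
case: (sp _ x) => [->|->|->|[k -> hk]]; case: (sp _ y) => [->|->|->|[l -> hl]];
rewrite ?rest_o ?rest_i ?rest_0 ?rest_pt ?index_order_list_o ?index_order_list_i ?index_order_list_0
  ?index_order_list ?val_pto ?val_pti ?val_pt //; try lia.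
by move=> kl; rewrite !ltnS; apply: i2; lia.
Qed.

(** Cut at 0, the cyclic order C is a linear order [e] on the labels, and s is the list sorted by
    it. The conditions on both factors place oo and the point 1 before all labels and make the
    labels of each factor increase. *)
Lemma merges_shuffle C : merges C -> exists2 s, s \in shuffles L1 L2 & C = cyc_order n s.
Proof.
case/andP => /cyc_embP h1 /cyc_embP h2.
pose e a b := in_cyc C (pto n) (pt n a) (pt n b).
have te : transitive e by move=> b a d; apply: cyc_trans.
have ie : irreflexive e by move=> a; apply/negP => /cyc_uniq/and3P[_]; rewrite eqxx.
have e1 a b : (a < b <= w)%N -> e a b.
  move=> hab; have := h1 (pto w) (pt w a) (pt w b).
  rewrite first_o !first_pt; try lia.
  by rewrite /e => <-; rewrite in_cyc_std val_pto !val_pt /cyc_nat; lia.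
have e2 a b : (0 < a < b)%N -> (b <= q)%N -> e (w + a)%N (w + b)%N.
  move=> ha hb; have := h2 (pto q) (pt q a) (pt q b).
  rewrite rest_o !rest_pt; try lia.
  by rewrite /e => <-; rewrite in_cyc_std val_pto !val_pt /cyc_nat; lia.
have e0 b : (0 < b <= n)%N -> e 0%N b.
  move=> hb; have [hw|hw] := leqP b w; first by apply: e1; lia.
  have := h2 (pto q) (pt q 0) (pt q (b - w)).
  rewrite rest_o rest_0 rest_pt ?subnKC; try lia.
  by rewrite /e => <-; rewrite in_cyc_std val_pto !val_pt /cyc_nat; lia.
have ei : in_cyc C (pto n) (pti n) (pt n 0).
  by rewrite -(first_o w hq) -(first_i w hq) -(@first_pt w q hq 0) // -h1 in_cyc_std val_pto val_pti val_pt.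
(* Sorting asks for a total relation, hence the reflexive closure; as labels are distinct, the
   sorted list is strictly sorted for [e]. *)
pose r a b := (a == b) || e a b.
have tr : {in mem (iota 1 n) &, total r}.
  move=> a b; rewrite !mem_iota => ha hb; rewrite /r eq_sym.
  have [//|ab /=] := eqVneq b a.
  have /cyc_total : uniq [:: pto n; pt n a; pt n b].
    rewrite /= !inE -!val_eqE /= !val_pto !val_pt; lia.
  by move=> /(_ C) /orP[h|/cyc_rot/cyc_rot h]; rewrite /e h ?orbT.
pose s := sort r (iota 1 n).
have hs : perm_eq s (iota 1 n) by rewrite perm_sort.
have us : uniq s by rewrite (perm_uniq hs) iota_uniq.
have ss : sorted e s.
  have := sort_sorted_in tr (s := iota 1 n) (introT allP (fun x h => h)).
  rewrite -/s => /(sortedP 0) h; apply/(sortedP 0) => i hi.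
  have := h i hi; rewrite /r => /orP[/eqP /eqP|//].
  by rewrite nth_uniq ?(ltnW hi) //; lia.
exists s; last first.
  apply: (listing_uniq _ (cyc_orderP hs)).
  apply: (@cyc_listing _ _ (pto n)); first exact: order_list_uniq.
    by move=> a; apply: order_list_mem.
  have sz : size s = n by rewrite (perm_size hs) size_iota.
  case=> [//|[|[|j]]] _ hj.
  - exact: ei.
  - rewrite /=; move: hj; rewrite /= size_map sz => hj.
    by rewrite (nth_map 0) ?sz //; apply: e0; rewrite -(mem_iota 1) -(perm_mem hs) mem_nth ?sz.
  - move: hj; rewrite /= size_map sz => hj.
    rewrite !(nth_map 0) ?sz //; last by lia.
    by apply: (sortedP 0 ss); rewrite sz.
rewrite mem_shuffles ?labels_uniq // labels_cat hs /=; apply/andP; split; apply/eqP.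
  apply: (irr_sorted_eq te ie); first exact: sorted_filter.
    by apply/(sortedP 0) => i; rewrite size_iota => hi; rewrite !nth_iota ?(ltnW hi) //; apply: e1; lia.
  by move=> x; rewrite mem_filter (perm_mem hs) -labels_cat mem_cat; case: (x \in L1).
apply: (irr_sorted_eq te ie); first exact: sorted_filter.
  apply/(sortedP 0) => i; rewrite size_iota => hi; rewrite !nth_iota ?(ltnW hi) //.
  by rewrite !addSnnS; apply: e2; lia.
by move=> x; rewrite mem_filter (perm_mem hs) -labels_cat mem_cat orbC; case: (x \in L2).
Qed.

Lemma sum_merges (V : nmodType) (g : cycord 'I_n.+3 -> V) :
  \sum_(C | merges C) g C = \sum_(s <- shuffles L1 L2) g (cyc_order n s).
Proof.
have hp s : s \in shuffles L1 L2 -> perm_eq s (iota 1 n).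
  by rewrite mem_shuffles ?labels_uniq // labels_cat => /and3P[].
rewrite -big_filter -[RHS](big_map (cyc_order n) xpredT); apply: perm_big; apply: uniq_perm.
- exact/filter_uniq/index_enum_uniq.
- rewrite map_inj_in_uniq; first exact/uniq_shuffles/labels_uniq.
  move=> s s' /hp hs /hp hs' e.
  apply: (order_list_inj hs hs').
  have h' : listing (cyc_order n s) (order_list n s') by rewrite e; apply: cyc_orderP.
  by congr cons; apply: (listing_same (cyc_orderP hs) h').
move=> C; rewrite mem_filter mem_index_enum andbT.
apply/idP/mapP => [/merges_shuffle[s h1 h2]|[s hs ->]]; last exact: shuffle_merges.
by exists s.
Qed.
End Merge.

(** * Words *)

Lemma seq_of_word_rec_pos c z : all (ltn 0) (seq_of_word_rec c z).
Proof. by elim: z c => //= -[] z IH c /=. Qed.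

(** A final run of letters x is lost in the conversion, so the word has to end in y; the default of
    [last] admits the empty word when no x is pending. *)
Lemma sumn_seq_of_word_rec c z : last (c == 0%N) z ->
  sumn (seq_of_word_rec c z) = (c + size z)%N.
Proof.
elim: z c => [|[] z IH] c /=; first by move/eqP->.
  by move=> h; rewrite IH // add0n addSnnS.
by move=> h; rewrite (IH c.+1) // addSnnS.
Qed.

(** Partial sums are the positions of the letters y, counted from 1 and shifted by the c pending
    letters x. *)
Lemma mem_psums_word_rec c z m :
  (m \in psums (seq_of_word_rec c z)) = (c < m)%N && nth false z (m - c.+1).
Proof.
elim: z c m => [|[] z IH] c m; first by rewrite nth_nil andbF.
- rewrite -[seq_of_word_rec _ _]/(c.+1 :: seq_of_word_rec 0 z) psums_cons inE.
  apply/orP/andP => [[/eqP->|/mapP[d + ->]]|[cm hm]].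
  + by rewrite subnn.
  + rewrite IH => /andP[d0 hd]; split; first by lia.
    by rewrite (_ : (c.+1 + d - c.+1)%N = (d - 1).+1) //; lia.
  + have [->|mc] := eqVneq m c.+1; [by left|right].
    apply/mapP; exists (m - c.+1)%N; last by lia.
    rewrite IH; apply/andP; split; first by lia.
    have e : (m - c.+1)%N = (m - c.+1 - 1).+1 by lia.
    by move: hm; rewrite {1}e.
- rewrite -[seq_of_word_rec _ _]/(seq_of_word_rec c.+1 z) IH.
  have [h|h] := ltnP c.+1 m.
    by rewrite (ltn_trans (ltnSn c) h) (_ : (m - c.+1)%N = (m - c.+2).+1) //; lia.
  by rewrite (_ : (m - c.+1)%N = 0%N) ?andbF //; lia.
Qed.

Lemma word_of_seq_cons x k :
  word_of_seq (x :: k) = rcons (nseq x.-1 false) true ++ word_of_seq k.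
Proof. by []. Qed.

Lemma word_of_seqK k : all (ltn 0) k -> seq_of_word (word_of_seq k) = k.
Proof.
elim: k => //= x k IH /andP[x0 hk]; rewrite /seq_of_word word_of_seq_cons cat_rcons.
have h c p z : seq_of_word_rec c (nseq p false ++ true :: z) = (c + p).+1 :: seq_of_word z.
  by elim: p c => [|p IHp] c /=; rewrite ?addn0 // IHp addSnnS.
by rewrite h IH // add0n prednK.
Qed.

Lemma size_word_of_seq k : all (ltn 0) k -> size (word_of_seq k) = sumn k.
Proof.
elim: k => //= x k IH /andP[x0 hk]; rewrite word_of_seq_cons size_cat IH // size_rcons size_nseq.
by rewrite prednK.
Qed.

Lemma last_word_of_seq k b : last b (word_of_seq k) = if k is [::] then b else true.
Proof.
elim: k b => //= x k IH b; rewrite word_of_seq_cons last_cat last_rcons IH.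
by case: k {IH}.
Qed.

Lemma mem_psums k m : all (ltn 0) k -> (m \in psums k) = (0 < m)%N && nth false (word_of_seq k) m.-1.
Proof. by move=> hk; rewrite -{1}(word_of_seqK hk) mem_psums_word_rec subn1. Qed.

(** Together with [head_shuffle] this shows that shuffles of words that begin with x and end in y do
    so as well, which is the convergence of the resulting sequences. *)
Lemma last_shuffle (T : eqType) (P : pred T) d s1 s2 s : P (last d s1) -> P (last d s2) ->
  s \in shuffles s1 s2 -> P (last d s).
Proof.
elim: s d s1 s2 => [|h z IH] d [|v s1] [|u s2] h1 h2;
  try by [|rewrite ?shuffles_nil mem_seq1 => /eqP->].
  by rewrite shuffles_cons mem_cat => /orP[] /mapP[].
by rewrite shuffles_cons mem_cat !mem_map_cons => /orP[/andP[/eqP-> ]|/andP[/eqP->]]; apply: IH.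
Qed.

Lemma head_shuffle (T : eqType) (P : pred T) d v s1 u s2 s : P v -> P u ->
  s \in shuffles (v :: s1) (u :: s2) -> P (head d s).
Proof.
move=> hv hu; rewrite shuffles_cons mem_cat.
by move=> /orP[] /mapP[z _ ->].
Qed.

(** * Relabelling *)

Section Relabel.
Variables (n : nat) (s : seq nat).
Hypothesis hs : perm_eq s (iota 1 n).

Let sz : size (order_list n s) = n.+3.
Proof. by rewrite (perm_size (order_list_perm hs)) size_enum_ord. Qed.

Lemma relabel_inj : injective (fun x : 'I_n.+3 => nth (pto n) (order_list n s) x).
Proof.
move=> x y /eqP; rewrite nth_uniq ?order_list_uniq ?sz //.
by move=> /eqP/ord_inj.
Qed.
Definition relabel : embedding 'I_n.+3 'I_n.+3 := Embedding relabel_inj.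
Lemma relabelE x : relabel x = nth (pto n) (order_list n s) x. Proof. by []. Qed.

Lemma relabel_cyc : cyc_emb relabel (std n) (cyc_order n s).
Proof.
apply/cyc_embP => a b d; rewrite in_cyc_std (listing_cyc _ _ _ (cyc_orderP hs)).
by rewrite !relabelE !index_uniq ?order_list_uniq ?sz.
Qed.

Lemma relabel_list : [seq relabel x | x <- enum 'I_n.+3] = order_list n s.
Proof.
apply: (@eq_from_nth _ (pto n)); rewrite size_map size_enum_ord ?sz // => i hi.
by rewrite (nth_map (pto n)) ?size_enum_ord // relabelE nth_enum_ord.
Qed.

Lemma relabel_o : relabel (pto n) = pto n.
Proof. by rewrite relabelE val_pto. Qed.
Lemma relabel_i : relabel (pti n) = pti n.
Proof. by rewrite relabelE val_pti. Qed.
Lemma relabel_pt k : (k <= n)%N -> relabel (pt n k) = pt n (nth 0%N (0%N :: s) k).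
Proof.
move=> hk; rewrite relabelE val_pt // -[LHS]/(nth (pto n) [seq pt n k | k <- 0%N :: s] k).
by rewrite (nth_map 0%N) // -[size _]/(size s).+1 (perm_size hs) size_iota.
Qed.

Lemma pull_zeta_letter (R : realType) (S S' : Type) (f : embedding S S') b q :
  pull f (@zeta_letter R S b q) = zeta_letter b (quad_map f q).
Proof.
rewrite /zeta_letter pull_scale pull_dcr; congr form_scale.
by apply/funext => z; rewrite cross_ratio_pull.
Qed.

Lemma relabel_letters (R : realType) (bt bt' : nat -> bool) :
  (forall m, (m < n)%N -> bt' m.+1 = bt (nth 0%N s m)) ->
  pull relabel (letters R n bt' (iota 1 n)) = letters R n bt s.
Proof.
move=> hb; rewrite /letters pull_wedges; congr wedges.
have szs : size s = n by rewrite (perm_size hs) size_iota.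
rewrite -[in RHS](mkseq_nth 0%N s) szs /mkseq -[iota 1 n]/(iota (1 + 0) n) iotaDl -!map_comp.
apply/eq_in_map => m; rewrite mem_iota => hm.
rewrite -[LHS]/(pull relabel (zeta_letter (bt' m.+1) (cubn n 0 m.+1))).
rewrite pull_zeta_letter hb; last by lia.
rewrite -[quad_map _ _]/(relabel (pt n m.+1), relabel (pt n 0), relabel (pto n), relabel (pti n)).
by rewrite relabel_o relabel_i !relabel_pt //; lia.
Qed.

Variables (R : realType) (A : comAlgType rat) (I : integral_data R A).
Hypothesis hI : formal_cell_zeta I.

Lemma relabel_integral B (bt : nat -> bool) : ends n B ->
  (forall m, (m < n)%N -> (m.+1 \in B) = bt (nth 0%N s m)) ->
  I (cyc_order n s) (orient (cyc_order n s) (simplicial_vol R (enum 'I_n.+3)))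
    (letters R n bt (iota 1 n)) = J I n [seq (0, b)%N | b <- B].
Proof.
move=> hB hb; have hB' := hB; case/and3P: hB' => uB aB _.
have aB0 : all (fun b => 0 < b <= n)%N B by apply: sub_all aB => b; lia.
have card3 : (3 <= #|'I_n.+3|)%N by rewrite card_ord.
have bf : bijective relabel by apply: injF_bij; apply: emb_inj.
set C := cyc_order n s; have ef : cyc_emb relabel (std n) C := relabel_cyc.
have [_ _ inv] := hI.
rewrite /J -(inv _ _ _ _ relabel _ _ card3 bf ef (o_st_orientation R n) (@top_ends R _ _ hB)).
rewrite /o_st (pull_orient bf ef) Omega_letters // (relabel_letters _ hb).
have -> : pull relabel (simplicial_vol R (enum 'I_n.+3)) = simplicial_vol R (order_list n s).
  rewrite -relabel_list /simplicial_vol pull_wedges simplicial_map -map_comp.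
  by congr wedges; apply: eq_map => q; rewrite /= pull_dcr.
have hs' : perm_eq (iota 1 n) s by rewrite perm_sym.
(* One sign reorders both the real volume form and the complex integrand, so it enters squared. *)
have [b wp] := wedges_perm hs'.
have -> : simplicial_vol R (enum 'I_n.+3) =
    form_sign b (simplicial_vol R (order_list n s)).
  rewrite /simplicial_vol -order_list_iota /= -!map_comp.
  by apply: (wp _ _ (fun k => dcr (cubn n 0 k))) => k; apply: homog_dcr.
rewrite [letters R n bt (iota 1 n)]wp; last first.
  by move=> m z vs hvs; rewrite /zeta_letter /form_scale homog_dcr // mulr0.
rewrite cellint_sign //.
- by rewrite mulrA -expr2 sqrr_sign mul1r.
- by exists (order_list n s); [exact: cyc_orderP|left].
rewrite -[wedges _]/(letters R n bt s) -(relabel_letters R hb) -Omega_letters //.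
rewrite /top_form card_ord (_ : (n.+3 - 3)%N = n); last by nlia.
apply/nice_regular/(nice_pull (or_introl ef)).
by apply: (nice_fits (chain_std n)); apply: fits_ends.
Qed.
End Relabel.

Lemma simplicial_vol_iota (F : fieldType) n : simplicial_vol F (enum 'I_n.+3) =
  wedges [seq dcr (cubn n 0 k) | k <- iota 1 n].
Proof. by rewrite /simplicial_vol simplicial_std iota_index -map_comp. Qed.

(** * Forms on the merged labels and the shuffle relation *)

Section MergeForms.
Variables (w q : nat).
Hypothesis hq : (0 < q)%N.
Notation n := (w + q)%N.
Notation j1 := (first_pts w hq).
Notation j2 := (rest_pts w hq).

Lemma first_quad k : (0 < k <= w)%N -> quad_map j1 (cubn w 0 k) = cubn n 0 k.
Proof.
move=> hk; rewrite -[quad_map _ _]/(j1 (pt w k), j1 (pt w 0), j1 (pto w), j1 (pti w)).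
by rewrite first_o first_i !first_pt //; lia.
Qed.

Lemma rest_quad k : (0 < k <= q)%N -> quad_map j2 (cubn q 0 k) = cubn n 0 (w + k).
Proof.
move=> hk; rewrite -[quad_map _ _]/(j2 (pt q k), j2 (pt q 0), j2 (pto q), j2 (pti q)).
by rewrite rest_o rest_i rest_0 rest_pt.
Qed.

(** The letter u is arbitrary so that one statement covers the volume form, for which u ignores its
    boolean, and the multiple zeta form. *)
Lemma merge_wedges (F : fieldType) (u : forall m, bool -> quad 'I_m.+3 -> form F 'I_m.+3)
    (bt bt1 bt2 : nat -> bool) :
  (forall m m' (f : embedding 'I_m.+3 'I_m'.+3) b x, pull f (u m b x) = u m' b (quad_map f x)) ->
  (forall k, (0 < k <= w)%N -> bt1 k = bt k) ->
  (forall k, (0 < k <= q)%N -> bt2 k = bt (w + k)%N) ->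
  wedge (pull j1 (wedges [seq u w (bt1 k) (cubn w 0 k) | k <- iota 1 w]))
        (pull j2 (wedges [seq u q (bt2 k) (cubn q 0 k) | k <- iota 1 q])) =
  wedges [seq u n (bt k) (cubn n 0 k) | k <- iota 1 n].
Proof.
move=> hu h1 h2; rewrite !pull_wedges -wedges_cat -labels_cat map_cat.
congr (wedges (_ ++ _)).
  by apply/eq_in_map => k; rewrite mem_iota => hk; rewrite hu first_quad ?h1 //; lia.
rewrite -[w.+1 in RHS]addn1 iotaDl -map_comp; apply/eq_in_map => k; rewrite mem_iota => hk.
by rewrite hu rest_quad ?h2 //; lia.
Qed.
End MergeForms.

Lemma word_of_convergent k : convergent k -> exists r, word_of_seq k = false :: r.
Proof.
case: k => // -[|[|x]] k /and3P[] // _ _ _.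
by exists (rcons (nseq x false) true ++ word_of_seq k).
Qed.

Section ShuffleRelation.
Variables (R : realType) (A : comAlgType rat) (I : integral_data R A).
Hypothesis hI : formal_cell_zeta I.
Hypothesis hsh : generalized_shuffle I.

Lemma shuffle_sum k l (bt : nat -> bool) : convergent k -> convergent l ->
  (forall m, (0 < m <= sumn k)%N -> (m \in psums k) = bt m) ->
  (forall m, (0 < m <= sumn l)%N -> (m \in psums l) = bt (sumn k + m)%N) ->
  let n := (sumn k + sumn l)%N in
  zetaI I k * zetaI I l = \sum_(s <- shuffles (iota 1 (sumn k)) (iota (sumn k).+1 (sumn l)))
    I (cyc_order n s) (orient (cyc_order n s) (simplicial_vol R (enum 'I_n.+3)))
      (letters R n bt (iota 1 n)).
Proof.
move=> hk hl h1 h2 n.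
have hq : (0 < sumn l)%N.
  by case/and3P: (ends_psums hl) => _ aL qL; have := allP aL _ qL; lia.
have := hsh (three_std _) (three_std _) (merge_pushout _ hq)
  (@diff_form_std R _) (o_st_orientation R _) (@diff_form_std R _) (o_st_orientation R _)
  (@top_zeta R _ hk) (@top_zeta R _ hl).
rewrite -!/(o_st _) -!/(zetaI _ _) => ->.
rewrite -(sum_merges hq (fun C => I C (orient C (simplicial_vol R (enum 'I_n.+3)))
  (letters R n bt (iota 1 n)))).
apply: eq_bigr => C _; congr (I C (orient C _) _).
  rewrite !simplicial_vol_iota.
  exact: (merge_wedges hq (u := fun m _ x => dcr x) (bt := bt) (fun m m' f _ => pull_dcr R f)).
rewrite !zeta_form_letters /letters.
have hu m m' (f : embedding 'I_m.+3 'I_m'.+3) b x :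
    pull f (@zeta_letter R _ b x) = zeta_letter b (quad_map f x) by apply: pull_zeta_letter.
have := merge_wedges hq hu h1 h2 => h.
exact: h.
Qed.

Lemma shuffle_relation k l : convergent k -> convergent l ->
  zetaI I k * zetaI I l = \sum_(s <- sh k l) zetaI I s.
Proof.
move=> hk hl; have [pk pl] := (convergent_pos hk, convergent_pos hl).
have [ek el] := (ends_psums hk, ends_psums hl).
set w := sumn k; set q := sumn l; set n := (w + q)%N.
(* The letters of both words on the labels 1, ..., n; the labels of l start at w + 1. *)
pose bt m := nth false (word_of_seq k ++ word_of_seq l) m.-1.
have sk : size (word_of_seq k) = w by apply: size_word_of_seq.
have sl : size (word_of_seq l) = q by apply: size_word_of_seq.
have b1 m : (0 < m <= w)%N -> (m \in psums k) = bt m.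
  by move=> hm; rewrite mem_psums // /bt nth_cat sk (_ : (m.-1 < w)%N); [case/andP: hm => ->|lia].
have b2 m : (0 < m <= q)%N -> (m \in psums l) = bt (w + m)%N.
  move=> hm; rewrite mem_psums // /bt nth_cat sk (_ : ((w + m).-1 < w)%N = false); last by lia.
  by case/andP: hm => -> _; congr (nth _ _ _); lia.
rewrite (shuffle_sum hk hl b1 b2) -/w -/q -/n.
have ew : word_of_seq k = [seq bt m | m <- iota 1 w].
  apply: (@eq_from_nth _ false); [by rewrite size_map size_iota|rewrite sk => i hi].
  by rewrite (nth_map 0%N) ?size_iota // nth_iota // /bt nth_cat sk hi.
have eq : word_of_seq l = [seq bt m | m <- iota w.+1 q].
  apply: (@eq_from_nth _ false); [by rewrite size_map size_iota|rewrite sl => i hi].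
  rewrite (nth_map 0%N) ?size_iota // nth_iota // /bt -[(w.+1 + i).-1]/(w + i)%N.
  by rewrite nth_cat sk ltnNge leq_addr addKn.
rewrite /sh ew eq sh_word_map !big_map big_seq [RHS]big_seq; apply: eq_bigr => s hs.
have hp : perm_eq s (iota 1 n).
  by move: hs; rewrite mem_shuffles ?labels_uniq // labels_cat => /and3P[].
have szs : size s = n by rewrite (perm_size hp) size_iota.
set z := [seq bt m | m <- s]; have szz : size z = n by rewrite size_map.
have zs : z \in shuffles (word_of_seq k) (word_of_seq l).
  have := map_f (map bt) hs; rewrite -sh_word_map -ew -eq.
  by have := sh_word_map id (word_of_seq k) (word_of_seq l); rewrite !map_id (eq_map (@map_id _)) map_id => ->.
have sz : sumn (seq_of_word z) = n.
  rewrite /seq_of_word sumn_seq_of_word_rec ?szz // eqxx.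
  by apply: (last_shuffle (P := id) _ _ zs); rewrite last_word_of_seq; [case: (k)|case: (l)].
have pz : all (ltn 0) (seq_of_word z) by apply: seq_of_word_rec_pos.
have q0 : (0 < q)%N by case/and3P: el => _ aL qL; have := allP aL _ qL; lia.
have hz : ~~ head true z.
  have [[r er] [r' er']] := (word_of_convergent hk, word_of_convergent hl).
  by move: zs; rewrite er er'; apply: head_shuffle.
have mz m : (m \in psums (seq_of_word z)) = (0 < m)%N && nth false z m.-1.
  by rewrite mem_psums_word_rec subn1.
(* The letter at position m + 1 of the word z is the letter of the label in that position, as
   [relabel_integral] requires. *)
rewrite zetaI_J // sz; apply: relabel_integral => //; last first.
  by move=> m hm; rewrite mz /= (nth_map 0%N) ?szs.
apply/and3P; split; first exact: psums_uniq.
  apply/allP => b hb; have := psums_bounds pz hb; rewrite sz => /andP[b0 ->]; rewrite andbT.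
  (* A partial sum equal to 1 would mean that the word begins with y. *)
  rewrite ltn_neqAle b0 andbT; apply/eqP => e.
  by move: hb hz; rewrite -e mz /= nth0; case: (z) => //= -[].
rewrite -[X in X \in _]sz; apply: psums_last; apply/eqP => e.
by move: sz; rewrite e /=; lia.
Qed.
End ShuffleRelation.

Theorem theorem1 (R : realType) (A : comAlgType rat) (I : integral_data R A)
    (hI : formal_cell_zeta I)
    (hsh : generalized_shuffle I) (hst : generalized_stuffle I)
    (k l : seq nat) (hk : convergent k) (hl : convergent l) :
  zetaI I k * zetaI I l = \sum_(s <- sh k l) zetaI I s /\
  zetaI I k * zetaI I l = \sum_(s <- st k l) zetaI I s.
Proof.
by split; [exact: shuffle_relation|exact: stuffle_relation].
Qed.
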